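(* Let $d\in\mathbf{N}$, let $n\ge 0$ be an integer, let $\Omega\subset\mathbf{R}^d$ be a bounded domain, and let $\sigma\in W^{k,\infty}(\mathbf{R})\setminus\{0\}$ with $k$ an integer, $k\ge n$. Let $\varphi\in\mathscr{S}(\mathbf{R})\setminus\{0\}$ be real-valued, let $\phi\in\mathscr{S}(\mathbf{R}^d)\setminus\{0\}$, and fix $(t,\tau)\in\mathbf{R}^2$ with $\tau\neq 0$ and $(V_\varphi\sigma)(t,\tau)\neq 0$. Define $$\mathbb{D}=\Big\{x\mapsto \sigma\big(\tfrac{\eta\cdot x}{\tau}+b\big)\,\varphi\big(\tfrac{\eta\cdot x}{\tau}+b-t\big)\,\phi(x-y)\;:\;(y,\eta,b)\in\mathbf{R}^d\times\mathbf{R}^d\times\mathbf{R}\Big\}.$$ Then for any $2\le r<\infty$ and any $f\in B_{n+1}(\mathbf{R}^d)$ there exists a constant $C>0$ such that $$\inf_{f_N\in\Sigma_N(\mathbb{D})}\|f-f_N\|_{W^{n,r}(\Omega)}\le C\,N^{-1/2}\,|\Omega+\Omega|\,\|f\|_{B_{n+1}}$$ for all $N\in\mathbf{N}$. If $\Omega$ is convex, then there exists a constant $C>0$ such that $$\inf_{f_N\in\Sigma_N(\mathbb{D})}\|f-f_N\|_{W^{n,r}(\Omega)}\le 2C\,N^{-1/2}\,|\Omega|\,\|f\|_{B_{n+1}}$$ for all $N\in\mathbf{N}$.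
   Context: Notation. $\mathscr{S}$ is the Schwartz class and $\mathscr{S}'$ the tempered distributions. $|\cdot|$ applied to sets is Lebesgue measure and $\Omega+\Omega=\{x+y:x,y\in\Omega\}$. Fourier transform: $\hat f(\xi)=\int f(x)e^{-2\pi i x\cdot\xi}dx$. Barron space: $B_s(\mathbf{R}^d)=\{f\in\mathscr{S}'(\mathbf{R}^d):\|f\|_{B_s}=\int_{\mathbf{R}^d}(1+|\xi|)^s|\hat f(\xi)|\,d\xi<\infty\}$. Short-time Fourier transform on $\mathbf{R}$: $(V_\varphi\sigma)(x,\omega)=\int_{\mathbf{R}}\sigma(y)\overline{\varphi(y-x)}e^{-2\pi i y\omega}\,dy$. Sobolev norm: $\|h\|_{W^{n,r}(\Omega)}=\big(\sum_{|\alpha|\le n}\|\partial^\alpha h\|_{L^r(\Omega)}^r\big)^{1/r}$. For a dictionary (a set of functions) $\mathbb{D}$, $\Sigma_N(\mathbb{D})=\{\sum_{j=1}^N a_jh_j: h_j\in\mathbb{D},\ a_j\in\mathbf{C}\}$. *)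

(* Defs.v *)
From HB Require Import structures.
From mathcomp Require Import all_boot all_order all_algebra.
From mathcomp Require Import all_classical all_reals all_analysis.
From mathcomp.real_closed Require Import complex.

Set Implicit Arguments.
Unset Strict Implicit.
Unset Printing Implicit Defensive.

Import Order.TTheory GRing.Theory Num.Theory.
Import numFieldNormedType.Exports.

Local Open Scope classical_set_scope.
Local Open Scope ring_scope.
Local Open Scope complex_scope.

Definition rV_display : measure_display. Proof. exact. Qed.

Section measurable_rV.
Context {R : realType} (n : nat).

Let coord (i : 'I_n) (x : 'rV[R]_n) : R := x 0 i.

Let rV_set0 : g_sigma_preimage coord set0.
Proof. exact: sigma_algebra0. Qed.

Let rV_setC A : g_sigma_preimage coord A -> g_sigma_preimage coord (~` A).
Proof. exact: sigma_algebraC. Qed.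

Let rV_bigcup (F : (set 'rV[R]_n)^nat) :
  (forall i, g_sigma_preimage coord (F i)) ->
  g_sigma_preimage coord (\bigcup_i (F i)).
Proof. exact: sigma_algebra_bigcup. Qed.

(* The product sigma-algebra, i.e. the Borel sigma-algebra of R^n. *)
HB.instance Definition _ := @isMeasurable.Build rV_display
  'rV[R]_n (g_sigma_preimage coord) rV_set0 rV_setC rV_bigcup.

Lemma measurable_coord (i : 'I_n) :
  measurable_fun [set: 'rV[R]_n] (fun x : 'rV[R]_n => x 0 i).
Proof.
move=> _ Y mY; rewrite setTI; apply: sub_sigma_algebra => /=.
rewrite -bigcup_seq/=; exists i => /=; first by rewrite mem_index_enum.
by exists Y => //; rewrite setTI.
Qed.

Lemma measurable_fun_rV d (T : measurableType d) (f : T -> 'rV[R]_n) :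
  (forall i, measurable_fun [set: T] (fun t => f t 0 i)) ->
  measurable_fun [set: T] f.
Proof.
move=> mf _ Y; rewrite setTI.
suff : (measurable : set (set 'rV[R]_n)) `<=` [set Y | measurable (f @^-1` Y)].
  by apply.
apply: smallest_sub.
  split => /= [|A mA|F mF].
  - by rewrite preimage_set0.
  - by rewrite setTD -preimage_setC; exact: measurableC.
  - by rewrite preimage_bigcup; exact: bigcup_measurable.
rewrite -bigcup_seq; apply: bigcup_sub => i _ A [B mB <-] /=.
by have := mf i measurableT B mB; rewrite !setTI.
Qed.

End measurable_rV.

Section lebesgue_rV.
Context {R : realType}.

Definition rV_cons n (p : measurableTypeR R * 'rV[R]_n) : 'rV[R]_n.+1 :=
  \row_i oapp (p.2 0) p.1 (unlift ord0 i).

Definition rV_uncons n (v : 'rV[R]_n.+1) : measurableTypeR R * 'rV[R]_n :=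
  (v 0 ord0, \row_j v 0 (lift ord0 j)).

Lemma rV_consK n : cancel (@rV_cons n) (@rV_uncons n).
Proof.
move=> [x v]; rewrite /rV_uncons; congr pair; first by rewrite mxE unlift_none.
by apply/rowP => j; rewrite !mxE liftK.
Qed.

Lemma measurable_rV_cons n : measurable_fun setT (@rV_cons n).
Proof.
apply: measurable_fun_rV => i.
under eq_fun do rewrite mxE.
case: (unliftP ord0 i) => [j|] _ /=; last exact: measurable_fst.
exact: (measurableT_comp (measurable_coord j) measurable_snd).
Qed.

HB.instance Definition _ n :=
  isMeasurableFun.Build _ _ _ _ (@rV_cons n) (@measurable_rV_cons n).

Lemma measurable_rV_uncons n : measurable_fun setT (@rV_uncons n).
Proof.
apply/measurable_fun_pairP; split => /=; first exact: measurable_coord.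
apply: measurable_fun_rV => j /=.
under eq_fun do rewrite mxE.
exact: measurable_coord.
Qed.

Section step.
Context (n : nat) (mu : {sigma_finite_measure set 'rV[R]_n -> \bar R}).

Definition leb_step : set 'rV[R]_n.+1 -> \bar R :=
  pushforward (@lebesgue_measure R \x mu)%E (@rV_cons n).

Let leb_step0 : leb_step set0 = 0%E.
Proof. exact: measure0. Qed.

Let leb_step_ge0 A : (0 <= leb_step A)%E.
Proof. exact: measure_ge0. Qed.

Let leb_step_sigma_additive : semi_sigma_additive leb_step.
Proof. exact: measure_semi_sigma_additive. Qed.

HB.instance Definition _ := isMeasure.Build _ _ _ leb_step
  leb_step0 leb_step_ge0 leb_step_sigma_additive.

Lemma leb_step_sigma_finite : sigma_finite setT leb_step.
Proof.
have /sigma_finiteP[F [TF ndF Foo]] := sigma_finiteT (@lebesgue_measure R).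
have /sigma_finiteP[G [TG ndG Goo]] := sigma_finiteT mu.
exists (fun k => @rV_uncons n @^-1` (F k `*` G k)).
  rewrite -preimage_bigcup (_ : \bigcup_k (F k `*` G k) = setT).
    by rewrite preimage_setT.
  rewrite -setXTT TF TG predeqE => -[x y]; split.
    by move=> [k _ []/= ? ?]; split; exists k.
  move=> [/= [k _ Fkx] [l _ Gly]]; exists (maxn k l) => //; split.
    by move: x Fkx; exact/subsetPset/ndF/leq_maxl.
  by move: y Gly; exact/subsetPset/ndG/leq_maxr.
move=> k; have [mF Fk] := Foo k; have [mG Gk] := Goo k.
have mFG : measurable (F k `*` G k) by exact: measurableX.
split; first by have := @measurable_rV_uncons n measurableT _ mFG; rewrite setTI.
rewrite /leb_step /pushforward -comp_preimage.
rewrite (_ : _ \o _ = id); last by apply/funext => p /=; rewrite rV_consK.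
rewrite preimage_id product_measure1E//.
by rewrite lte_mul_pinfty// ge0_fin_numE.
Qed.

HB.instance Definition _ :=
  Measure_isSigmaFinite.Build _ _ _ leb_step leb_step_sigma_finite.

End step.

(* Lebesgue measure on R^n, as the n-fold product of lebesgue_measure. *)
Fixpoint leb (n : nat) : {sigma_finite_measure set 'rV[R]_n -> \bar R} :=
  match n with
  | 0 => \d_ (0 : 'rV[R]_0)
  | m.+1 => leb_step (leb m)
  end.

End lebesgue_rV.

Arguments leb {R} n.

Section complex_functions.
Context {R : realType}.

Definition modulus (z : R[i]) : R := ComplexField.Normc.normc z.

Definition cexp (theta : R) : R[i] := cos theta +i* sin theta.

Section integral.
Context d (T : measurableType d) (mu : {measure set T -> \bar R}).

Definition cintegrable (D : set T) (f : T -> R[i]) :=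
  mu.-integrable D (EFin \o (@complex.Re R \o f)) /\
  mu.-integrable D (EFin \o (@complex.Im R \o f)).

Definition cintegral (D : set T) (f : T -> R[i]) : R[i] :=
  (\int[mu]_(x in D) complex.Re (f x)) +i* (\int[mu]_(x in D) complex.Im (f x)).

End integral.

Definition stft (phi sigma : R -> R[i]) (x omega : R) : R[i] :=
  cintegral (@lebesgue_measure R) setT
    (fun y => sigma y * conjc (phi (y - x)) * cexp (- (2 * pi * y * omega))).

End complex_functions.

Section euclidean_space.
Context {R : realType} {d : nat}.
Local Notation V := 'rV[R]_d.
Implicit Types (f g psi : V -> R[i]) (Omega : set V).

Definition dotp (x y : V) : R := \sum_(i < d) x 0 i * y 0 i.

Definition enorm (x : V) : R := Num.sqrt (dotp x x).

(* Derivatives, integrals and measurability of complex-valued functions are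
   taken on real and imaginary parts: R[i] is not an instance of
   normedModType R. *)
Definition partial (i : 'I_d) f : V -> R[i] := fun x =>
  ('D_(delta_mx 0 i) (@complex.Re R \o f) x) +i* ('D_(delta_mx 0 i) (@complex.Im R \o f) x).

Definition mpartial (a : 'I_d -> nat) f : V -> R[i] :=
  foldr (fun i => iter (a i) (partial i)) f (enum 'I_d).

Definition smooth f := forall s : seq 'I_d,
  let g := foldr partial f s in
  [/\ continuous (@complex.Re R \o g), continuous (@complex.Im R \o g) &
      forall (i : 'I_d) (x : V), derivable (@complex.Re R \o g) x (delta_mx 0 i) /\
                                 derivable (@complex.Im R \o g) x (delta_mx 0 i)].

Definition test_function Omega psi :=
  smooth psi /\
  exists K, [/\ compact K, K `<=` Omega & forall x, ~ K x -> psi x = 0].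

Definition schwartz_weight (a b : 'I_d -> nat) f (x : V) : R :=
  (\prod_(i < d) `|x 0 i| ^+ a i) * modulus (mpartial b f x).

Definition schwartz_seminorm (a b : 'I_d -> nat) f : R :=
  sup (range (schwartz_weight a b f)).

Definition schwartz f :=
  smooth f /\ forall a b, has_ubound (range (schwartz_weight a b f)).

Definition fourier f (xi : V) : R[i] :=
  cintegral (leb d) setT (fun x => f x * cexp (- (2 * pi * dotp x xi))).

(* Distributions are encoded as functionals on all functions; only their
   values on test functions (on Schwartz functions, for tempered ones) are
   ever used. *)
Definition functional := (V -> R[i]) -> R[i].

Implicit Types u : functional.

Definition tempered u :=
  (forall (c : R[i]) f g, schwartz f -> schwartz g ->
     u (fun x => c * f x + g x) = c * u f + u g) /\
  (exists (C : R) (m : nat), forall f, schwartz f ->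
     modulus (u f) <= C * \sum_(a : {ffun 'I_d -> 'I_m.+1})
       \sum_(b : {ffun 'I_d -> 'I_m.+1}) schwartz_seminorm (fun i => a i) (fun i => b i) f).

Definition functional_of g : functional :=
  fun psi => cintegral (leb d) setT (fun x => g x * psi x).

Definition dist_mpartial (a : 'I_d -> nat) u : functional :=
  fun psi => (-1) ^+ (\sum_(i < d) a i) * u (mpartial a psi).

Definition dist_fourier u : functional := fun psi => u (fourier psi).

Definition loc_integrable Omega g :=
  forall K, compact K -> K `<=` Omega -> cintegrable (leb d) K g.

Definition represents Omega u g :=
  loc_integrable Omega g /\
  forall psi, test_function Omega psi ->
    u psi = cintegral (leb d) Omega (fun x => g x * psi x).

Definition Lp_norm Omega (p : \bar R) g : \bar R :=
  Lnorm (leb d) p (fun x => (modulus (g x) * \1_Omega x)%:E).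

(* Membership in W^{k,p}(Omega) for a function; p = +oo is allowed. *)
Definition sobolev (k : nat) (p : \bar R) Omega g :=
  loc_integrable Omega g /\
  forall a : 'I_d -> nat, (\sum_(i < d) a i <= k)%N ->
    exists2 h, represents Omega (dist_mpartial a (functional_of g)) h &
               (Lp_norm Omega p h < +oo)%E.

(* The W^{n,r}(Omega) norm of a distribution: the families of functions
   representing its weak derivatives are unique up to null sets, so that the
   infimum is over at most one value; it is +oo if a weak derivative is not a
   function. *)
Definition sobolev_norm (n : nat) (r : R) Omega u : \bar R :=
  ereal_inf
    [set ((\sum_(a : {ffun 'I_d -> 'I_n.+1} | (\sum_(i < d) a i <= n)%N)
             Lp_norm Omega r%:E (h a) `^ r) `^ r^-1)%E
    | h in [set h : {ffun 'I_d -> 'I_n.+1} -> (V -> R[i]) |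
        forall a : {ffun 'I_d -> 'I_n.+1}, (\sum_(i < d) a i <= n)%N ->
          represents Omega (dist_mpartial (fun i => a i) u) (h a)]].

(* As above, at most one value, and +oo if the Fourier transform of u is not
   a function. *)
Definition barron_norm (s : R) u : \bar R :=
  ereal_inf
    [set (\int[leb d]_xi ((1 + enorm xi) `^ s * modulus (g xi))%:E)%E
    | g in represents setT (dist_fourier u)].

Definition barron (s : R) : set functional :=
  [set u | tempered u /\ (barron_norm s u < +oo)%E].

Definition span_N (N : nat) (D : set (V -> R[i])) : set (V -> R[i]) :=
  [set f | exists (a : 'I_N -> R[i]) (h : 'I_N -> V -> R[i]),
     (forall j, D (h j)) /\ f = (fun x => \sum_(j < N) a j * h j x)].

Definition stft_dictionary (sigma phi1 : R -> R[i]) (phi : V -> R[i])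
    (t tau : R) : set (V -> R[i]) :=
  [set h | exists (y eta : V) (b : R),
     h = (fun x => sigma (dotp eta x / tau + b) *
                   phi1 (dotp eta x / tau + b - t) * phi (x - y))].

Definition approx_error (n : nat) (r : R) Omega u (F : set (V -> R[i])) :
    \bar R :=
  ereal_inf [set sobolev_norm n r Omega (fun psi => u psi - functional_of g psi)
            | g in F].

Definition sumset (A B : set V) : set V := [set x + y | x in A & y in B].

Definition bounded_domain Omega :=
  [/\ Omega !=set0, open Omega, connected Omega & bounded_set Omega].

End euclidean_space.

(* The identification of R^1, as 'rV_1, with the real line. *)
Definition on_line {R : realType} (f : R -> R[i]) : 'rV[R]_1 -> R[i] :=
  fun x => f (x 0 0).

(* Main.v *)
(* A Barron functional f equals integration against
   F x = kappa * int g(xi) e^{2 pi i xi.x} dxi: test functions are recovered from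
   their cut-off Fourier transforms through an approximate identity whose kernel
   |theta^|^2 is the Fourier transform of the autocorrelation of a bump theta.
   Choose zeta0 with phi^(zeta0) <> 0. Modulo two nonzero constants, one of them
   the value of the short-time Fourier transform at (t, tau), the plane wave
   e^{2 pi i xi.x} is the integral over (b, y) of the dictionary atoms of slope
   xi + zeta0 against unimodular factors. Rescaling b by a width of order 1 + |xi|
   makes the weak derivatives of these atoms of order at most n dominated by
   (1 + |xi|)^n times a fixed integrable weight in (b, y), the rescaling itself
   costing one more factor 1 + |xi|; this is where B_{n+1} enters. The parameters
   of an N-term approximation are then chosen greedily so as to keep the potential
   int_Omega sum exp(+- S / (2 sqrt N)) bounded, S being the partial sums of the
   normalized centered atoms and of their derivatives. The potential grows by a
   factor 1 + O(1/N) at each step, hence S is O(sqrt N) in every L^r(Omega). *)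

From HB Require Import structures.
Require Import Defs.
From mathcomp Require Import all_boot all_order all_algebra.
From mathcomp Require Import all_classical all_reals all_analysis.
From mathcomp.real_closed Require Import complex.
From mathcomp Require Import measurable_realfun ring lra.

Set Implicit Arguments.
Unset Strict Implicit.
Unset Printing Implicit Defensive.

Import Order.TTheory GRing.Theory Num.Theory.
Import numFieldNormedType.Exports.

Local Open Scope classical_set_scope.
Local Open Scope ring_scope.

(** * Lebesgue measure on row vectors *)

(** Four obstacles shape the proof. No explicit bump is built: either every test function on Omega
    is 0, and then all weak derivative conditions are vacuous and the error is 0, or some psi is
    nonzero and theta = |psi|^2 is the bump, its restriction to a line serving in dimension 1. The
    transform of phi may vanish at 0, so the y-integral is modulated by a frequency zeta0 where it
    does not, and the slope compensates. As sigma is only a bounded function with weak derivatives,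
    each of these is replaced by an everywhere bounded representative; a ridge of slope zero sees a
    single value of sigma, so the replacement is right only for almost every b, and sampled
    parameters must avoid a null set. Finally, in L^r with r > 2 the error is not a variance; an
    exponential dominates every power and sums over derivatives and signs, so one deterministic
    choice of parameters serves all derivatives at once. The constant is uniform in f and N; the
    measure of Omega or Omega + Omega, positive and finite, is divided into it at the end. *)

Section rV_topology.
Context {R : realType} (n : nat).
Implicit Types (x y : 'rV[R]_n).

Lemma rV_coord_le_norm x i : `|x 0 i| <= `|x|.
Proof.
rewrite -[`|x|]/(mx_norm x) mx_normrE.
exact: (le_bigmax 0 (fun i : 'I_1 * 'I_n => `|x i.1 i.2|) (0, i)).
Qed.

Lemma rV_norm_le x (e : R) : 0 <= e -> (forall i, `|x 0 i| <= e) -> `|x| <= e.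
Proof.
move=> e0 xe; rewrite -[`|x|]/(mx_norm x) mx_normrE bigmax_le// => -[i j] _ /=.
by rewrite ord1.
Qed.

Lemma rV_norm_lt x (e : R) : 0 < e -> (forall i, `|x 0 i| < e) -> `|x| < e.
Proof.
move=> e0 xe; rewrite -[`|x|]/(mx_norm x) mx_normrE bigmax_lt// => -[i j] _ /=.
by rewrite ord1.
Qed.

(** The sigma-algebra is generated by the coordinates, so an open set is written as a countable
    union of cubes with rational centres and radii [1 / (k + 1)], each a finite intersection of
    coordinate preimages. *)
Lemma open_measurable_rV (U : set 'rV[R]_n) : open U -> measurable U.
Proof.
move=> oU.
pose B (p : 'rV[rat]_n * nat) :=
  [set x : 'rV[R]_n | forall i, `|x 0 i - ratr (p.1 0 i)| < p.2.+1%:R^-1].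
pose F p := if `[< B p `<=` U >] then B p else set0.
suff -> : U = \bigcup_p F p.
  apply: countable_bigcupT_measurable; first exact: countableP.
  move=> p; rewrite /F; case: ifP => // _.
  rewrite (_ : B p = \bigcap_(i in [set` (index_enum 'I_n)])
    ((fun x : 'rV[R]_n => x 0 i) @^-1` (ball (ratr (p.1 0 i) : R) p.2.+1%:R^-1))).
    apply: fin_bigcap_measurable => // i _.
    rewrite -[X in measurable X]setTI; apply: measurable_coord => //.
    exact: measurable_ball.
  apply/seteqP; split => [x Bx i _ /=|x Bx i]; first by rewrite /ball/= distrC.
  by rewrite distrC; apply: Bx => /=; rewrite mem_index_enum.
apply/seteqP; split => [x Ux|x [p _]]; last first.
  by rewrite /F; case: asboolP => // BU; exact: BU.
have /nbhs_ballP[e /= e0 eU] := open_nbhs_nbhs (conj oU Ux).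
(* Two points of a cube of radius [1 / (k + 1)] are at distance at most [2 / (k + 1) < e], so the
   cube found around [x] stays in [U]. *)
pose k := Num.truncn (2 / e).
have ke : 2 * k.+1%:R^-1 < e.
  by rewrite ltr_pdivrMr ?ltr0n// mulrC -ltr_pdivrMr// truncnS_gt.
have /choice[q xq] : forall i, exists q : rat, `|x 0 i - ratr q| < k.+1%:R^-1.
  move=> i; have /rat_in_itvoo[q] : x 0 i < x 0 i + k.+1%:R^-1 by rewrite ltrDl invr_gt0.
  rewrite in_itv/= => /andP[q1 q2]; exists q.
  have k0 : 0 < k.+1%:R^-1 :> R by rewrite invr_gt0.
  rewrite ltr_distl; move: q1 q2 k0; move: (ratr q : R) (k.+1%:R^-1 : R) (x 0 i).
  by move=> *; apply/andP; split; lra.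
exists (\row_i q i, k) => //; rewrite /F.
have xB : B (\row_i q i, k) x by move=> i; rewrite /= mxE.
case: asboolP => // -[]; move=> y By; apply: eU.
rewrite mx_norm_ball /ball_/=; apply: (@le_lt_trans _ _ (2 * k.+1%:R^-1)) => //.
apply: rV_norm_le => [|i]; first by rewrite mulr_ge0// invr_ge0.
have := ltW (By i); have := ltW (xB i); rewrite /= !mxE => h1 h2.
rewrite (_ : _ - _ = (x 0 i - ratr (q i)) - (y 0 i - ratr (q i))); last by ring.
apply: le_trans (ler_normB _ _) _.
by rewrite mulr_natl mulr2n lerD.
Qed.

Lemma closed_measurable_rV (A : set 'rV[R]_n) : closed A -> measurable A.
Proof.
move=> cA; rewrite -[A]setCK; apply: measurableC; apply: open_measurable_rV.
exact: closed_openC.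
Qed.

Lemma continuous_measurable_rV (f : 'rV[R]_n -> R) :
  continuous f -> measurable_fun setT f.
Proof.
move=> cf; apply: (measurability _ (RGenOpens.measurableE R)) => //.
move=> _ [_ [a [b ->] <-]]; rewrite setTI.
by apply: open_measurable_rV; move/continuousP : cf; apply; exact: interval_open.
Qed.

End rV_topology.

Section leb_tonelli.
Context {R : realType}.
Local Open Scope ereal_scope.

(** [leb n.+1] is a pushforward of a product measure, so this is Tonelli with the first coordinate
    outside: the recursion by which one computes with [leb]. *)
Lemma ge0_integral_lebS n (f : 'rV[R]_n.+1 -> \bar R) :
  measurable_fun setT f -> (forall x, 0 <= f x) ->
  \int[leb n.+1]_x f x =
  \int[@lebesgue_measure R]_x \int[leb n]_v f (rV_cons (x, v)).
Proof.
move=> mf f0.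
transitivity (\int[pushforward (@lebesgue_measure R \x leb n) (@rV_cons R n)]_x f x).
  by [].
rewrite (ge0_integral_pushforward (measurable_rV_cons (n := n)) _ measurableT)//.
rewrite preimage_setT fubini_tonelli1//=.
by apply: measurableT_comp => //; exact: measurable_rV_cons.
Qed.

Lemma integral_leb0 (f : 'rV[R]_0 -> \bar R) : measurable_fun setT f ->
  \int[leb 0]_x f x = f 0%R.
Proof. by move=> mf; rewrite integral_dirac//= diracT mul1e. Qed.

(** Both sides are integrals of [f] against measures on the line, and uniqueness of Lebesgue measure
    reduces their equality to half-open intervals. *)
Lemma ge0_integral_affine1 (a b : R) (f : R -> \bar R) : a != 0%R ->
  measurable_fun setT f -> (forall x, 0 <= f x) ->
  \int[@lebesgue_measure R]_x f (a * x + b)%R =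
  (`|a|^-1)%:E * \int[@lebesgue_measure R]_x f x.
Proof.
move=> a0 mf f0.
have inv0 : (0 <= `|a|^-1 :> R)%R by rewrite invr_ge0.
have mphi c e : measurable_fun [set: measurableTypeR R]
    (fun x : measurableTypeR R => c * x + e : measurableTypeR R)%R.
  by apply: measurable_funD => //; exact: mulrl_measurable.
pose phi : {mfun measurableTypeR R >-> measurableTypeR R} :=
  HB.pack (fun x : measurableTypeR R => (a * x + b)%R : measurableTypeR R)
          (isMeasurableFun.Build _ _ _ _ _ (mphi a b)).
transitivity (\int[pushforward (@lebesgue_measure R) phi]_x f x).
  by rewrite (ge0_integral_pushforward (measurable_funP phi) _ measurableT).
rewrite -[`|a|^-1%R]/((NngNum inv0)%:num) -ge0_integral_mscale//.
apply: eq_measure_integral => A mA _.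
have abs0 : (0 <= `|a| :> R)%R by [].
have scaleP (m : {measure set (measurableTypeR R) -> \bar R}) :
    (forall X, ocitv X -> @lebesgue_measure R X = `|a|%:E * m X) ->
    m A = mscale (NngNum inv0) (@lebesgue_measure R) A.
  move=> mP; rewrite /mscale/=.
  rewrite (lebesgue_measure_unique (mu := mscale (NngNum abs0) m)) /mscale//=.
  by rewrite muleA -EFinM mulVf ?normr_eq0// mul1e.
apply: scaleP => _ [[u v]] _ <-.
change (lebesgue_measure [set` `]u, v]%R] =
  `|a|%:E * lebesgue_measure ((fun x : R => (a * x + b)%R) @^-1` [set` `]u, v]%R])).
(* For [a < 0] the preimage of []u, v]] has its closed end on the left; only its length matters. *)
have -> : (fun x : R => (a * x + b)%R) @^-1` [set` `]u, v]%R] =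
   [set` (if (0 < a)%R then `](u - b) / a, (v - b) / a]%R
          else `[(v - b) / a, (u - b) / a[%R)].
  apply/seteqP; split => x /=; case: ltgtP a0 => // a0 _; rewrite !in_itv/= => /andP[].
  - by rewrite ltr_pdivrMr ?ler_pdivlMr// => *; apply/andP; split; lra.
  - by rewrite ltr_ndivlMr ?ler_ndivrMr// => *; apply/andP; split; lra.
  - by rewrite ltr_pdivrMr ?ler_pdivlMr// => *; apply/andP; split; lra.
  - by rewrite ltr_ndivlMr ?ler_ndivrMr// => *; apply/andP; split; lra.
have aD : forall x y : R, (x / a - y / a = (x - y) / a)%R by move=> x y; ring.
rewrite !lebesgue_measure_itv/=.
move: a0; rewrite neq_lt => /orP[a0|a0]; rewrite ?a0 ?(lt_gtF a0)/= !lte_fin; last first.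
- rewrite gtr0_norm// ltr_pM2r ?invr_gt0// ltrD2r; case: ifPn => uv; last by rewrite mule0.
  rewrite -!EFinB -EFinM; congr EFin; field.
  by rewrite gt_eqF.
- rewrite ltr0_norm// ltr_nM2r ?invr_lt0// ltrD2r; case: ifPn => uv; last by rewrite mule0.
  rewrite -!EFinB -EFinM; congr EFin; field.
  by rewrite lt_eqF.
Qed.

Lemma ge0_integral_affine n (a : R) (v : 'rV[R]_n) (f : 'rV[R]_n -> \bar R) :
  a != 0%R -> measurable_fun setT f -> (forall x, 0 <= f x) ->
  \int[leb n]_x f (a *: x + v)%R = (`|a|^-1 ^+ n)%:E * \int[leb n]_x f x.
Proof.
move=> a0; elim: n => [|n IHn] in v f *; move=> mf f0.
  rewrite !integral_leb0//; last first.
    rewrite (_ : (fun _ => _) = cst (f 0%R))//.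
    by apply/funext => x; congr f; apply/rowP => -[].
  by rewrite expr0 mul1e; congr f; apply/rowP => -[].
have mfc : measurable_fun setT (fun p => f (rV_cons p)).
  by apply: measurableT_comp => //; exact: measurable_rV_cons.
have maff m (w : 'rV[R]_m) : measurable_fun setT (fun x : 'rV[R]_m => a *: x + w)%R.
  apply: measurable_fun_rV => i; under eq_fun do rewrite !mxE.
  by apply: measurable_funD => //; apply: measurable_funM => //; exact: measurable_coord.
rewrite !ge0_integral_lebS//; last exact: (measurableT_comp mf (maff _ _)).
transitivity (\int[lebesgue_measure]_x \int[leb n]_w
    f (rV_cons ((a * x + v ord0 ord0)%R, (a *: w + \row_j v ord0 (lift ord0 j))%R))).
  apply: eq_integral => x _; apply: eq_integral => w _; congr f.
  apply/rowP => i; rewrite !mxE; case: (unliftP ord0 i) => [j ->|->] /=.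
    by rewrite !mxE.
  by [].
under eq_integral => x _.
  rewrite (IHn _ (fun w => f (rV_cons ((a * x + v ord0 ord0)%R, w))))//; last first.
    exact: (measurableT_comp mfc (measurable_pair1 _)).
  over.
rewrite (ge0_integral_affine1 _ (f := fun x => (`|a|^-1 ^+ n)%:E * \int[leb n]_w f (rV_cons (x, w))))//.
- rewrite ge0_integralZl//.
  + by rewrite muleA -EFinM exprS.
  + exact: (measurable_fun_fubini_tonelli_F (fun p => f (rV_cons p))).
  + by move=> *; exact: integral_ge0.
- apply: emeasurable_funM => //.
  exact: (measurable_fun_fubini_tonelli_F (fun p => f (rV_cons p))).
- by move=> x; rewrite mule_ge0// ?lee_fin ?exprn_ge0//; exact: integral_ge0.
Qed.

Lemma leb_box n (e : R) : (0 < e)%R ->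
  leb n [set x : 'rV[R]_n | forall i, (`|x 0 i| < e)%R] = ((2 * e) ^+ n)%:E.
Proof.
move=> e0.
have mbox m : measurable [set x : 'rV[R]_m | forall i, (`|x 0 i| < e)%R].
  rewrite (_ : [set _ | _] = ball (0%R : 'rV[R]_m) e).
    by apply: open_measurable_rV; exact: ball_open.
  apply/seteqP; split => x; rewrite mx_norm_ball /ball_/= sub0r normrN.
    exact: rV_norm_lt.
  by move=> xe i; apply: le_lt_trans xe; exact: rV_coord_le_norm.
elim: n => [|n IHn].
  by rewrite /= diracE mem_set// => -[].
set A := (X in leb _ X); have mA : measurable A by exact: mbox.
have mI : measurable_fun setT (fun x => (\1_A x)%:E : \bar R).
  by apply/measurable_EFinP; exact: measurable_indic.
rewrite -(setIT A) -integral_indic// ge0_integral_lebS//.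
have E x v : \1_A (rV_cons (x, v)) =
    (\1_(ball (0 : R) e) x *
     \1_[set v : 'rV[R]_n | forall i, `|v 0 i| < e] v)%R :> R.
  rewrite !indicE -natrM mulnb; congr (nat_of_bool _)%:R; apply/idP/idP.
    move=> /set_mem Acons; apply/andP; split; apply/mem_set.
      by have := Acons ord0; rewrite mxE unlift_none /ball/= sub0r normrN.
    by move=> i; have := Acons (lift ord0 i); rewrite mxE liftK.
  move=> /andP[/set_mem]; rewrite /ball/= sub0r normrN => xe /set_mem ve.
  by apply/mem_set => i; rewrite mxE; case: (unliftP ord0 i) => [j|] _ /=.
have mI' : measurable_fun setT (fun v => (\1_[set v : 'rV[R]_n | forall i, (`|v 0 i| < e)%R] v)%:E : \bar R).
  by apply/measurable_EFinP; apply: measurable_indic; exact: mbox.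
have IE : \int[leb n]_v (\1_[set v : 'rV[R]_n | forall i, (`|v 0 i| < e)%R] v)%:E = ((2 * e) ^+ n)%:E.
  by rewrite integral_indic ?setIT//; exact: mbox.
under eq_integral => x _.
  under eq_integral => v _ do rewrite E EFinM.
  rewrite ge0_integralZl// IE; over.
rewrite ge0_integralZr//; last 2 first.
- by apply/measurable_EFinP; apply: measurable_indic; exact: measurable_ball.
- by rewrite lee_fin exprn_ge0// mulr_ge0// ltW.
rewrite integral_indic//; last exact: measurable_ball.
rewrite setIT (_ : _ (ball 0%R e) = (e *+ 2)%:E); last first.
  exact: (lebesgue_measure_ball 0%R (ltW e0)).
by rewrite -EFinM exprS mulr_natl.
Qed.

Lemma measurable_rV_ball n (x : 'rV[R]_n) (e : R) :
  measurable [set y | (`|y - x| < e)%R].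
Proof.
rewrite (_ : [set _ | _] = ball x e).
  by apply: open_measurable_rV; exact: ball_open.
by apply/seteqP; split => z; rewrite mx_norm_ball /ball_/= distrC.
Qed.

Lemma leb_ball n (x : 'rV[R]_n) (e : R) : (0 < e)%R ->
  leb n [set y | (`|y - x| < e)%R] = ((2 * e) ^+ n)%:E.
Proof.
move=> e0.
have ballE z : [set y : 'rV[R]_n | (`|y - z| < e)%R] =
    [set y : 'rV[R]_n | forall i, (`|(y - z) 0 i| < e)%R].
  apply/seteqP; split => y /=; last exact: rV_norm_lt.
  by move=> h i; apply: le_lt_trans h; exact: rV_coord_le_norm.
rewrite -leb_box//.
set A := (X in _ = leb _ X); set B := (X in leb _ X = _).
have mA : measurable A.
  have := measurable_rV_ball (0%R : 'rV[R]_n) e; rewrite ballE.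
  by under eq_set do under eq_forall do rewrite subr0.
have mB : measurable B by exact: measurable_rV_ball.
rewrite -(setIT A) -(setIT B) -!integral_indic//.
transitivity (\int[leb n]_y (\1_A (1 *: y - x)%R)%:E).
  by apply: eq_integral => y _; rewrite !indicE /B ballE scale1r.
rewrite (@ge0_integral_affine _ 1%R (- x)%R (fun y => (\1_A y)%:E)) ?oner_eq0//.
  by rewrite normr1 invr1 expr1n mul1e.
by apply/measurable_EFinP; exact: measurable_indic.
Qed.

Lemma leb_open_gt0 n (U : set 'rV[R]_n) : open U -> U !=set0 -> 0 < leb n U.
Proof.
move=> oU [x Ux]; have /nbhs_ballP[e /= e0 eU] := open_nbhs_nbhs (conj oU Ux).
apply: (@lt_le_trans _ _ (leb n [set y | (`|y - x| < e)%R])).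
  by rewrite leb_ball// lte_fin exprn_gt0// mulr_gt0.
apply: le_measure; rewrite ?inE.
- exact: measurable_rV_ball.
- exact: open_measurable_rV.
- by move=> y xy; apply: eU; rewrite mx_norm_ball /ball_/= distrC.
Qed.

Lemma leb_bounded_lty n (U : set 'rV[R]_n) (M : R) : measurable U ->
  (forall x, U x -> (`|x| <= M)%R) -> leb n U < +oo.
Proof.
move=> mU UM.
apply: (@le_lt_trans _ _ (leb n [set y : 'rV[R]_n | (`|y - 0| < `|M| + 1)%R])).
  apply: le_measure; rewrite ?inE//; first exact: measurable_rV_ball.
  move=> x Ux /=; rewrite subr0.
  apply: le_lt_trans (UM _ Ux) _; apply: le_lt_trans (ler_norm _) _.
  by rewrite ltrDl.
by rewrite leb_ball ?ltry// ltr_wpDl.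
Qed.

Lemma measurable_affine n (a : R) (w : 'rV[R]_n) :
  measurable_fun setT (fun x : 'rV[R]_n => (a *: x + w)%R).
Proof.
apply: measurable_fun_rV => i; under eq_fun do rewrite !mxE.
by apply: measurable_funD => //; apply: measurable_funM => //; exact: measurable_coord.
Qed.

Lemma integrable_affine n (a : R) (v : 'rV[R]_n) (f : 'rV[R]_n -> \bar R) :
  a != 0%R -> (leb n).-integrable setT f ->
  (leb n).-integrable setT (fun x => f (a *: x + v)%R).
Proof.
move=> a0 /integrableP[mf foo]; apply/integrableP; split.
  exact: (measurableT_comp mf (measurable_affine _ _)).
rewrite (ge0_integral_affine _ (f := fun x => `|f x|))//; last exact: measurableT_comp.
by rewrite lte_mul_pinfty// ?lee_fin ?exprn_ge0 ?invr_ge0.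
Qed.

Lemma integral_affine n (a : R) (v : 'rV[R]_n) (f : 'rV[R]_n -> \bar R) :
  a != 0%R -> (leb n).-integrable setT f ->
  \int[leb n]_x f (a *: x + v)%R = (`|a|^-1 ^+ n)%:E * \int[leb n]_x f x.
Proof.
move=> a0 intf.
have [/integrableP[mf _] _] := (intf, I).
rewrite [in LHS]integralE [X in _ = _ * X]integralE.
rewrite -[(fun x => f (a *: x + v)%R)]/(f \o (fun x => a *: x + v)%R).
rewrite funepos_comp funeneg_comp.
rewrite (ge0_integral_affine _ (f := f^\+))//; last exact: measurable_funepos.
rewrite (ge0_integral_affine _ (f := f^\-))//; last exact: measurable_funeneg.
rewrite -muleBr//; apply: fin_num_adde_defl; rewrite fin_numN.
have /integrableP[_] := integrable_funeneg measurableT intf.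
move=> h; rewrite ge0_fin_numE; last by apply: integral_ge0 => x _; exact: funeneg_ge0.
apply: le_lt_trans h; rewrite le_eqVlt; apply/orP; left; apply/eqP.
by apply: eq_integral => x _; rewrite gee0_abs.
Qed.

Lemma ge0_integral_leb1 (f : R -> \bar R) : measurable_fun setT f ->
  (forall x, 0 <= f x) ->
  \int[leb 1]_v f (v ord0 ord0) = \int[@lebesgue_measure R]_x f x.
Proof.
move=> mf f0.
have mf1 : measurable_fun setT (fun v : 'rV[R]_1 => f (v ord0 ord0)).
  by apply: measurableT_comp => //; exact: measurable_coord.
rewrite (ge0_integral_lebS mf1)//; apply: eq_integral => x _.
rewrite integral_leb0; last first.
  apply: (measurableT_comp (f := fun v : 'rV[R]_1 => f (v ord0 ord0))) => //.
  exact: (measurableT_comp (measurable_rV_cons (n := 0)) (measurable_pair1 _)).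
by rewrite mxE unlift_none.
Qed.

End leb_tonelli.

(** * The integrable comparison weight *)

Section weight.
Context {R : realType}.

(** The common dominating function: its product form makes it integrable by Tonelli and comparable
    to its bounded translates, and Schwartz seminorms control functions relative to it. *)
Definition wt n (x : 'rV[R]_n) : R := \prod_(i < n) (1 + x 0 i ^+ 2)^-1.

Lemma wt_gt0 n (x : 'rV[R]_n) : 0 < wt x.
Proof. by rewrite prodr_gt0// => i _; rewrite invr_gt0 ltr_pwDl// sqr_ge0. Qed.

Lemma measurable_wt n : measurable_fun setT (@wt n).
Proof.
apply: measurable_prod => i _.
apply: (measurableT_comp (f := fun x : R => (1 + x ^+ 2)^-1)); last exact: measurable_coord.
apply: continuous_measurable_fun; exact: continuous_oneDsqrV.
Qed.

Lemma integral_wt1 : (\int[@lebesgue_measure R]_x ((1 + x ^+ 2)^-1)%:E = pi%:E)%E.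
Proof.
rewrite (@ge0_symfun_integralT _ (fun x => (1 + x ^+ 2)^-1)).
- have -> : [set x : R | 0 <= x] = `[0, +oo[%classic.
    by apply/seteqP; split => x; rewrite /= in_itv/= andbT.
  rewrite integral0y_oneDsqr -EFinM; congr EFin; by field.
- by move=> x; rewrite invr_ge0 addr_ge0 ?ler01 ?sqr_ge0.
- exact: continuous_oneDsqrV.
- by move=> x /=; rewrite sqrrN.
Qed.

Lemma integral_wt n : (\int[leb n]_x (@wt n x)%:E = (pi ^+ n)%:E)%E.
Proof.
elim: n => [|n IHn].
  rewrite integral_leb0; first by rewrite /wt big_ord0.
  by apply/measurable_EFinP; exact: measurable_wt.
rewrite ge0_integral_lebS; last 2 first.
- by apply/measurable_EFinP; exact: measurable_wt.
- by move=> x; rewrite lee_fin ltW// wt_gt0.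
under eq_integral => x _.
  under eq_integral => v _.
    rewrite /wt big_ord_recl mxE unlift_none/=.
    under eq_bigr do rewrite mxE liftK/=.
    rewrite -/(wt v) EFinM.
    over.
  rewrite ge0_integralZl//; last 3 first.
  - by apply/measurable_EFinP; exact: measurable_wt.
  - by move=> v _; rewrite lee_fin ltW// wt_gt0.
  - by rewrite lee_fin invr_ge0 addr_ge0// sqr_ge0.
  rewrite IHn; over.
rewrite ge0_integralZr//.
- by rewrite integral_wt1 exprS EFinM.
- apply/measurable_EFinP.
  by apply: continuous_measurable_fun; exact: continuous_oneDsqrV.
- by move=> x _; rewrite lee_fin invr_ge0 addr_ge0// sqr_ge0.
- by rewrite lee_fin exprn_ge0// pi_ge0.
Qed.

Lemma integrable_wt n : (leb n).-integrable setT (EFin \o @wt n).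
Proof.
apply/integrableP; split; first by apply/measurable_EFinP; exact: measurable_wt.
under eq_integral do rewrite gee0_abs ?lee_fin ?ltW ?wt_gt0//.
by rewrite integral_wt ltry.
Qed.

End weight.

(** * Complex-valued integrals *)

Section modulus_theory.
Context {R : realType}.
Implicit Types (z w : R[i]) (a b : R).

Lemma modulus_ge0 z : 0 <= modulus z.
Proof. by case: z => a b; exact: sqrtr_ge0. Qed.

Lemma modulus0 : modulus (0 : R[i]) = 0.
Proof. exact: ComplexField.Normc.normc0. Qed.

Lemma modulus_eq0 z : modulus z = 0 -> z = 0.
Proof. exact: ComplexField.Normc.eq0_normc. Qed.

Lemma modulusM z w : modulus (z * w) = modulus z * modulus w.
Proof. exact: ComplexField.Normc.normcM. Qed.

Lemma modulusD z w : modulus (z + w) <= modulus z + modulus w.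
Proof. exact: le_normcD. Qed.

Lemma modulusN z : modulus (- z) = modulus z.
Proof. exact: normcN. Qed.

Lemma modulus_Re z : `|complex.Re z| <= modulus z.
Proof.
case: z => a b /=; rewrite -sqrtr_sqr ler_wsqrtr// lerDl; exact: sqr_ge0.
Qed.

Lemma modulus_Im z : `|complex.Im z| <= modulus z.
Proof.
case: z => a b /=; rewrite -sqrtr_sqr ler_wsqrtr// lerDr; exact: sqr_ge0.
Qed.

Lemma modulus_le z : modulus z <= `|complex.Re z| + `|complex.Im z|.
Proof.
case: z => a b /=; rewrite -[leRHS]ger0_norm ?addr_ge0// -sqrtr_sqr ler_wsqrtr//.
rewrite sqrrD !real_normK ?num_real//.
by rewrite lerD2r lerDl mulrn_wge0// mulr_ge0.
Qed.

Lemma modulus_real a : modulus (a%:C)%C = `|a|.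
Proof. by rewrite /modulus/= expr0n addr0 sqrtr_sqr. Qed.

Lemma modulus_cexp a : modulus (cexp a) = 1.
Proof. by rewrite /modulus/= cos2Dsin2 sqrtr1. Qed.

Lemma cexpD a b : cexp (a + b) = cexp a * cexp b.
Proof. by rewrite /cexp cosD sinD; simpc; congr (_ +i* _)%C; ring. Qed.

Lemma cReM z w : complex.Re (z * w) =
  complex.Re z * complex.Re w - complex.Im z * complex.Im w.
Proof. by case: z => ? ?; case: w. Qed.

Lemma cImM z w : complex.Im (z * w) =
  complex.Re z * complex.Im w + complex.Im z * complex.Re w.
Proof. by case: z => ? ?; case: w. Qed.

Lemma cReD z w : complex.Re (z + w) = complex.Re z + complex.Re w.
Proof. by case: z => ? ?; case: w. Qed.

Lemma cImD z w : complex.Im (z + w) = complex.Im z + complex.Im w.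
Proof. by case: z => ? ?; case: w. Qed.

Lemma cReN z : complex.Re (- z) = - complex.Re z. Proof. by case: z. Qed.
Lemma cImN z : complex.Im (- z) = - complex.Im z. Proof. by case: z. Qed.

Lemma cReJ z : complex.Re (conjc z) = complex.Re z. Proof. by case: z. Qed.
Lemma cImJ z : complex.Im (conjc z) = - complex.Im z. Proof. by case: z. Qed.

Lemma modulusE z : modulus z = Num.sqrt (complex.Re z ^+ 2 + complex.Im z ^+ 2).
Proof. by case: z. Qed.

Lemma eq_complexP z w : complex.Re z = complex.Re w ->
  complex.Im z = complex.Im w -> z = w.
Proof. by case: z => ? ?; case: w => ? ? /= -> ->. Qed.

End modulus_theory.

Section complex_measurable.
Context {R : realType} d (T : measurableType d).
Implicit Types (f g : T -> R[i]).

Definition cmeas f := measurable_fun setT (@complex.Re R \o f) /\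
                      measurable_fun setT (@complex.Im R \o f).

Lemma cmeasD f g : cmeas f -> cmeas g -> cmeas (fun x => f x + g x).
Proof.
move=> [f1 f2] [g1 g2]; split; rewrite /comp.
  by under eq_fun do rewrite cReD; exact: measurable_funD.
by under eq_fun do rewrite cImD; exact: measurable_funD.
Qed.

Lemma cmeasN f : cmeas f -> cmeas (fun x => - f x).
Proof.
move=> [f1 f2]; split; rewrite /comp.
  by under eq_fun do rewrite cReN; exact: measurableT_comp.
by under eq_fun do rewrite cImN; exact: measurableT_comp.
Qed.

Lemma cmeasB f g : cmeas f -> cmeas g -> cmeas (fun x => f x - g x).
Proof. by move=> mf mg; apply: cmeasD => //; exact: cmeasN. Qed.

Lemma cmeasM f g : cmeas f -> cmeas g -> cmeas (fun x => f x * g x).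
Proof.
move=> [f1 f2] [g1 g2]; split; rewrite /comp.
  under eq_fun do rewrite cReM.
  by apply: measurable_funB; exact: measurable_funM.
under eq_fun do rewrite cImM.
by apply: measurable_funD; exact: measurable_funM.
Qed.

Lemma cmeas_cst (z : R[i]) : cmeas (fun=> z).
Proof. by split; exact: measurable_cst. Qed.

Lemma cmeas_real (h : T -> R) : measurable_fun setT h -> cmeas (fun x => (h x)%:C%C).
Proof. by move=> mh; split => //; exact: measurable_cst. Qed.

Lemma cmeas_cexp (h : T -> R) : measurable_fun setT h -> cmeas (fun x => cexp (h x)).
Proof.
move=> mh; split; rewrite /comp/=.
  by apply: measurableT_comp mh; apply: continuous_measurable_fun; exact: continuous_cos.
by apply: measurableT_comp mh; apply: continuous_measurable_fun; exact: continuous_sin.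
Qed.

Lemma cmeas_conj f : cmeas f -> cmeas (fun x => conjc (f x)).
Proof.
move=> [f1 f2]; split; rewrite /comp.
  by under eq_fun => x do rewrite cReJ.
by under eq_fun => x do rewrite cImJ; exact: measurableT_comp.
Qed.

Lemma measurable_modulus f : cmeas f -> measurable_fun setT (fun x => modulus (f x)).
Proof.
move=> [f1 f2].
under eq_fun => x do rewrite modulusE.
have ms : measurable_fun setT (@Num.sqrt R).
  by apply: continuous_measurable_fun; exact: sqrt_continuous.
by apply: (measurableT_comp ms); apply: measurable_funD; exact: measurable_funX.
Qed.

Lemma cmeas_sum (I : Type) (s : seq I) (P : pred I) (F : I -> T -> R[i]) :
  (forall i, cmeas (F i)) -> cmeas (fun x => \sum_(i <- s | P i) F i x).
Proof.
move=> mF; elim: s => [|i s IHs].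
  by under eq_fun do rewrite big_nil; exact: cmeas_cst.
by case Pi : (P i); under eq_fun do rewrite big_cons Pi; [exact: cmeasD|].
Qed.

End complex_measurable.

Lemma cmeas_comp {R : realType} d d' (T : measurableType d) (T' : measurableType d')
  (f : T' -> R[i]) (g : T -> T') : cmeas f -> measurable_fun setT g ->
  cmeas (fun x => f (g x)).
Proof.
by move=> [f1 f2] mg; split; [exact: (measurableT_comp f1 mg)|exact: (measurableT_comp f2 mg)].
Qed.

Lemma smooth_cmeas {R : realType} n (f : 'rV[R]_n -> R[i]) : smooth f -> cmeas f.
Proof. by move=> /(_ [::])[c1 c2 _]; split; exact: continuous_measurable_rV. Qed.

Lemma line_cmeas {R : realType} (f : R -> R[i]) : cmeas (on_line f) -> cmeas f.
Proof.
move=> mf; have mc : measurable_fun setT (fun s : R => const_mx s : 'rV[R]_1).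
  by apply: measurable_fun_rV => i; under eq_fun do rewrite mxE; exact: measurable_id.
by have := cmeas_comp mf mc; congr cmeas; apply/funext => s; rewrite /on_line mxE.
Qed.

Section complex_integral.
Context {R : realType} d (T : measurableType d) (mu : {measure set T -> \bar R}).
Implicit Types (f g : T -> R[i]).
Local Notation cI := (cintegral mu setT).

Lemma cintegrable_cmeas f : cintegrable mu setT f -> cmeas f.
Proof.
by move=> [/measurable_int/measurable_EFinP ? /measurable_int/measurable_EFinP ?].
Qed.

Lemma le_cintegrable (g : T -> R) f : cmeas f ->
  mu.-integrable setT (EFin \o g) -> (forall x, modulus (f x) <= g x) ->
  cintegrable mu setT f.
Proof.
move=> [f1 f2] intg fg; split.
- apply: (le_integrable measurableT _ _ intg); first exact/measurable_EFinP.
  move=> x _ /=; rewrite lee_fin (le_trans (modulus_Re _))//.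
  exact: le_trans (fg x) (ler_norm _).
- apply: (le_integrable measurableT _ _ intg); first exact/measurable_EFinP.
  move=> x _ /=; rewrite lee_fin (le_trans (modulus_Im _))//.
  exact: le_trans (fg x) (ler_norm _).
Qed.

Lemma integrable_modulus f : cintegrable mu setT f ->
  mu.-integrable setT (fun x => (modulus (f x))%:E).
Proof.
move=> intf; have mf := cintegrable_cmeas intf; case: intf => f1 f2.
have h : mu.-integrable setT (fun x => `|complex.Re (f x)|%:E + `|complex.Im (f x)|%:E)%E.
  apply: integrableD => //; [exact: integrable_norm f1|exact: integrable_norm f2].
apply: (le_integrable measurableT _ _ h).
  by apply/measurable_EFinP; exact: measurable_modulus.
move=> x _; rewrite /= lee_fin ger0_norm ?modulus_ge0//.
by apply: le_trans (modulus_le _) (ler_norm _).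
Qed.

Lemma cintegrableD f g : cintegrable mu setT f -> cintegrable mu setT g ->
  cintegrable mu setT (fun x => f x + g x).
Proof.
move=> intf intg.
apply: (le_cintegrable (g := fun x => modulus (f x) + modulus (g x))).
- by apply: cmeasD; exact: cintegrable_cmeas.
- rewrite /comp; under eq_fun do rewrite EFinD.
  by apply: integrableD => //; exact: integrable_modulus.
- by move=> x; exact: modulusD.
Qed.

Lemma cintegrableMl (h : T -> R[i]) (M : R) f : cmeas h ->
  (forall x, modulus (h x) <= M) -> cintegrable mu setT f ->
  cintegrable mu setT (fun x => h x * f x).
Proof.
move=> mh hM intf.
apply: (le_cintegrable (g := fun x => M * modulus (f x))).
- by apply: cmeasM => //; exact: cintegrable_cmeas.
- rewrite /comp; under eq_fun do rewrite EFinM.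
  by apply: integrableZl => //; exact: integrable_modulus.
- by move=> x; rewrite modulusM ler_wpM2r// modulus_ge0.
Qed.

Lemma cintegrableMr (h : T -> R[i]) (M : R) f : cmeas h ->
  (forall x, modulus (h x) <= M) -> cintegrable mu setT f ->
  cintegrable mu setT (fun x => f x * h x).
Proof.
move=> mh hM intf; under eq_fun do rewrite mulrC.
exact: cintegrableMl.
Qed.

Lemma cintegrableZ (z : R[i]) f : cintegrable mu setT f ->
  cintegrable mu setT (fun x => z * f x).
Proof.
by move=> intf; apply: (cintegrableMl (M := modulus z)) => //; exact: cmeas_cst.
Qed.

Lemma cintegrableN f : cintegrable mu setT f -> cintegrable mu setT (fun x => - f x).
Proof.
by move=> intf; under eq_fun do rewrite -mulN1r; exact: cintegrableZ.
Qed.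

Lemma cintegral0 : cI (fun=> 0) = 0.
Proof. by apply: eq_complexP; rewrite /cintegral/= /Rintegral integral0. Qed.

Lemma eq_cintegral f g : f =1 g -> cI f = cI g.
Proof. by move=> /funext ->. Qed.

Lemma cintegralD f g : cintegrable mu setT f -> cintegrable mu setT g ->
  cI (fun x => f x + g x) = cI f + cI g.
Proof.
move=> [f1 f2] [g1 g2]; apply: eq_complexP; rewrite /cintegral/=.
- by under eq_Rintegral do rewrite cReD; rewrite RintegralD.
- by under eq_Rintegral do rewrite cImD; rewrite RintegralD.
Qed.

Lemma cintegralZ (z : R[i]) f : cintegrable mu setT f ->
  cI (fun x => z * f x) = z * cI f.
Proof.
move=> [f1 f2]; have Zint (a : R) (h : T -> R) : mu.-integrable setT (EFin \o h) ->
    mu.-integrable setT (EFin \o (fun x => a * h x)).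
  by move=> inth; rewrite /comp; under eq_fun do rewrite EFinM; exact: integrableZl.
apply: eq_complexP; rewrite /cintegral/= ?cReM ?cImM/=.
- under eq_Rintegral do rewrite cReM.
  by rewrite RintegralB//; [rewrite !RintegralZl|exact: Zint..].
- under eq_Rintegral do rewrite cImM.
  by rewrite RintegralD//; [rewrite !RintegralZl|exact: Zint..].
Qed.

Lemma cintegralZr (z : R[i]) f : cintegrable mu setT f ->
  cI (fun x => f x * z) = cI f * z.
Proof.
by move=> intf; under eq_cintegral do rewrite mulrC; rewrite cintegralZ// mulrC.
Qed.

Lemma cintegralN f : cintegrable mu setT f -> cI (fun x => - f x) = - cI f.
Proof.
by move=> intf; under eq_cintegral do rewrite -mulN1r; rewrite cintegralZ// mulN1r.
Qed.

Lemma cintegralB f g : cintegrable mu setT f -> cintegrable mu setT g ->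
  cI (fun x => f x - g x) = cI f - cI g.
Proof.
by move=> intf intg; rewrite cintegralD// ?cintegralN//; exact: cintegrableN.
Qed.

Lemma cintegrable_sum (I : Type) (s : seq I) (F : I -> T -> R[i]) :
  (forall i, cintegrable mu setT (F i)) ->
  cintegrable mu setT (fun x => \sum_(i <- s) F i x).
Proof.
move=> intF; elim: s => [|i s IHs].
  under eq_fun do rewrite big_nil.
  by rewrite -[X in cintegrable _ _ (fun=> X)]/0; split; exact: integrable0.
by under eq_fun do rewrite big_cons; exact: cintegrableD.
Qed.

Lemma cintegral_sum (I : Type) (s : seq I) (F : I -> T -> R[i]) :
  (forall i, cintegrable mu setT (F i)) ->
  cI (fun x => \sum_(i <- s) F i x) = \sum_(i <- s) cI (F i).
Proof.
move=> intF; elim: s => [|i s IHs].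
  by under eq_cintegral do rewrite big_nil; rewrite big_nil cintegral0.
under eq_cintegral do rewrite big_cons.
by rewrite big_cons cintegralD ?IHs//; exact: cintegrable_sum.
Qed.

(** Real and imaginary parts are bounded separately, whence the factor 2; it is absorbed by later
    constants. *)
Lemma le_modulus_cintegral (g : T -> R) f : cmeas f ->
  mu.-integrable setT (EFin \o g) -> (forall x, modulus (f x) <= g x) ->
  modulus (cI f) <= 2 * \int[mu]_x g x.
Proof.
move=> mf intg fg; have [f1 f2] := le_cintegrable mf intg fg.
apply: le_trans (modulus_le _) _; rewrite /cintegral/= mulr_natl mulr2n lerD//.
- apply: le_trans (le_normr_Rintegral _ f1) _ => //.
  apply: le_Rintegral => //; first exact: integrable_norm f1.
  by move=> x _; exact: le_trans (modulus_Re _) (fg x).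
- apply: le_trans (le_normr_Rintegral _ f2) _ => //.
  apply: le_Rintegral => //; first exact: integrable_norm f2.
  by move=> x _; exact: le_trans (modulus_Im _) (fg x).
Qed.

Lemma ae_eq_cintegral f g : cmeas f -> cmeas g ->
  {ae mu, forall x, f x = g x} -> cI f = cI g.
Proof.
move=> [f1 f2] [g1 g2] fg; apply: eq_complexP; rewrite /cintegral/= /Rintegral;
  congr fine; apply: ae_eq_integral => //; rewrite ?/ae_eq.
- exact/measurable_EFinP.
- exact/measurable_EFinP.
- by apply: filterS fg => x ->.
- exact/measurable_EFinP.
- exact/measurable_EFinP.
- by apply: filterS fg => x ->.
Qed.

End complex_integral.

(** * Fubini and dominated convergence for complex-valued functions *)

Section complex_fubini.
Context {R : realType} d1 d2 (T1 : measurableType d1) (T2 : measurableType d2).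
Variables (m1 : {sigma_finite_measure set T1 -> \bar R})
          (m2 : {sigma_finite_measure set T2 -> \bar R}).

(** [fine] sends infinite inner integrals to 0, which can only lower the absolute value and happens
    on a null set. *)
Lemma Rintegral12 (f : T1 * T2 -> R) : (m1 \x m2)%E.-integrable setT (EFin \o f) ->
  m1.-integrable setT (EFin \o (fun x => \int[m2]_y f (x, y))) /\
  \int[m1]_x \int[m2]_y f (x, y) = \int[(m1 \x m2)%E]_z f z.
Proof.
move=> intf.
have mF : measurable_fun setT (fun x => (\int[m2]_y (EFin \o f) (x, y))%E).
  exact: (measurable_int m1 (integrable_fubini_F intf)).
have mR : measurable_fun setT (fun x => (\int[m2]_y f (x, y))%:E).
  by apply/measurable_EFinP; rewrite /Rintegral; exact: (measurableT_comp (fine_measurable measurableT) mF).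
split.
  apply: (le_integrable measurableT mR _ (integrable_fubini_F intf)) => x _ /=.
  rewrite /Rintegral /fubini_F /fubini_G /=; by case: (\int[_]_y _)%E => [r||] /=; rewrite ?normr0 ?leey ?lexx.
rewrite [in RHS]/Rintegral -(integral12_prod_meas1 intf) [in LHS]/Rintegral; congr fine.
apply: ae_eq_integral => //.
apply: filterS (ae_integrable1 intf) => x intx _.
by rewrite /Rintegral fineK//; exact: integrable_fin_num intx.
Qed.

Lemma Rintegral21 (f : T1 * T2 -> R) : (m1 \x m2)%E.-integrable setT (EFin \o f) ->
  m2.-integrable setT (EFin \o (fun x => \int[m1]_y f (y, x))) /\
  \int[m2]_x \int[m1]_y f (y, x) = \int[(m1 \x m2)%E]_z f z.
Proof.
move=> intf.
have mf := measurable_int _ intf.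
have mF : measurable_fun setT (fun x => (\int[m1]_y (EFin \o f) (y, x))%E).
  exact: measurable_fubini_G intf.
have intG : m2.-integrable setT (fun x => (\int[m1]_y (EFin \o f) (y, x))%E).
  apply/integrableP; split => //.
  apply: le_lt_trans ((integrable21ltyP m1 m2 mf).1 intf).
  apply: ge0_le_integral => //.
  - exact: measurableT_comp.
  - apply: (measurable_fun_fubini_tonelli_G (abse \o (EFin \o f))) => //.
    exact: measurableT_comp.
    by move=> x; exact: abse_ge0.
  - by move=> y _; apply: le_abse_integral => //; exact: measurableT_comp.
have mR : measurable_fun setT (fun x => (\int[m1]_y f (y, x))%:E).
  by apply/measurable_EFinP; rewrite /Rintegral; exact: (measurableT_comp (fine_measurable measurableT) mF).
split.
  apply: (le_integrable measurableT mR _ intG) => x _ /=.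
  rewrite /Rintegral /fubini_F /fubini_G /=; by case: (\int[_]_y _)%E => [r||] /=; rewrite ?normr0 ?leey ?lexx.
rewrite [in RHS]/Rintegral -(integral21_prod_meas1 intf) [in LHS]/Rintegral; congr fine.
apply: ae_eq_integral => //.
apply: filterS (ae_integrable2 intf) => x intx _.
by rewrite /Rintegral fineK//; exact: integrable_fin_num intx.
Qed.

Lemma cintegral12 (f : T1 * T2 -> R[i]) : cintegrable (m1 \x m2)%E setT f ->
  cintegrable m1 setT (fun x => cintegral m2 setT (fun y => f (x, y))) /\
  cintegral m1 setT (fun x => cintegral m2 setT (fun y => f (x, y))) =
  cintegral (m1 \x m2)%E setT f.
Proof.
move=> [f1 f2].
have [i1 e1] := Rintegral12 f1; have [i2 e2] := Rintegral12 f2.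
by split => //; apply: eq_complexP; [exact: e1|exact: e2].
Qed.

Lemma cintegral21 (f : T1 * T2 -> R[i]) : cintegrable (m1 \x m2)%E setT f ->
  cintegrable m2 setT (fun y => cintegral m1 setT (fun x => f (x, y))) /\
  cintegral m2 setT (fun y => cintegral m1 setT (fun x => f (x, y))) =
  cintegral (m1 \x m2)%E setT f.
Proof.
move=> [f1 f2].
have [i1 e1] := Rintegral21 f1; have [i2 e2] := Rintegral21 f2.
by split => //; apply: eq_complexP; [exact: e1|exact: e2].
Qed.

Lemma integrable_prodM (g : T1 -> R) (h : T2 -> R) :
  m1.-integrable setT (EFin \o g) -> m2.-integrable setT (EFin \o h) ->
  (m1 \x m2)%E.-integrable setT (EFin \o (fun p => g p.1 * h p.2)).
Proof.
move=> intg inth.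
have mg := measurable_int _ intg; have mh := measurable_int _ inth.
have mgh : measurable_fun setT (fun p : T1 * T2 => (g p.1 * h p.2)%:E).
  apply/measurable_EFinP; apply: measurable_funM.
    by apply: measurableT_comp => //; exact/measurable_EFinP.
  by apply: measurableT_comp => //; exact/measurable_EFinP.
apply/integrable12ltyP => //.
under eq_integral => x _.
  under eq_integral => y _ do rewrite /= normrM EFinM.
  rewrite ge0_integralZl//; last by do 2 apply: measurableT_comp => //; exact/measurable_EFinP.
  over.
have /integrableP[_ hoo] := inth; have /integrableP[_ goo] := intg.
rewrite ge0_integralZr//.
- by rewrite lte_mul_pinfty// ?ge0_fin_numE ?integral_ge0.
- by do 2 apply: measurableT_comp => //; exact/measurable_EFinP.
- by apply: integral_ge0.
Qed.

(** The bound by a product of integrable functions gives joint integrability at once; all later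
    exchanges of complex integrals are put in this form. *)
Lemma cFubini (f : T1 -> T2 -> R[i]) (g : T1 -> R) (h : T2 -> R) :
  cmeas (fun p => f p.1 p.2) ->
  m1.-integrable setT (EFin \o g) -> m2.-integrable setT (EFin \o h) ->
  (forall x y, modulus (f x y) <= g x * h y) ->
  cintegral m1 setT (fun x => cintegral m2 setT (f x)) =
  cintegral m2 setT (fun y => cintegral m1 setT (f ^~ y)).
Proof.
move=> mf intg inth fgh.
have intf : cintegrable (m1 \x m2)%E setT (fun p => f p.1 p.2).
  by apply: (le_cintegrable mf (integrable_prodM intg inth)) => -[x y] /=.
have [_ e1] := cintegral12 intf; have [_ e2] := cintegral21 intf.
exact: etrans e1 (esym e2).
Qed.

Lemma cintegrable_fubini1 (f : T1 -> T2 -> R[i]) (g : T1 -> R) (h : T2 -> R) :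
  cmeas (fun p => f p.1 p.2) ->
  m1.-integrable setT (EFin \o g) -> m2.-integrable setT (EFin \o h) ->
  (forall x y, modulus (f x y) <= g x * h y) ->
  cintegrable m1 setT (fun x => cintegral m2 setT (f x)).
Proof.
move=> mf intg inth fgh.
have intf : cintegrable (m1 \x m2)%E setT (fun p => f p.1 p.2).
  by apply: (le_cintegrable mf (integrable_prodM intg inth)) => -[x y] /=.
by have [] := cintegral12 intf.
Qed.

End complex_fubini.

Section dominated.
Context {R : realType} d (T : measurableType d) (mu : {measure set T -> \bar R}).

Lemma dominated_Rintegral (f_ : nat -> T -> R) (f g : T -> R) :
  (forall n, measurable_fun setT (f_ n)) ->
  (forall x, f_ n x @[n --> \oo] --> f x) ->
  mu.-integrable setT (EFin \o g) -> (forall n x, `|f_ n x| <= g x) ->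
  \int[mu]_x f_ n x @[n --> \oo] --> \int[mu]_x f x.
Proof.
move=> mf_ f_f intg f_g.
have mf : measurable_fun setT f by apply: measurable_fun_cvg => // x _; exact: f_f.
have [] := @dominated_convergence _ _ _ mu _ measurableT
  (fun n x => (f_ n x)%:E) (EFin \o f) (EFin \o g).
- by move=> n; exact/measurable_EFinP.
- exact/measurable_EFinP.
- by apply/aeW => x _; apply: cvg_EFin; [exact: nearW|exact: f_f].
- exact: intg.
- by apply/aeW => x n _ /=; rewrite lee_fin.
move=> intf _ h; have {}h : (\int[mu]_x (f_ n x)%:E @[n --> \oo] --> (\int[mu]_x f x)%:E)%E.
  by rewrite /Rintegral fineK//; exact: integrable_fin_num intf.
exact: (fine_cvg h).
Qed.

Lemma dominated_cintegral (f_ : nat -> T -> R[i]) (f : T -> R[i]) (g : T -> R) :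
  (forall n, cmeas (f_ n)) ->
  (forall x, modulus (f_ n x - f x) @[n --> \oo] --> (0 : R)) ->
  mu.-integrable setT (EFin \o g) -> (forall n x, modulus (f_ n x) <= g x) ->
  modulus (cintegral mu setT (f_ n) - cintegral mu setT f) @[n --> \oo] --> (0 : R).
Proof.
move=> mf_ f_f intg f_g.
have cvgRe (u_ : nat -> R[i]) (u : R[i]) : modulus (u_ n - u) @[n --> \oo] --> (0 : R) ->
    complex.Re (u_ n) @[n --> \oo] --> complex.Re u /\
    complex.Im (u_ n) @[n --> \oo] --> complex.Im u.
  move=> uu; split; apply/cvgrPdist_le => e e0; move/cvgrPdist_le : uu => /(_ _ e0);
    apply: filterS => n; rewrite sub0r normrN ger0_norm ?modulus_ge0//; apply: le_trans.
  - by rewrite distrC -cReN -cReD modulus_Re.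
  - by rewrite distrC -cImN -cImD modulus_Im.
have c1 : \int[mu]_x complex.Re (f_ n x) @[n --> \oo] --> \int[mu]_x complex.Re (f x).
  apply: (dominated_Rintegral _ _ intg).
  - by move=> n; have [] := mf_ n.
  - by move=> x; have [] := cvgRe (f_ ^~ x) (f x) (f_f x).
  - by move=> n x; exact: le_trans (modulus_Re _) (f_g n x).
have c2 : \int[mu]_x complex.Im (f_ n x) @[n --> \oo] --> \int[mu]_x complex.Im (f x).
  apply: (dominated_Rintegral _ _ intg).
  - by move=> n; have [] := mf_ n.
  - by move=> x; have [] := cvgRe (f_ ^~ x) (f x) (f_f x).
  - by move=> n x; exact: le_trans (modulus_Im _) (f_g n x).
apply: (@squeeze_cvgr _ _ _ _ (cst 0)
  (fun n => `|\int[mu]_x complex.Re (f_ n x) - \int[mu]_x complex.Re (f x)| +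
    `|\int[mu]_x complex.Im (f_ n x) - \int[mu]_x complex.Im (f x)|)).
- apply: nearW => n; rewrite modulus_ge0 andTb.
  by apply: le_trans (modulus_le _) _; rewrite cReD cReN cImD cImN.
- exact: cvg_cst.
- have cvgn0 (u_ : nat -> R) (u : R) : u_ n @[n --> \oo] --> u ->
      `|u_ n - u| @[n --> \oo] --> (0 : R).
    move=> uu; rewrite -[X in _ --> X](@normr0 _ R); apply: cvg_norm.
    by rewrite -(subrr u); apply: cvgB => //; exact: cvg_cst.
  by rewrite -(addr0 0); apply: cvgD; exact: cvgn0.
Qed.

End dominated.

Section leb_complex.
Context {R : realType} (n : nat).
Implicit Types f : 'rV[R]_n -> R[i].

Lemma cintegrable_affine (a : R) (v : 'rV[R]_n) f : a != 0 ->
  cintegrable (leb n) setT f -> cintegrable (leb n) setT (fun x => f (a *: x + v)).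
Proof.
by move=> a0 [f1 f2]; split; [exact: (integrable_affine v a0 f1)|exact: (integrable_affine v a0 f2)].
Qed.

Lemma cintegral_affine (a : R) (v : 'rV[R]_n) f : a != 0 ->
  cintegrable (leb n) setT f ->
  cintegral (leb n) setT (fun x => f (a *: x + v)) =
  ((`|a|^-1 ^+ n)%:C)%C * cintegral (leb n) setT f.
Proof.
move=> a0 [f1 f2]; apply: eq_complexP; rewrite ?cReM ?cImM /= mul0r ?subr0 ?addr0 /Rintegral.
- rewrite -[X in X * _]/(fine (`|a|^-1 ^+ n)%:E) -fineM//; last exact: integrable_fin_num f1.
  by rewrite -(integral_affine v a0 f1).
- rewrite -[X in X * _]/(fine (`|a|^-1 ^+ n)%:E) -fineM//; last exact: integrable_fin_num f2.
  by rewrite -(integral_affine v a0 f2).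
Qed.

Lemma cintegral_shift (v : 'rV[R]_n) f : cintegrable (leb n) setT f ->
  cintegral (leb n) setT (fun x => f (x + v)) = cintegral (leb n) setT f.
Proof.
move=> intf; have := cintegral_affine v (oner_neq0 R) intf.
rewrite normr1 invr1 expr1n mul1r => <-.
by apply: eq_cintegral => x; rewrite scale1r.
Qed.

Lemma cintegral_reflect (v : 'rV[R]_n) f : cintegrable (leb n) setT f ->
  cintegral (leb n) setT (fun x => f (v - x)) = cintegral (leb n) setT f.
Proof.
have a0 : -1 != 0 :> R by rewrite oppr_eq0 oner_neq0.
move=> intf; have := cintegral_affine v a0 intf.
rewrite normrN normr1 invr1 expr1n mul1r => <-.
by apply: eq_cintegral => x; rewrite scaleN1r addrC.
Qed.

End leb_complex.

(** * Smooth functions *)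

Section line_derivative.
Context {R : realType} (V : normedModType R).
Implicit Types (f : V -> R) (x v : V).

(** Turns directional derivatives on R^n into derivatives in one real variable, where the mean value
    theorem and differentiation under the integral apply. *)
Lemma derive_line f x v :
  (derivable f x v <-> derivable (fun h : R => f (x + h *: v)) 0 1) /\
  'D_v f x = 'D_1 (fun h : R => f (x + h *: v)) 0.
Proof.
rewrite /derivable /derive.
suff -> : (fun h => h^-1 *: ((f \o shift x) (h *: v) - f x)) =
  (fun h : R => h^-1 *: (((fun h : R => f (x + h *: v)) \o shift 0) (h *: 1) -
    f (x + 0 *: v))) by [].
apply/funext => h; congr (_ *: (f _ - f _)); rewrite /= ?scale0r ?addr0//.
by rewrite (_ : h *: (1 : R) = h) 1?addrC//; exact: mulr1.
Qed.

Lemma is_derive_line f x v (h : R) : derivable f (x + h *: v) v ->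
  is_derive h 1 (fun h => f (x + h *: v)) ('D_v f (x + h *: v)).
Proof.
move=> df; have [e1 e2] := derive_line f (x + h *: v) v.
have E : (fun k => f (x + k *: v)) =
    (fun k => f (x + h *: v + k *: v)) \o (fun k => k - h).
  by apply/funext => k /=; rewrite -addrA -scalerDl addrCA subrr addr0.
have d0 : is_derive (h - h) 1 (fun k => f (x + h *: v + k *: v)) ('D_v f (x + h *: v)).
  rewrite subrr e2; apply: derivableP; exact: (e1.1 df).
rewrite E -[X in is_derive _ _ _ X]mulr1.
have d1 : is_derive h 1 (fun k : R => k - h) (1 : R).
  rewrite -[X in is_derive _ _ _ X]subr0.
  exact: is_deriveB.
have := @is_derive1_comp _ (fun k : R => f (x + h *: v + k *: v)) (fun k => k - h) h _ _ d0 d1.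
by [].
Qed.

Lemma bounded_derive_lipschitz f x v (B : R) :
  (forall h : R, derivable f (x + h *: v) v) ->
  (forall h : R, `|'D_v f (x + h *: v)| <= B) ->
  forall h : R, `|f (x + h *: v) - f x| <= B * `|h|.
Proof.
move=> df dB.
pose g (h : R) := f (x + h *: v).
have dg (h : R) : is_derive h 1 g ('D_v f (x + h *: v)) by exact: is_derive_line.
have cg (h : R) : {for h, continuous g}.
  by apply/differentiable_continuous/derivable1_diffP; exact: (@ex_derive _ _ _ _ _ _ _ (dg h)).
have main (a b : R) : a <= b -> `|g b - g a| <= B * (b - a).
  rewrite le_eqVlt => /predU1P[->|ab]; first by rewrite !subrr normr0 mulr0.
  have [c _ ->] := MVT ab (fun h _ => dg h) (continuous_subspaceT cg).
  by rewrite normrM ler_pM// ger0_norm// subr_ge0 ltW.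
move=> h; have -> : f x = g 0 by rewrite /g scale0r addr0.
have [h0|h0] := leP 0 h.
  by rewrite -/(g h) (le_trans (main _ _ h0))// subr0 ger0_norm.
by rewrite distrC -/(g h) (le_trans (main _ _ (ltW h0)))// sub0r ltr0_norm.
Qed.

Lemma mvt_line f x v (h : R) : 0 < h ->
  (forall k : R, derivable f (x + k *: v) v) ->
  exists2 c : R, 0 < c < h & f (x + h *: v) - f x = h * 'D_v f (x + c *: v).
Proof.
move=> h0 df.
pose g (h : R) := f (x + h *: v).
have dg (k : R) : is_derive k 1 g ('D_v f (x + k *: v)) by exact: is_derive_line.
have cg (k : R) : {for k, continuous g}.
  by apply/differentiable_continuous/derivable1_diffP; exact: (@ex_derive _ _ _ _ _ _ _ (dg k)).
have [c] := MVT h0 (fun k _ => dg k) (continuous_subspaceT cg).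
rewrite /g scale0r addr0 subr0 mulrC => c0h e; exists c => //.
Qed.

End line_derivative.

(** Locked so that conversion does not unfold iterated derivatives. *)
HB.lock Definition rpartial {R : realType} {d : nat} (i : 'I_d) (f : 'rV[R]_d -> R) :
  'rV[R]_d -> R := fun x => 'D_(delta_mx 0 i) f x.

Section smooth.
Context {R : realType} {d : nat}.
Local Notation V := 'rV[R]_d.
Implicit Types (f g : V -> R) (i j : 'I_d) (x y : V).
Local Notation e_ i := (delta_mx 0 i : V).

Lemma rpartialE i f x : rpartial i f x = 'D_(e_ i) f x.
Proof. by rewrite rpartial.unlock. Qed.

(** Partial derivatives are not asked to be continuous: for [rsmooth] functions this comes from the
    next derivative, and the weaker notion is what parametric integrals give directly. *)
Definition C1 f := continuous f /\ forall i x, derivable f x (e_ i).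

Variant rsmooth f : Prop :=
  Rsmooth of forall s : seq 'I_d, C1 (foldr rpartial f s).

Lemma rsmooth_C1 f : rsmooth f -> C1 f. Proof. by case=> /(_ [::]). Qed.

Lemma rsmooth_rpartial f i : rsmooth f -> rsmooth (rpartial i f).
Proof. by case=> sf; split=> s; have := sf (rcons s i); rewrite foldr_rcons. Qed.

(** Smooth functions form the largest class of [C1] functions stable under partial derivatives, so
    smoothness is proved by exhibiting a stable class that contains the function. *)
Lemma rsmooth_coind (P : (V -> R) -> Prop) :
  (forall g, P g -> C1 g /\ forall i, P (rpartial i g)) ->
  forall g, P g -> rsmooth g.
Proof.
move=> PC g Pg; split=> s; suff : P (foldr rpartial g s) by move/PC => [].
by elim: s => // i s /PC[_]; exact.
Qed.

Lemma foldr_partialE (f : V -> R[i]) s :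
  foldr partial f s = (fun x => (foldr rpartial (@complex.Re R \o f) s x +i*
                                 foldr rpartial (@complex.Im R \o f) s x)%C).
Proof.
elim: s => [|i s IHs]; first by apply/funext => x /=; case: (f x).
by rewrite [LHS]/= IHs; apply/funext => x /=; rewrite !rpartialE.
Qed.

Lemma smoothP (f : V -> R[i]) :
  smooth f <-> rsmooth (@complex.Re R \o f) /\ rsmooth (@complex.Im R \o f).
Proof.
split=> [sf|[[s1] [s2]] s].
  split; split=> s; have [c1 c2 c3] := sf s; rewrite foldr_partialE in c1 c2 c3.
  - by split => // i x; exact: (c3 i x).1.
  - by split => // i x; exact: (c3 i x).2.
have [c1 d1] := s1 s; have [c2 d2] := s2 s; rewrite foldr_partialE.
by split.
Qed.

Lemma rsmooth_cst (c : R) : rsmooth (cst c).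
Proof.
apply: (rsmooth_coind (P := fun g => exists c, g = cst c)); last by exists c.
move=> _ [{}c ->]; split.
  by split => [|i x]; [exact: cst_continuous|exact: derivable_cst].
move=> i; exists 0; apply/funext => x; rewrite rpartialE; exact: derive_cst.
Qed.

Lemma rpartialD f g i : C1 f -> C1 g ->
  rpartial i (f \+ g) = rpartial i f \+ rpartial i g.
Proof. by move=> [_ df] [_ dg]; apply/funext => x; rewrite /= !rpartialE deriveD. Qed.

Lemma rpartialM f g i : C1 f -> C1 g ->
  rpartial i (f \* g) = (f \* rpartial i g) \+ (rpartial i f \* g).
Proof.
move=> [_ df] [_ dg]; apply/funext => x; rewrite /= !rpartialE deriveM//=.
by congr (_ + _); exact: mulrC.
Qed.

Lemma C1D f g : C1 f -> C1 g -> C1 (f \+ g).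
Proof.
move=> [cf df] [cg dg]; split => [x|i x]; last exact: derivableD.
exact: (cvgD (cf x) (cg x)).
Qed.

Lemma C1M f g : C1 f -> C1 g -> C1 (f \* g).
Proof.
move=> [cf df] [cg dg]; split => [x|i x]; last exact: derivableM.
exact: (cvgM (cf x) (cg x)).
Qed.

(** Products of two smooth functions are not stable under derivatives; their finite sums are, by the
    Leibniz rule. *)
Inductive products : (V -> R) -> Prop :=
| products_M f g : rsmooth f -> rsmooth g -> products (f \* g)
| products_D f g : products f -> products g -> products (f \+ g).

Lemma products_rsmooth f : products f -> rsmooth f.
Proof.
apply: rsmooth_coind => {}f; elim => [{}f g sf sg|{}f g _ [cf pf] _ [cg pg]].
  have [cf cg] := (rsmooth_C1 sf, rsmooth_C1 sg); split; first exact: C1M.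
  move=> i; rewrite rpartialM//.
  exact: products_D (products_M sf (rsmooth_rpartial i sg))
                    (products_M (rsmooth_rpartial i sf) sg).
split; first exact: C1D.
by move=> i; rewrite rpartialD//; exact: products_D.
Qed.

Lemma rsmoothM f g : rsmooth f -> rsmooth g -> rsmooth (f \* g).
Proof. by move=> sf sg; apply: products_rsmooth; exact: products_M. Qed.

Lemma rsmoothZ (c : R) f : rsmooth f -> rsmooth (fun x => c * f x).
Proof. by move=> sf; exact: (rsmoothM (rsmooth_cst c) sf). Qed.

Lemma rsmoothD f g : rsmooth f -> rsmooth g -> rsmooth (f \+ g).
Proof.
move=> sf sg; have one (h : V -> R) : h = cst 1 \* h by apply/funext => x; rewrite /= mul1r.
rewrite (one f) (one g); apply: products_rsmooth.
exact: products_D (products_M (rsmooth_cst 1) sf) (products_M (rsmooth_cst 1) sg).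
Qed.

Lemma rsmoothN f : rsmooth f -> rsmooth (fun x => - f x).
Proof. by move=> sf; under eq_fun do rewrite -mulN1r; exact: rsmoothZ. Qed.

Lemma rsmoothB f g : rsmooth f -> rsmooth g -> rsmooth (fun x => f x - g x).
Proof. by move=> sf sg; exact: (rsmoothD sf (rsmoothN sg)). Qed.

(** Go from [y] to [x] one coordinate at a time; in the sup norm each of the [d] moves costs at most
    [B * |x - y|]. *)
Lemma C1_lipschitz f (B : R) : C1 f -> (forall i x, `|rpartial i f x| <= B) ->
  forall x y, `|f x - f y| <= d%:R * B * `|x - y|.
Proof.
move=> [_ df] fB x y.
pose p k : V := \row_i if (i < k)%N then x 0 i else y 0 i.
have step k : (k <= d)%N -> `|f (p k) - f y| <= k%:R * B * `|x - y|.
  elim: k => [_|k IHk kd].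
    rewrite (_ : p 0%N = y) ?subrr ?normr0 ?mul0r//.
    by apply/rowP => i; rewrite mxE.
  have pS : p k.+1 = p k + ((x - y) 0 (Ordinal kd)) *: e_ (Ordinal kd).
    apply/rowP => i; rewrite !mxE/= -val_eqE/= ltnS leq_eqVlt.
    case: eqP => [ik|_]/=; last by rewrite mulr0 addr0.
    rewrite ik ltnn mulr1 (_ : i = Ordinal kd); last exact/val_inj.
    by rewrite addrC subrK.
  rewrite -(subrK (f (p k)) (f (p k.+1))) -addrA (le_trans (ler_normD _ _))//.
  rewrite (_ : k.+1%:R * B * _ = B * `|x - y| + k%:R * B * `|x - y|); last first.
    by rewrite -natr1; ring.
  apply: lerD; last exact: IHk (ltnW kd).
  rewrite pS.
  apply: le_trans (bounded_derive_lipschitz (B := B) _ _ _) _.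
  - by move=> h; exact: df.
  - by move=> h; rewrite -rpartialE; exact: fB.
  - rewrite ler_wpM2l ?rV_coord_le_norm//.
    by apply: le_trans (fB (Ordinal kd) 0).
have := step d (leqnn _); rewrite (_ : p d = x)//.
by apply/rowP => i; rewrite mxE ltn_ord.
Qed.

(** The second difference is symmetric in the two directions and equals [h ^+ 2] times either mixed
    derivative at some point near [x]; both mixed derivatives are continuous at [x], so they agree
    there. *)
Lemma rpartialC f i j : rsmooth f -> rpartial i (rpartial j f) = rpartial j (rpartial i f).
Proof.
move=> sf; apply/funext => x; apply/eqP; rewrite -subr_eq0 -normr_eq0; apply/eqP.
have [_ df] := rsmooth_C1 sf.
have [_ dif] := rsmooth_C1 (rsmooth_rpartial i sf).
have [_ djf] := rsmooth_C1 (rsmooth_rpartial j sf).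
(* The second difference of f over a square of side h, by the mean value theorem. *)
have diff (a b : 'I_d) (h : R) : 0 < h -> exists p : V, `|x - p| <= 2 * h /\
    f (x + h *: e_ b + h *: e_ a) - f (x + h *: e_ b) - (f (x + h *: e_ a) - f x) =
    h * (h * rpartial b (rpartial a f) p).
  move=> h0.
  have [_ daf] := rsmooth_C1 (rsmooth_rpartial a sf).
  pose g y := f (y + h *: e_ b) - f y.
  have dshift (y : V) : derivable (fun z => f (z + h *: e_ b)) y (e_ a) /\
      'D_(e_ a) (fun z => f (z + h *: e_ b)) y = 'D_(e_ a) f (y + h *: e_ b).
    have [d1 e1] := derive_line (fun z => f (z + h *: e_ b)) y (e_ a).
    have [d2 e2] := derive_line f (y + h *: e_ b) (e_ a).
    have E : (fun k : R => f (y + k *: e_ a + h *: e_ b)) =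
             (fun k : R => f (y + h *: e_ b + k *: e_ a)).
      by apply/funext => k; rewrite addrAC.
    split; last by rewrite e1 E e2.
    by apply: (d1.2 _); rewrite E; apply: (d2.1 _); exact: (df a (y + h *: e_ b)).
  have dg (k : R) : derivable g (x + k *: e_ a) (e_ a).
    by apply: derivableB; [exact: (dshift _).1|exact: df].
  have [c /andP[c0 ch] gE] := mvt_line h0 dg.
  have [c' /andP[c'0 c'h] g'E] := @mvt_line _ _ (rpartial a f) (x + c *: e_ a) (e_ b) h h0
    (fun k => daf _ _).
  exists (x + c *: e_ a + c' *: e_ b); split.
    rewrite -addrA opprD addNKr normrN (le_trans (ler_normD _ _))//.
    rewrite !normrZ mulr_natl mulr2n.
    have ne (k : 'I_d) : `|e_ k| <= 1.
      apply: rV_norm_le => // l; rewrite mxE /=; case: (l == k) => /=;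
      by rewrite ?normr1 ?normr0.
    by apply: lerD; rewrite ger0_norm ?(ltW c0) ?(ltW c'0)// -[leRHS]mulr1 ler_pM// ltW.
  rewrite (rpartialE b) -g'E addrAC (_ : _ - _ = g (x + h *: e_ a) - g x); last first.
    by rewrite /g [x + h *: e_ a + _]addrAC; ring.
  rewrite gE; congr (_ * _); rewrite deriveB; [|exact: (dshift _).1|exact: df].
  by rewrite (dshift _).2 !rpartialE.
apply/eqP; rewrite eq_le normr_ge0 andbT; apply/ler_addgt0Pr => e e0; rewrite add0r.
have cij := (rsmooth_C1 (rsmooth_rpartial i (rsmooth_rpartial j sf))).1 x.
have cji := (rsmooth_C1 (rsmooth_rpartial j (rsmooth_rpartial i sf))).1 x.
have e20 : 0 < e / 2 by rewrite divr_gt0.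
have [r1 /= r10 h1] := (nbhs_ballP _ _).1 ((cvgrPdist_le _ _).1 cij _ e20).
have [r2 /= r20 h2] := (nbhs_ballP _ _).1 ((cvgrPdist_le _ _).1 cji _ e20).
(* The points supplied by [diff] lie within [2 * h] of [x], so a quarter of the smaller radius keeps
   them in both balls. *)
pose h := Num.min r1 r2 / 4.
have h0 : 0 < h by rewrite divr_gt0// lt_min r10.
have h2r : 2 * h < Num.min r1 r2.
  have : 0 < Num.min r1 r2 by rewrite lt_min r10 r20.
  by rewrite /h; move: (Num.min r1 r2) => m m0; lra.
have [p [xp pE]] := diff j i h h0; have [q [xq qE]] := diff i j h h0.
have {}h1 := h1 p; have {}h2 := h2 q.
have bp : ball x r1 p.
  rewrite mx_norm_ball /ball_/=; apply: le_lt_trans xp _; apply: lt_le_trans h2r _.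
  by rewrite ge_min lexx.
have bq : ball x r2 q.
  rewrite mx_norm_ball /ball_/=; apply: le_lt_trans xq _; apply: lt_le_trans h2r _.
  by rewrite ge_min lexx orbT.
have pq : rpartial i (rpartial j f) p = rpartial j (rpartial i f) q.
  have hn0 : h != 0 by rewrite gt_eqF.
  apply: (mulfI hn0); apply: (mulfI hn0); rewrite -pE -qE.
  by rewrite [x + h *: e_ j + h *: e_ i]addrAC; ring.
have {}h1 := h1 bp; have {}h2 := h2 bq.
rewrite (_ : _ - _ = (rpartial i (rpartial j f) x - rpartial i (rpartial j f) p) -
   (rpartial j (rpartial i f) x - rpartial j (rpartial i f) q)); last by rewrite pq; ring.
by rewrite (le_trans (ler_normB _ _))// [leRHS]splitr lerD.
Qed.

Lemma rsmooth_foldr f s : rsmooth f -> rsmooth (foldr rpartial f s).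
Proof. by move=> sf; elim: s => // i s IHs; exact: (rsmooth_rpartial i IHs). Qed.

Lemma foldr_rpartial_rem f s i : rsmooth f -> i \in s ->
  foldr rpartial f s = rpartial i (foldr rpartial f (rem i s)).
Proof.
move=> sf; elim: s => // j s IHs; rewrite inE /=; have [->//|ij /= js] := eqVneq j i.
by rewrite /= (IHs js) rpartialC//; exact: (rsmooth_foldr (rem i s) sf).
Qed.

Lemma foldr_rpartial_perm f s1 s2 : rsmooth f -> perm_eq s1 s2 ->
  foldr rpartial f s1 = foldr rpartial f s2.
Proof.
move=> sf; elim: s1 s2 => [|i s1 IHs] s2 p12.
  by have /eqP := perm_size p12; rewrite eq_sym size_eq0 => /eqP ->.
have is2 : i \in s2 by rewrite -(perm_mem p12) mem_head.
rewrite (foldr_rpartial_rem sf is2)/= (IHs (rem i s2))//.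
by rewrite -(perm_cons i) (perm_trans p12)// perm_to_rem.
Qed.

Definition seq_of_multi (a : 'I_d -> nat) : seq 'I_d :=
  flatten [seq nseq (a i) i | i <- enum 'I_d].

Lemma foldr_partial_multi T (D : 'I_d -> T -> T) (a : 'I_d -> nat) (f : T) :
  foldr (fun i => iter (a i) (D i)) f (enum 'I_d) = foldr D f (seq_of_multi a).
Proof.
rewrite /seq_of_multi; elim: (enum 'I_d) => //= i s ->.
rewrite foldr_cat; elim: (a i) => //= n ->.
by [].
Qed.

Lemma count_seq_of_multi (a : 'I_d -> nat) i : count_mem i (seq_of_multi a) = a i.
Proof.
rewrite /seq_of_multi count_flatten -map_comp sumnE big_map big_enum/=.
rewrite (bigD1 i)//= count_nseq /= eqxx mul1n big1 ?addn0// => j ji.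
by rewrite count_nseq/= (negbTE ji) mul0n.
Qed.

Lemma size_seq_of_multi (a : 'I_d -> nat) : size (seq_of_multi a) = (\sum_i a i)%N.
Proof.
rewrite /seq_of_multi size_flatten /shape -map_comp sumnE big_map big_enum/=.
by apply: eq_bigr => i _; rewrite size_nseq.
Qed.

Lemma mpartial_seq (f : V -> R[i]) (a : 'I_d -> nat) :
  mpartial a f = foldr partial f (seq_of_multi a).
Proof. exact: foldr_partial_multi. Qed.

(** Partial derivatives commute, so a word of directions acts only through its multiplicities; this
    identifies derivatives along words with the multi-index derivatives of the definitions. *)
Lemma foldr_partial_count (f : V -> R[i]) (s : seq 'I_d) : smooth f ->
  foldr partial f s = mpartial (fun i => count_mem i s) f.
Proof.
move=> /smoothP[s1 s2]; rewrite mpartial_seq !foldr_partialE.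
have ps : perm_eq s (seq_of_multi (fun i => count_mem i s)).
  by apply/allP => i _ /=; rewrite count_seq_of_multi.
by rewrite (foldr_rpartial_perm s1 ps) (foldr_rpartial_perm s2 ps).
Qed.

End smooth.

Section smooth_comp.
Context {R : realType} {m d : nat}.

(* Precomposition with such a map rescales partial derivatives one by one, so
   that no multivariate chain rule is needed. *)
Definition axial (io : 'rV[R]_m -> 'rV[R]_d) (a : 'I_m -> R) (k : 'I_m -> 'I_d) :=
  continuous io /\
  forall (j : 'I_m) x (h : R),
    io (x + h *: delta_mx 0 j) = io x + (h * a j) *: delta_mx 0 (k j).

Lemma C1_comp io a k (f : 'rV[R]_d -> R) : axial io a k -> C1 f ->
  C1 (f \o io) /\ forall j, rpartial j (f \o io) = (fun x => a j * rpartial (k j) f (io x)).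
Proof.
move=> [cio ax] [cf df].
have dcomp j x : is_derive x (delta_mx 0 j : 'rV[R]_m) (f \o io) (a j * rpartial (k j) f (io x)).
  have [d1 e1] := derive_line (f \o io) x (delta_mx 0 j).
  have E : (fun h : R => (f \o io) (x + h *: delta_mx 0 j)) =
     (fun h : R => f (io x + h *: delta_mx 0 (k j))) \o (fun h => h * a j).
    by apply/funext => h /=; rewrite ax.
  have dl : is_derive (0 * a j) 1 (fun h : R => f (io x + h *: delta_mx 0 (k j)))
       (rpartial (k j) f (io x)).
    have := is_derive_line (df (k j) (io x + (0 * a j) *: delta_mx 0 (k j))).
    by rewrite {2}mul0r scale0r addr0 -rpartialE.
  have dm : is_derive (0 : R) 1 (fun h : R => h * a j) (a j).
    rewrite -[X in is_derive _ _ _ X]mulr1 (_ : (fun h => h * a j) = a j \*: id).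
      exact: is_deriveZ.
    by apply/funext => h; exact: mulrC.
  have := @is_derive1_comp _ (fun h : R => f (io x + h *: delta_mx 0 (k j)))
    (fun h => h * a j) 0 _ _ dl dm.
  rewrite -E => dd.
  apply: DeriveDef; first by apply/d1; exact: ex_derive.
  by rewrite e1 derive_val mulrC.
split; last by move=> j; apply/funext => x; rewrite [LHS]rpartialE derive_val.
split => [x|j x]; last exact: ex_derive.
exact: (continuous_comp (cio x) (cf (io x))).
Qed.

(** The scalar multiples of functions [f \o io] with [f] smooth form a stable class, because an
    axial map only rescales each partial derivative. *)
Lemma rsmooth_comp io a k (f : 'rV[R]_d -> R) : axial io a k -> rsmooth f ->
  rsmooth (f \o io).
Proof.
move=> ax sf.
apply: (rsmooth_coind (P := fun g => exists c f, rsmooth f /\ g = (fun x => c * f (io x)))).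
  move=> _ [c [{sf}f [sf ->]]].
  have [C1f dE] := C1_comp ax (rsmooth_C1 sf).
  have C1c : C1 (cst c : 'rV[R]_m -> R) := rsmooth_C1 (rsmooth_cst c).
  split; first exact: (C1M C1c C1f).
  move=> j; exists (c * a j), (rpartial (k j) f); split; first exact: rsmooth_rpartial.
  rewrite -[fun x => c * f (io x)]/(cst c \* (f \o io)) rpartialM// dE.
  apply/funext => x /=; rewrite (rpartialE _ (cst c)) derive_cst mul0r addr0.
  by rewrite mulrA.
by exists 1, f; split => //; apply/funext => x; rewrite mul1r.
Qed.

End smooth_comp.

(** * Differentiation under the integral sign *)

Section parametric_integral.
Context {R : realType} (n : nat) d (T : measurableType d).
Context (mu : {measure set T -> \bar R}).
Local Notation V := 'rV[R]_n.
Variables (k : V -> T -> R) (B : T -> R).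
Hypothesis intk : forall x, mu.-integrable setT (EFin \o k x).
Hypothesis C1k : forall z, C1 (k ^~ z).
Hypothesis intB : mu.-integrable setT (EFin \o B).
Hypothesis kB : forall i x z, `|rpartial i (k ^~ z) x| <= B z.

Let F x := \int[mu]_z k x z.

Lemma rpartial_integral i x :
  derivable F x (delta_mx 0 i) /\
  rpartial i F x = \int[mu]_z rpartial i (k ^~ z) x.
Proof.
pose e_i : V := delta_mx 0 i.
pose f (h : R) z := k (x + h *: e_i) z.
have df h z : derivable (f ^~ z) h 1 /\ 'D_1 (f ^~ z) h = rpartial i (k ^~ z) (x + h *: e_i).
  have [_ dk] := C1k z.
  have := is_derive_line (dk i (x + h *: e_i)).
  by rewrite -rpartialE => H; split; [exact: ex_derive|rewrite derive_val].
have B0 z : 0 <= B z by exact: le_trans (kB i 0 z).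
have I0 : `]-1, 1[%classic (0 : R) by rewrite /= in_itv/= ltrN10 ltr01.
have H1 h : `]-1, 1[%classic h -> mu.-integrable setT (EFin \o f h) by move=> _; exact: intk.
have H2 h z : `]-1, 1[%classic h -> setT z -> derivable (f ^~ z) h 1 by move=> _ _; exact: (df h z).1.
have H3 h z : `]-1, 1[%classic h -> setT z -> `|partial1of2 f h z| <= B z.
  by move=> _ _; rewrite partial1of2E (df h z).2; exact: kB.
have [d1 e1] := derive_line F x e_i.
have E : (fun h : R => F (x + h *: e_i)) = (fun h => \int[mu]_z f h z) by [].
split.
  apply/d1; rewrite E.
  exact: (@derivable_under_integral _ _ _ mu f setT measurableT 0 (-1) 1 I0 H1 H2 B B0 intB H3).
rewrite rpartialE e1 E -derive1E.
rewrite (@differentiation_under_integral _ _ _ mu f setT measurableT 0 (-1) 1 I0 H1 H2 B B0 intB H3).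
by apply: eq_Rintegral => z _; rewrite partial1of2E (df 0 z).2 scale0r addr0.
Qed.

(** The bound on the partial derivatives makes each [k ^~ z] Lipschitz with constant [n * B z];
    integrating it gives the continuity of [F]. *)
Lemma parametric_integral_lipschitz x y :
  `|F x - F y| <= n%:R * (\int[mu]_z B z) * `|x - y|.
Proof.
rewrite -RintegralB//.
have intD : mu.-integrable setT (EFin \o (fun z => k x z - k y z)).
  rewrite /comp; under eq_fun do rewrite EFinB.
  exact: (integrableB measurableT (intk x) (intk y)).
apply: le_trans (le_normr_Rintegral measurableT intD) _.
have -> : n%:R * (\int[mu]_z B z) * `|x - y| = \int[mu]_z (n%:R * `|x - y| * B z).
  by rewrite RintegralZl//; ring.
apply: le_Rintegral => //.
- exact: integrable_norm intD.
- by rewrite /comp; under eq_fun do rewrite EFinM; exact: integrableZl.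
- move=> z _; rewrite mulrAC; apply: (@C1_lipschitz _ _ (k ^~ z)) => // i w.
Qed.

Lemma lipschitz_continuous_rV (f : V -> R) (L : R) :
  (forall x y, `|f x - f y| <= L * `|x - y|) -> continuous f.
Proof.
move=> fL x; apply: (cvgrPdist_le (F := nbhs x) _ _).2 => e e0.
have L0 : 0 < `|L| + 1 by rewrite ltr_wpDl.
apply/nbhs_ballP; exists (e / (`|L| + 1)); first by rewrite /= divr_gt0.
move=> y; rewrite mx_norm_ball /ball_/= ltr_pdivlMr// => xy.
apply: le_trans (fL _ _) _; apply: le_trans _ (ltW xy); rewrite mulrC ler_wpM2l//.
by apply: le_trans (ler_norm _) _; rewrite lerDl.
Qed.

Lemma C1_parametric_integral : C1 F.
Proof.
split; last by move=> i x; have [] := rpartial_integral i x.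
exact: lipschitz_continuous_rV parametric_integral_lipschitz.
Qed.

End parametric_integral.

Section weight_bounds.
Context {R : realType} (n : nat).
Implicit Types (f : 'rV[R]_n -> R) (x : 'rV[R]_n).

(** Trades [2 * n] powers of [1 + |x|] for the integrable weight; in each coordinate,
    [1 + x_i^2 <= (1 + |x|)^2]. *)
Lemma wt_ge x : 1 <= (1 + `|x|) ^+ (2 * n) * wt x.
Proof.
rewrite /wt exprM (_ : (_ ^+ 2) ^+ n = \prod_(i < n) (1 + `|x|) ^+ 2); last first.
  by rewrite prodr_const card_ord.
rewrite -big_split/=; elim/big_rec : _ => // i y _ y1; apply: mulr_ege1 => //.
have h : 0 < 1 + x 0 i ^+ 2 by rewrite ltr_pwDl// sqr_ge0.
rewrite ler_pdivlMr// mul1r -(real_normK (num_real (x 0 i))) sqrrD expr1n mul1r.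
apply: lerD; last by rewrite lerXn2r ?nnegrE// rV_coord_le_norm.
by rewrite lerDl mulrn_wge0.
Qed.

Lemma compact_support_bounded f (r : R) : continuous f ->
  (forall x, r < `|x| -> f x = 0) -> exists2 M, 0 <= M & forall x, `|f x| <= M.
Proof.
move=> cf f0.
have cB : compact [set x : 'rV[R]_n | `|x| <= r].
  apply: bounded_closed_compact.
    by exists r; split; [exact: num_real|move=> M rM x /= xr; rewrite (le_trans xr)// ltW].
  rewrite (_ : [set _ | _] = (@Num.norm _ 'rV[R]_n) @^-1` [set y | y <= r])//.
  by apply: closed_comp => [x _|]; [exact: norm_continuous|exact: closed_le].
have /compact_bounded[M [_ fM]] := continuous_compact (continuous_subspaceT cf) cB.
exists (`|M| + 1) => // x; have [xr|/f0 ->] := leP `|x| r; last by rewrite normr0.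
apply: fM; last by exists x.
by rewrite (le_lt_trans (ler_norm _))// ltrDl.
Qed.

Lemma compact_support_wt f (r M : R) : (forall x, r < `|x| -> f x = 0) ->
  (forall x, `|f x| <= M) -> forall x, `|f x| <= M * (1 + `|r|) ^+ (2 * n) * wt x.
Proof.
move=> f0 fM x; have M0 : 0 <= M by exact: le_trans (fM x).
have [xr|/f0 ->] := leP `|x| r; last first.
  by rewrite normr0 !mulr_ge0 ?exprn_ge0 ?addr_ge0 ?(ltW (wt_gt0 _)).
apply: le_trans (fM x) _; rewrite -mulrA ler_peMr//.
apply: le_trans (wt_ge x) _; rewrite ler_wpM2r ?(ltW (wt_gt0 _))//.
by rewrite lerXn2r ?nnegrE ?addr_ge0// lerD2l (le_trans xr) ?ler_norm.
Qed.

Lemma wt_bounded_integrable f (C : R) : measurable_fun setT f ->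
  (forall x, `|f x| <= C * wt x) -> (leb n).-integrable setT (EFin \o f).
Proof.
move=> mf fC.
have h : (leb n).-integrable setT (fun x => C%:E * (wt x)%:E)%E.
  by apply: integrableZl => //; exact: integrable_wt.
apply: (le_integrable measurableT _ _ h); first exact/measurable_EFinP.
by move=> x _ /=; rewrite lee_fin (le_trans (fC x))// ler_norm.
Qed.

End weight_bounds.

(** * Test functions *)

Section test_functions.
Context {R : realType} {n : nat}.
Implicit Types (f g : 'rV[R]_n -> R) (x : 'rV[R]_n).
Local Notation V := 'rV[R]_n.

Definition rtest f := rsmooth f /\ exists r : R, forall x, r < `|x| -> f x = 0.

Lemma open_norm_gt (r : R) : open [set x : V | r < `|x|].
Proof.
rewrite (_ : [set _ | _] = (@Num.norm _ V) @^-1` [set y | r < y])//.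
by apply: open_comp => [x _|]; [exact: norm_continuous|exact: open_gt].
Qed.

Lemma rpartial_eq0 f (U : set V) i : open U -> (forall x, U x -> f x = 0) ->
  forall x, U x -> rpartial i f x = 0.
Proof.
move=> oU f0 x Ux; rewrite rpartialE (@near_eq_derive _ _ _ f (cst 0)) ?derive_cst//.
by have := open_nbhs_nbhs (conj oU Ux); apply: filterS => y /f0.
Qed.

Lemma rtest_rpartial f i : rtest f -> rtest (rpartial i f).
Proof.
move=> [sf [r f0]]; split; first exact: rsmooth_rpartial.
by exists r => x xr; apply: (rpartial_eq0 (U := [set x | r < `|x|])) => //; exact: open_norm_gt.
Qed.

Lemma rtest_foldr f s : rtest f -> rtest (foldr rpartial f s).
Proof. by move=> tf; elim: s => // i s IHs; exact: (rtest_rpartial i IHs). Qed.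

Lemma rtestM f g : rtest f -> rsmooth g -> rtest (f \* g).
Proof.
move=> [sf [r f0]] sg; split; first exact: rsmoothM.
by exists r => x /f0 /= ->; rewrite mul0r.
Qed.

Lemma rtestD f g : rtest f -> rtest g -> rtest (f \+ g).
Proof.
move=> [sf [r f0]] [sg [r' g0]]; split; first exact: rsmoothD.
by exists (Num.max r r') => x; rewrite gt_max => /andP[/f0 /= -> /g0 ->]; rewrite addr0.
Qed.

Lemma rtest_continuous f : rtest f -> continuous f.
Proof. by move=> [/rsmooth_C1[]]. Qed.

Lemma rtest_measurable f : rtest f -> measurable_fun setT f.
Proof. by move=> tf; apply: continuous_measurable_rV; exact: rtest_continuous. Qed.

Lemma rtest_bounded f : rtest f -> exists2 M, 0 <= M & forall x, `|f x| <= M.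
Proof.
move=> tf; have cf := rtest_continuous tf; have [_ [r f0]] := tf.
exact: compact_support_bounded f0.
Qed.

Lemma rtest_wt f : rtest f -> exists2 C, 0 <= C & forall x, `|f x| <= C * wt x.
Proof.
move=> tf; have [M M0 fM] := rtest_bounded tf; have [_ [r f0]] := tf.
exists (M * (1 + `|r|) ^+ (2 * n)); last exact: compact_support_wt.
by rewrite mulr_ge0// exprn_ge0// addr_ge0.
Qed.

Lemma rtest_integrable f : rtest f -> (leb n).-integrable setT (EFin \o f).
Proof.
move=> tf; have [C _ fC] := rtest_wt tf.
exact: wt_bounded_integrable (rtest_measurable tf) fC.
Qed.

Lemma rtest_lipschitz f : rtest f ->
  exists2 L, 0 <= L & forall x y, `|f x - f y| <= L * `|x - y|.
Proof.
move=> tf.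
have /choice[M /all_and2[M0 fM]] : forall i, exists M, 0 <= M /\ forall x, `|rpartial i f x| <= M.
  by move=> i; have [M M0 fM] := rtest_bounded (rtest_rpartial i tf); exists M.
exists (n%:R * \sum_i M i); first by rewrite mulr_ge0// sumr_ge0.
apply: C1_lipschitz; first exact: rsmooth_C1 tf.1.
move=> i x; apply: le_trans (fM i x) _.
by rewrite (bigD1 i)//= lerDl sumr_ge0.
Qed.

(* Differentiate under the integral sign the constant integral of a translate of f. *)
Lemma integral_rpartial f i (r : R) : C1 f -> continuous (rpartial i f) ->
  (forall x, r < `|x| -> f x = 0) -> \int[leb n]_x rpartial i f x = 0.
Proof.
move=> [cf df] cdf f0.
have [M M0 fM] := compact_support_bounded cf f0.
have df0 x : r < `|x| -> rpartial i f x = 0.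
  by move=> xr; apply: (rpartial_eq0 (U := [set x | r < `|x|])) => //; exact: open_norm_gt.
have [M' M'0 dfM] := compact_support_bounded cdf df0.
pose e_i : V := delta_mx 0 i.
pose k (h : R) x := f (x + h *: e_i).
have intf : (leb n).-integrable setT (EFin \o f).
  apply: (wt_bounded_integrable _ (compact_support_wt f0 fM)).
  exact: continuous_measurable_rV.
have ne : `|e_i| <= 1.
  apply: rV_norm_le => // l; rewrite mxE /=; case: (l == i) => /=;
  by rewrite ?normr1 ?normr0.
(* For [|h| <= 1] the translated derivatives are supported in the ball of radius [|r| + 1], so one
   multiple of the weight dominates them all. *)
pose G x := M' * (1 + `| `|r| + 1 |) ^+ (2 * n) * wt x.
have G0 x : 0 <= G x.
  by rewrite !mulr_ge0// ?exprn_ge0 ?addr_ge0// ltW// wt_gt0.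
have dk (h : R) x : is_derive h 1 (k ^~ x) (rpartial i f (x + h *: e_i)).
  by rewrite rpartialE; exact: (is_derive_line (df i (x + h *: e_i))).
have I0 : `]-1, 1[%classic (0 : R) by rewrite /= in_itv/= ltrN10 ltr01.
have H1 h : `]-1, 1[%classic h -> (leb n).-integrable setT (EFin \o k h).
  move=> _; have := integrable_affine (h *: e_i) (oner_neq0 R) intf.
  by under eq_fun do rewrite scale1r.
have H2 h x : `]-1, 1[%classic h -> setT x -> derivable (k ^~ x) h 1.
  by move=> _ _; exact: (@ex_derive _ _ _ _ _ _ _ (dk h x)).
have H3 h x : `]-1, 1[%classic h -> setT x -> `|partial1of2 k h x| <= G x.
  rewrite /= in_itv/= => h1 _; rewrite partial1of2E; have dhx := dk h x; rewrite derive_val.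
  have := @compact_support_wt _ _ (fun x => rpartial i f (x + h *: e_i)) (`|r| + 1) M' _ _ x.
  apply => [y yr|y]; last exact: dfM.
  apply: df0; have := ler_normB (y + h *: e_i) (h *: e_i); rewrite addrK => yh.
  have : `|h *: e_i| <= 1 by rewrite normrZ mulr_ile1// ler_norml; case/andP: h1 => /ltW-> /ltW->.
  have := ler_norm r; move: (`|_ + _|) (`|h *: e_i|) (`|y|) yr yh => *; lra.
have intG : (leb n).-integrable setT (EFin \o G).
  rewrite /G /comp; under eq_fun do rewrite EFinM.
  by apply: integrableZl => //; exact: integrable_wt.
have := @differentiation_under_integral _ _ _ (leb n) k setT measurableT 0 (-1) 1 I0 H1 H2 G G0 intG H3.
rewrite (_ : (fun h => _) = cst (\int[leb n]_x f x)); last first.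
  apply/funext => h /=; rewrite /Rintegral; congr fine.
  have := integral_affine (h *: e_i) (oner_neq0 R) intf.
  rewrite normr1 invr1 expr1n mul1e => <-.
  by apply: eq_integral => x _; rewrite scale1r.
rewrite derive1_cst => ->; apply: eq_Rintegral => x _.
by rewrite partial1of2E; have dhx := dk 0 x; rewrite derive_val scale0r addr0.
Qed.

End test_functions.

Section ridge.
Context {R : realType} {n : nat}.
Implicit Types (a : 'I_n -> R) (b : R) (x : 'rV[R]_n).

(** Valued in ['rV_1] rather than in [R], so as to be an [axial] map: ridge functions are then
    compositions to which [C1_comp] applies. *)
Definition ridge a b x : 'rV[R]_1 := const_mx (\sum_i a i * x 0 i + b).

Lemma axial_ridge a b : axial (ridge a b) a (fun=> ord0).
Proof.
have add x y : ridge a b (x + y) - ridge a b x = const_mx (\sum_i a i * y 0 i).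
  apply/rowP => j; rewrite !mxE opprD addrACA subrr addr0 -sumrB.
  by apply: eq_bigr => i _; rewrite mxE; ring.
split; last first.
  move=> j x h; apply/eqP; rewrite -subr_eq0 opprD addrA add; apply/eqP/rowP => l.
  rewrite !mxE (bigD1 j)//= big1 ?addr0.
    by rewrite !mxE !eqxx (ord1 l) eqxx/=; ring.
  by move=> i /negbTE ij; rewrite !mxE ij andbF !mulr0.
move=> x; apply: (cvgrPdist_le (F := nbhs x) _ _).2 => e e0.
have L0 : 0 < \sum_i `|a i| + 1 by rewrite ltr_wpDl// sumr_ge0.
apply/nbhs_ballP; exists (e / (\sum_i `|a i| + 1)); first by rewrite /= divr_gt0.
move=> y; rewrite mx_norm_ball /ball_/= ltr_pdivlMr// => xy.
have E : y + (x - y) = x by rewrite addrC subrK.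
have := add y (x - y); rewrite E => ->.
apply: rV_norm_le => [|l]; first exact: ltW.
rewrite mxE; apply: le_trans _ (ltW xy); rewrite mulrDr mulr1 mulr_sumr.
apply: le_trans (ler_norm_sum _ _ _) _; rewrite ler_wpDr// ler_sum// => i _.
by rewrite normrM mulrC ler_wpM2r// rV_coord_le_norm.
Qed.

Lemma C1_line (g : R -> R) (dg : R -> R) : (forall x : R, is_derive x 1 g (dg x)) ->
  C1 (fun v : 'rV[R]_1 => g (v 0 0)) /\
  rpartial ord0 (fun v : 'rV[R]_1 => g (v 0 0)) = (fun v => dg (v 0 0)).
Proof.
move=> dgx.
have lin (v : 'rV[R]_1) (h : R) : (v + h *: delta_mx 0 ord0) 0 0 = v 0 0 + h.
  by rewrite !mxE !eqxx mulr1.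
have d0 (v : 'rV[R]_1) :
    is_derive v (delta_mx 0 ord0 : 'rV[R]_1) (fun v : 'rV[R]_1 => g (v 0 0)) (dg (v 0 0)).
  have [d1 e1] := derive_line (fun v : 'rV[R]_1 => g (v 0 0)) v (delta_mx 0 ord0).
  have dd : is_derive (0 : R) 1 (fun h : R => g ((v + h *: delta_mx 0 ord0) 0 0)) (dg (v 0 0)).
    rewrite (_ : (fun h => _) = fun h => g (v 0 0 + h *: 1)); last first.
      by apply/funext => h; rewrite lin; congr (g (_ + _)); rewrite [RHS]mulr1.
    have := @is_derive_line _ _ g (v 0 0) 1 0.
    rewrite scale0r addr0 => H; have dd := dgx (v 0 0).
    have <- : 'D_1 g (v 0 0) = dg (v 0 0) by rewrite derive_val.
    by apply: H; exact: ex_derive.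
  apply: DeriveDef; first by apply/d1; exact: ex_derive.
  by rewrite e1 derive_val.
split; last by apply/funext => v; rewrite rpartialE derive_val.
split => [v|i v]; last by rewrite (ord1 i); exact: ex_derive.
have cg : {for v 0 0, continuous g}.
  by apply/differentiable_continuous/derivable1_diffP;
    exact: (@ex_derive _ _ _ _ _ _ _ (dgx (v 0 0))).
exact: (continuous_comp (@coord_continuous _ _ _ 0 0 v) cg).
Qed.

Lemma C1_ridge_comp (g dg : R -> R) a b : (forall x : R, is_derive x 1 g (dg x)) ->
  C1 (fun x => g (\sum_i a i * x 0 i + b)) /\
  forall i, rpartial i (fun x => g (\sum_i a i * x 0 i + b)) =
            (fun x => a i * dg (\sum_i a i * x 0 i + b)).
Proof.
move=> dgx; have [C1g gE] := C1_line dgx.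
have [H1 H2] := C1_comp (axial_ridge a b) C1g.
have E : (fun x => g (\sum_i a i * x 0 i + b)) = (fun v : 'rV[R]_1 => g (v 0 0)) \o ridge a b.
  by apply/funext => x /=; rewrite mxE.
rewrite E; split => // i; rewrite H2 gE; apply/funext => x.
by rewrite mxE.
Qed.

End ridge.

(** * Fourier transforms and approximate identities *)

Section cosine_transform.
Context {R : realType} {n : nat}.
Implicit Types (f : 'rV[R]_n -> R) (b : R) (x z : 'rV[R]_n).

(* Real-valued: the phases b = 0 and b = - (pi / 2) give the real and the
   imaginary part of the inverse Fourier transform. *)
Definition ctrans f b z : R := \int[leb n]_x (f x * cos (2 * pi * dotp x z + b)).

Lemma dotpC x z : dotp x z = dotp z x.
Proof. by apply: eq_bigr => i _; rewrite mulrC. Qed.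

Lemma dotpDl x y z : dotp (x + y) z = dotp x z + dotp y z.
Proof. by rewrite /dotp -big_split; apply: eq_bigr => i _ /=; rewrite mxE mulrDl. Qed.

Lemma dotpNl x z : dotp (- x) z = - dotp x z.
Proof. by rewrite /dotp -sumrN; apply: eq_bigr => i _ /=; rewrite mxE mulNr. Qed.

Lemma dotpZl (a : R) x z : dotp (a *: x) z = a * dotp x z.
Proof. by rewrite /dotp mulr_sumr; apply: eq_bigr => i _ /=; rewrite mxE mulrA. Qed.

Lemma measurable_cos : measurable_fun setT (@cos R).
Proof. by apply: continuous_measurable_fun; exact: continuous_cos. Qed.

Lemma measurable_dotpl z : measurable_fun setT (fun x => dotp x z).
Proof.
by apply: measurable_sum => i; apply: measurable_funM => //; exact: measurable_coord.
Qed.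

Lemma ctrans_integrable f b z : (leb n).-integrable setT (EFin \o f) ->
  (leb n).-integrable setT (EFin \o (fun x => f x * cos (2 * pi * dotp x z + b))).
Proof.
move=> intf; have /measurable_EFinP mf := measurable_int _ intf.
apply: (le_integrable measurableT _ _ intf).
  apply/measurable_EFinP; apply: measurable_funM => //.
  apply: (measurableT_comp measurable_cos); apply: measurable_funD => //.
  by apply: measurable_funM => //; exact: measurable_dotpl.
move=> x _ /=; rewrite lee_fin normrM ler_piMr//.
by rewrite ler_norml cos_geN1 cos_le1.
Qed.

Lemma C1_cos_dotp b x :
  C1 (fun z => cos (2 * pi * dotp x z + b)) /\
  forall i, rpartial i (fun z => cos (2 * pi * dotp x z + b)) =
    fun z => 2 * pi * x 0 i * cos (2 * pi * dotp x z + (b + pi / 2)).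
Proof.
have E z : 2 * pi * dotp x z = \sum_i (2 * pi * x 0 i) * z 0 i.
  by rewrite /dotp mulr_sumr; apply: eq_bigr => i _; rewrite mulrA.
have [H1 H2] := C1_ridge_comp (fun i => 2 * pi * x 0 i) b (@is_derive_cos R).
under eq_fun do rewrite E; split => // i.
rewrite H2; apply/funext => z.
by rewrite addrA E cosDpihalf.
Qed.

(** Differentiating the cosine shifts its phase by [pi / 2] and multiplies [f] by a coordinate, so
    the family [ctrans f b] is stable under derivatives. *)
Lemma ctrans_C1 f b : (leb n).-integrable setT (EFin \o f) ->
  (forall i, (leb n).-integrable setT (EFin \o (fun x => x 0 i * f x))) ->
  C1 (ctrans f b) /\ forall i,
  rpartial i (ctrans f b) = ctrans (fun x => 2 * pi * (x 0 i * f x)) (b + pi / 2).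
Proof.
move=> intf intxf.
pose k z x := f x * cos (2 * pi * dotp x z + b).
have H1 z : (leb n).-integrable setT (EFin \o k z) by exact: ctrans_integrable.
have kE x : k ^~ x = cst (f x) \* (fun z => cos (2 * pi * dotp x z + b)) by [].
have C1c x : C1 (cst (f x) : 'rV[R]_n -> R) := rsmooth_C1 (rsmooth_cst (f x)).
have H2 x : C1 (k ^~ x).
  by rewrite kE; apply: C1M; [exact: C1c|exact: (C1_cos_dotp b x).1].
have dk i x z : rpartial i (k ^~ x) z =
    2 * pi * (x 0 i * f x) * cos (2 * pi * dotp x z + (b + pi / 2)).
  rewrite kE rpartialM//; last exact: (C1_cos_dotp b x).1.
  by rewrite (C1_cos_dotp b x).2/= (rpartialE _ (cst (f x))) derive_cst; ring.
pose B x := 2 * pi * \sum_i `|x 0 i * f x|.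
have H3 : (leb n).-integrable setT (EFin \o B).
  rewrite /B /comp; under eq_fun do rewrite EFinM.
  apply: integrableZl => //; under eq_fun do rewrite -sumEFin.
  by apply: integrable_sum => // i _; exact: integrable_norm (intxf i).
have H4 i z x : `|rpartial i (k ^~ x) z| <= B x.
  rewrite dk /B normrM (le_trans (ler_piMr _ _))//.
    by rewrite ler_norml cos_geN1 cos_le1.
  rewrite normrM ger0_norm ?mulr_ge0 ?pi_ge0// ler_wpM2l ?mulr_ge0 ?pi_ge0//.
  by rewrite (bigD1 i)//= lerDl sumr_ge0.
split; first exact: (C1_parametric_integral H1 H2 H3 H4).
move=> i; apply/funext => z; rewrite (rpartial_integral H1 H2 H3 H4 i z).2.
by apply: eq_Rintegral => x _; rewrite dk.
Qed.

(** Integration by parts: the derivative of [f] times the cosine has integral 0, since [f] has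
    bounded support. *)
Lemma ctrans_rpartial f b z i : rtest f ->
  ctrans (rpartial i f) b z = - (2 * pi * z 0 i) * ctrans f (b + pi / 2) z.
Proof.
move=> tf; have [_ [r f0]] := tf; have C1f := rsmooth_C1 tf.1.
pose c x := cos (2 * pi * dotp x z + b).
have [C1c cE] : C1 c /\ forall i, rpartial i c =
    fun x => 2 * pi * z 0 i * cos (2 * pi * dotp x z + (b + pi / 2)).
  have -> : c = fun x => cos (2 * pi * dotp z x + b) by apply/funext => x; rewrite dotpC.
  have [H1 H2] := C1_cos_dotp b z; split => // j; rewrite H2.
  by apply/funext => x; rewrite dotpC.
have H : \int[leb n]_x rpartial i (f \* c) x = 0.
  apply: (integral_rpartial (r := r)).
  - exact: C1M.
  - rewrite rpartialM// cE.
    have C1df := rsmooth_C1 (rsmooth_rpartial i tf.1).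
    have C1k : C1 (cst (2 * pi * z 0 i) : 'rV[R]_n -> R) := rsmooth_C1 (rsmooth_cst _).
    have C1c' : C1 (fun x => cos (2 * pi * dotp x z + (b + pi / 2))).
      have [+ _] := C1_cos_dotp (b + pi / 2) z.
      by under eq_fun do rewrite dotpC.
    exact: (C1D (C1M C1f (C1M C1k C1c')) (C1M C1df C1c)).1.
  - by move=> x /f0 /= ->; rewrite mul0r.
have intZ : (leb n).-integrable setT
    (EFin \o (fun x => 2 * pi * z 0 i * (f x * cos (2 * pi * dotp x z + (b + pi / 2))))).
  rewrite /comp; under eq_fun do rewrite EFinM.
  apply: integrableZl => //; exact: (ctrans_integrable (b + pi / 2) z (rtest_integrable tf)).
apply/eqP; rewrite mulNr -addr_eq0 -/(ctrans _ _ _) /ctrans.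
rewrite -RintegralZl//; last exact: (ctrans_integrable (b + pi / 2) z (rtest_integrable tf)).
rewrite -RintegralD//; last exact: ctrans_integrable (rtest_integrable (rtest_rpartial i tf)).
rewrite -[X in _ == X]H; apply/eqP/eq_Rintegral => x _.
by rewrite rpartialM// cE /= /c; ring.
Qed.

Lemma ctrans_bounded f b z : (leb n).-integrable setT (EFin \o f) ->
  `|ctrans f b z| <= \int[leb n]_x `|f x|.
Proof.
move=> intf; apply: le_trans (le_normr_Rintegral measurableT (ctrans_integrable b z intf)) _.
apply: le_Rintegral => //.
- exact: integrable_norm (ctrans_integrable b z intf).
- exact: integrable_norm intf.
- by move=> x _; rewrite normrM ler_piMr// ler_norml cos_geN1 cos_le1.
Qed.

(** One integration by parts for each factor [|z 0 i|]; the factor [2 * pi >= 1] that comes with it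
    is given up. *)
Lemma ctrans_decay_coord f i m : rtest f ->
  exists2 C, 0 <= C & forall b z, `|z 0 i| ^+ m * `|ctrans f b z| <= C.
Proof.
elim: m f => [|m IHm] f tf.
  exists (\int[leb n]_x `|f x|); first by apply: Rintegral_ge0.
  by move=> b z; rewrite mul1r; apply: ctrans_bounded; exact: rtest_integrable.
have [C C0 fC] := IHm _ (rtest_rpartial i tf).
(* The phase [b - pi / 2] cancels the shift caused by the integration by parts. *)
exists C => // b z; apply: le_trans (fC (b - pi / 2) z).
rewrite ctrans_rpartial// subrK exprSr -mulrA ler_wpM2l ?exprn_ge0// normrM ler_wpM2r//.
rewrite normrN normrM ler_peMl// ger0_norm ?mulr_ge0 ?pi_ge0//.
by have := @pi_ge2 R; lra.
Qed.

(** The sup norm is attained at a coordinate, so for [|z| > 1] the coordinate bounds suffice; for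
    [|z| <= 1] the trivial bound does. *)
Lemma ctrans_decay f m : rtest f ->
  exists2 C, 0 <= C & forall b z, (1 + `|z|) ^+ m * `|ctrans f b z| <= C.
Proof.
move=> tf.
have /choice[D DP] : forall i, exists D : R, 0 <= D /\ forall b z, `|z 0 i| ^+ m * `|ctrans f b z| <= D.
  by move=> i; have [C C0 fC] := ctrans_decay_coord i m tf; exists C.
have [C C0 fC] : exists2 C, 0 <= C & forall b z, `|ctrans f b z| <= C.
  exists (\int[leb n]_x `|f x|); first by apply: Rintegral_ge0.
  by move=> b z; apply: ctrans_bounded; exact: rtest_integrable.
have D0 : 0 <= \sum_i D i by rewrite sumr_ge0// => i _; exact: (DP i).1.
exists (2 ^+ m * (C + \sum_i D i)); first by rewrite mulr_ge0 ?exprn_ge0 ?addr_ge0.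
move=> b z; have [z1|z1] := leP `|z| 1.
  apply: ler_pM => //; rewrite ?exprn_ge0 ?addr_ge0//.
    by rewrite lerXn2r ?nnegrE ?addr_ge0// lerD2l.
  by rewrite (le_trans (fC b z))// lerDl.
have [[i0 i] zi] : exists i, `|z| = `|z i.1 i.2|.
  by apply: mx_norm_neq0; rewrite -[mx_norm z]/`|z| gt_eqF// (lt_trans _ z1).
rewrite /= (ord1 i0) in zi.
apply: (@le_trans _ _ ((2 * `|z|) ^+ m * `|ctrans f b z|)).
  rewrite ler_wpM2r// lerXn2r ?nnegrE ?addr_ge0 ?mulr_ge0//.
  by rewrite mulr_natl mulr2n lerD2r ltW.
rewrite exprMn -mulrA ler_wpM2l ?exprn_ge0// zi (le_trans ((DP i).2 b z))//.
by rewrite (bigD1 i)//= addrCA lerDl addr_ge0// sumr_ge0// => j _; exact: (DP j).1.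
Qed.

End cosine_transform.

Section axial_affine.
Context {R : realType} {n : nat}.

Lemma axial_affine (a : R) (v : 'rV[R]_n) : axial (fun x => a *: x + v) (fun=> a) id.
Proof.
split; last by move=> j x h; rewrite scalerDr scalerA mulrC addrAC.
move=> x; apply: (cvgrPdist_le (F := nbhs x) _ _).2 => e e0.
have L0 : 0 < `|a| + 1 by rewrite ltr_wpDl.
apply/nbhs_ballP; exists (e / (`|a| + 1)); first by rewrite /= divr_gt0.
move=> y; rewrite mx_norm_ball /ball_/= ltr_pdivlMr// => xy.
rewrite opprD addrACA subrr addr0 -scalerBr normrZ; apply: le_trans _ (ltW xy).
by rewrite mulrC ler_wpM2l// lerDl.
Qed.

End axial_affine.

Section positivity.
Context {R : realType} {n : nat}.
Implicit Types (f : 'rV[R]_n -> R).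

(** A continuous function stays above half of a positive value on an open neighbourhood, and
    nonempty open sets have positive measure. *)
Lemma integral_gt0 f x0 : continuous f -> (leb n).-integrable setT (EFin \o f) ->
  (forall x, 0 <= f x) -> 0 < f x0 -> 0 < \int[leb n]_x f x.
Proof.
move=> cf intf f0 fx0.
pose U := f @^-1` [set y | f x0 / 2 < y].
have oU : open U by apply: open_comp => [x _|]; [exact: cf|exact: open_gt].
have mU : measurable U by exact: open_measurable_rV.
have Ux0 : U x0 by rewrite /U /=; lra.
have U0 : (0 < leb n U)%E by apply: leb_open_gt0 => //; exists x0.
have : (0 < \int[leb n]_x (f x)%:E)%E.
  apply: (@lt_le_trans _ _ (\int[leb n]_(x in U) (f x0 / 2)%:E)%E).
    by rewrite integral_cst// mule_gt0// lte_fin divr_gt0.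
  apply: (@le_trans _ _ (\int[leb n]_(x in U) (f x)%:E)%E).
    apply: ge0_le_integral => //.
    - by move=> x _; rewrite lee_fin divr_ge0// ltW.
    - by apply/measurable_EFinP/measurable_funTS; exact: continuous_measurable_rV.
    - by move=> x Ux; rewrite lee_fin ltW.
  apply: ge0_subset_integral => //.
  - by apply/measurable_EFinP; exact: continuous_measurable_rV.
  - by move=> x _; rewrite lee_fin.
rewrite /Rintegral; have := integrable_fin_num measurableT intf.
by rewrite /comp; case: (\int[_]_x _)%E.
Qed.

End positivity.

Section smooth_ctrans.
Context {R : realType} {n : nat}.
Implicit Types (f : 'rV[R]_n -> R).

Lemma rsmooth_coord i : rsmooth (fun x : 'rV[R]_n => x 0 i).
Proof.
apply: (rsmooth_coind (P := fun g => (exists c, g = cst c) \/ g = fun x => x 0 i)); last by right.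
move=> g [[c ->]|->].
  split; first exact: rsmooth_C1 (rsmooth_cst c).
  by move=> j; left; exists 0; apply/funext => x; rewrite rpartialE derive_cst.
have [H1 H2] := C1_ridge_comp (fun j : 'I_n => (j == i)%:R : R) 0 (@is_derive_id R R^~ 1).
have E : (fun x : 'rV[R]_n => x 0 i) = (fun x => id (\sum_j (j == i)%:R * x 0 j + 0)).
  apply/funext => x; rewrite addr0 (bigD1 i)//= eqxx mul1r big1 ?addr0// => j /negbTE ->.
  by rewrite mul0r.
by rewrite E; split => // j; left; rewrite H2; eexists; reflexivity.
Qed.

(** Moments are indexed by words, so that multiplying by one more coordinate is a [cons]; the
    property then passes to the derivatives of [ctrans]. *)
Definition moments_integrable f := forall s : seq 'I_n,
  (leb n).-integrable setT (EFin \o (fun x : 'rV[R]_n => (\prod_(i <- s) x 0 i) * f x)).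

Lemma rsmooth_ctrans f b : moments_integrable f -> rsmooth (ctrans f b).
Proof.
move=> mf.
apply: (rsmooth_coind (P := fun g => exists f b, moments_integrable f /\ g = ctrans f b));
  last by exists f, b.
move=> _ [{mf}f [{}b [mf ->]]].
have int0 : (leb n).-integrable setT (EFin \o f).
  by have := mf [::]; under eq_fun do rewrite big_nil mul1r.
have int1 (i : 'I_n) : (leb n).-integrable setT (EFin \o (fun x : 'rV[R]_n => x 0 i * f x)).
  by have := mf [:: i]; under eq_fun do rewrite big_seq1.
have [C1c cE] := ctrans_C1 b int0 int1; split => // i; rewrite cE.
exists (fun x : 'rV[R]_n => 2 * pi * (x 0 i * f x)), (b + pi / 2); split => // s.
rewrite (_ : _ \o _ = (fun x : 'rV[R]_n => (2 * pi)%:E * ((\prod_(i <- i :: s) x 0 i) * f x)%:E)%E).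
  by apply: integrableZl => //; exact: mf.
by apply/funext => x; rewrite /= -EFinM big_cons; congr EFin; ring.
Qed.

Lemma rtest_moments f : rtest f -> moments_integrable f.
Proof.
move=> tf s; apply: rtest_integrable.
rewrite (_ : (fun x => _) = f \* (fun x => \prod_(i <- s) x 0 i)).
  apply: rtestM => //; elim: s => [|i s IHs].
    by under eq_fun do rewrite big_nil; exact: (rsmooth_cst 1).
  under eq_fun do rewrite big_cons.
  exact: (rsmoothM (rsmooth_coord i) IHs).
by apply/funext => x /=; rewrite mulrC.
Qed.

End smooth_ctrans.

(** * Mollification at scale e *)

Section scaled_convolution.
Context {R : realType} {n : nat}.
Variable (K : 'rV[R]_n -> R).
Hypothesis intK : (leb n).-integrable setT (EFin \o K).
Implicit Types (f : 'rV[R]_n -> R) (e : R).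

(** For [e > 0] this is convolution with the kernel [e^-n K(z / e)], after the substitution that
    moves the scale onto [f]. Derivatives then fall on [f], and integrability of [K] is enough to
    take them. *)
Definition sconv e f x : R := \int[leb n]_z (f (x - e *: z) * K z).

Let mK : measurable_fun setT K.
Proof. by have /measurable_EFinP := measurable_int _ intK. Qed.

Let measurable_shift e x : measurable_fun setT (fun z : 'rV[R]_n => x - e *: z).
Proof.
have := measurable_affine (- e) x; congr measurable_fun.
by apply/funext => z; rewrite scaleNr addrC.
Qed.

Lemma sconv_integrable e f x (M : R) : measurable_fun setT f -> (forall x, `|f x| <= M) ->
  (leb n).-integrable setT (EFin \o (fun z => f (x - e *: z) * K z)).
Proof.
move=> mf fM.
have h : (leb n).-integrable setT (fun z => M%:E * (`|K z|)%:E)%E.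
  by apply: integrableZl => //; exact: integrable_norm intK.
apply: (le_integrable measurableT _ _ h).
  apply/measurable_EFinP; apply: measurable_funM => //.
  exact: (measurableT_comp mf (measurable_shift e x)).
move=> z _; rewrite /= lee_fin normrM [leRHS]normrM normr_id ler_wpM2r//.
exact: le_trans (fM _) (ler_norm _).
Qed.

Lemma sconv_C1 e f : rtest f -> C1 (sconv e f) /\
  forall i, rpartial i (sconv e f) = sconv e (rpartial i f).
Proof.
move=> tf.
have [M M0 fM] := rtest_bounded tf.
have /choice[D DP] : forall i, exists D : R, 0 <= D /\ forall x, `|rpartial i f x| <= D.
  by move=> i; have [C C0 fC] := rtest_bounded (rtest_rpartial i tf); exists C.
pose k x z := f (x - e *: z) * K z.
have H1 x : (leb n).-integrable setT (EFin \o k x).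
  exact: sconv_integrable (rtest_measurable tf) fM.
have tr z : axial (fun x : 'rV[R]_n => x - e *: z) (fun=> 1) id.
  have := axial_affine 1 (- (e *: z)).
  by under eq_fun do rewrite scale1r.
have kE z : k ^~ z = (f \o (fun x => x - e *: z)) \* cst (K z) by [].
have C1f := rsmooth_C1 tf.1.
have C1K z : C1 (cst (K z) : 'rV[R]_n -> R) := rsmooth_C1 (rsmooth_cst (K z)).
have H2 z : C1 (k ^~ z).
  by rewrite kE; apply: C1M; [exact: (C1_comp (tr z) C1f).1|exact: C1K].
have dk i z x : rpartial i (k ^~ z) x = rpartial i f (x - e *: z) * K z.
  rewrite kE (rpartialM i (C1_comp (tr z) C1f).1 (C1K z)).
  rewrite (C1_comp (tr z) C1f).2 /= (rpartialE _ (cst (K z))) derive_cst.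
  by rewrite mulr0 add0r mul1r.
pose B z := (\sum_i D i) * `|K z|.
have H3 : (leb n).-integrable setT (EFin \o B).
  rewrite /B /comp; under eq_fun do rewrite EFinM.
  by apply: integrableZl => //; exact: integrable_norm intK.
have H4 i x z : `|rpartial i (k ^~ z) x| <= B z.
  rewrite dk normrM ler_wpM2r// (le_trans ((DP i).2 _))//.
  by rewrite (bigD1 i)//= lerDl sumr_ge0// => j _; exact: (DP j).1.
split; first exact: (C1_parametric_integral H1 H2 H3 H4).
move=> i; apply/funext => x; rewrite (rpartial_integral H1 H2 H3 H4 i x).2.
by apply: eq_Rintegral => z _; rewrite dk.
Qed.

Lemma sconv_foldr e f s : rtest f ->
  foldr rpartial (sconv e f) s = sconv e (foldr rpartial f s).
Proof.
move=> tf; elim: s => // i s /= ->.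
exact: (sconv_C1 e (rtest_foldr s tf)).2.
Qed.

Lemma rsmooth_sconv e f : rtest f -> rsmooth (sconv e f).
Proof.
move=> tf; split => s; rewrite sconv_foldr//.
exact: (sconv_C1 e (rtest_foldr s tf)).1.
Qed.

(** If [|x| <= |r| + |z|], then [1 + |x| <= (1 + |r|) (1 + |z|)], and the Lipschitz bound of [f]
    gives [e * |z|]; otherwise both values of [f] vanish, as [e <= 1]. The moment of order [m.+1] of
    [K] pays for the growth in [z]. *)
Lemma sconv_approx f m : rtest f -> (forall z, 0 <= K z) ->
  (leb n).-integrable setT (EFin \o (fun z => (1 + `|z|) ^+ m.+1 * K z)) ->
  exists2 C, 0 <= C & forall e x, 0 < e <= 1 ->
  (1 + `|x|) ^+ m * `|sconv e f x - (\int[leb n]_z K z) * f x| <= C * e.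
Proof.
move=> tf K0 intwK.
have [M M0 fM] := rtest_bounded tf; have [_ [r f0]] := tf.
have [L L0 fL] := rtest_lipschitz tf.
pose A := L * (1 + `|r|) ^+ m.
exists (A * \int[leb n]_z ((1 + `|z|) ^+ m.+1 * K z)).
  rewrite !mulr_ge0 ?exprn_ge0 ?addr_ge0// Rintegral_ge0// => z _.
  by rewrite mulr_ge0 ?exprn_ge0 ?addr_ge0.
move=> e x /andP[e0 e1].
have int1 := sconv_integrable e x (rtest_measurable tf) fM.
rewrite -RintegralZr// -RintegralB//; last first.
  by rewrite /comp; under eq_fun do rewrite EFinM; exact: integrableZr.
have intD : (leb n).-integrable setT (EFin \o (fun z => f (x - e *: z) * K z - K z * f x)).
  rewrite /comp; under eq_fun do rewrite EFinB.
  apply: integrableB => //; under eq_fun do rewrite EFinM.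
  exact: integrableZr.
have wx0 : 0 <= (1 + `|x|) ^+ m by rewrite exprn_ge0// addr_ge0.
apply: le_trans (ler_wpM2l wx0 (le_normr_Rintegral measurableT intD)) _.
rewrite -RintegralZl//; last exact: integrable_norm intD.
rewrite mulrAC -RintegralZl//.
apply: le_Rintegral => //.
- by rewrite /comp; under eq_fun do rewrite EFinM; apply: integrableZl => //; exact: integrable_norm intD.
- by rewrite /comp; under eq_fun do rewrite EFinM; exact: integrableZl.
move=> z _.
rewrite [K z * _]mulrC -mulrBl normrM (ger0_norm (K0 z)) !mulrA ler_wpM2r//.
have ez : `|e *: z| <= e * `|z| by rewrite normrZ gtr0_norm.
have ez1 : `|e *: z| <= `|z| by rewrite (le_trans ez)// ler_piMl.
have A0 : 0 <= A by rewrite mulr_ge0// exprn_ge0// addr_ge0.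
have [xr|xr] := leP `|x| (`|r| + `|z|); last first.
  rewrite (f0 x); last by rewrite (le_lt_trans (ler_norm r))// (le_lt_trans _ xr)// lerDl.
  rewrite f0 ?subrr ?normr0 ?mulr0 ?mulr_ge0 ?exprn_ge0 ?addr_ge0 ?(ltW e0)//.
  have := lerB_normD (x - e *: z) (e *: z); rewrite subrK => h.
  have := ler_norm r; have := ler_normD (x - e *: z) (e *: z); rewrite subrK.
  by move: xr ez1; move: (`|x|) (`|z|) (`|_ - _|) (`|e *: z|) (`|r|) => *; lra.
apply: (@le_trans _ _ ((1 + `|r|) ^+ m * (1 + `|z|) ^+ m * (L * (e * `|z|)))).
  rewrite -exprMn; apply: ler_pM => //.
    rewrite lerXn2r ?nnegrE ?addr_ge0 ?mulr_ge0//.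
    rewrite mulrDl mul1r mulrDr mulr1; have : 0 <= `|r| * `|z| by rewrite mulr_ge0.
    by move: xr; move: (`|r| * `|z|) (`|x|) (`|z|) (`|r|) => *; lra.
  apply: le_trans (fL _ _) _; rewrite ler_wpM2l// addrC addrA addNr add0r normrN//.
rewrite /A exprSr (_ : (1 + `|r|) ^+ m * _ * _ = L * (1 + `|r|) ^+ m * e * ((1 + `|z|) ^+ m * `|z|)); last by ring.
rewrite -!mulrA; do 3 rewrite ler_wpM2l ?exprn_ge0 ?addr_ge0 ?(ltW e0)//.
by rewrite ler_wpM2l ?exprn_ge0 ?addr_ge0// lerDr.
Qed.

End scaled_convolution.

Section complex_test.
Context {R : realType} {n : nat}.
Implicit Types (psi f : 'rV[R]_n -> R[i]) (x xi : 'rV[R]_n).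
Local Notation V := 'rV[R]_n.

Definition ctest psi := rtest (@complex.Re R \o psi) /\ rtest (@complex.Im R \o psi).

Lemma ctestP psi : ctest psi <-> smooth psi /\ exists r : R, forall x, r < `|x| -> psi x = 0.
Proof.
split=> [[[s1 [r1 h1]] [s2 [r2 h2]]]|[/smoothP[s1 s2] [r h]]].
  split; first exact/smoothP.
  exists (Num.max r1 r2) => x; rewrite gt_max => /andP[/h1 x1 /h2 x2].
  exact: eq_complexP.
by split; split => //; exists r => x /h /= ->.
Qed.

Lemma test_function_ctest Omega psi : test_function Omega psi -> ctest psi.
Proof.
move=> [sp [K [cK _ K0]]]; apply/ctestP; split => //.
have [M [_ KM]] := compact_bounded cK.
exists (`|M| + 1) => x xM; apply: K0 => Kx.
have := KM (`|M| + 1); rewrite (le_lt_trans (ler_norm _)) ?ltrDl// => /(_ isT x Kx) /= h.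
by move: xM; rewrite ltNge h.
Qed.

Lemma compact_norm_le (r : R) : compact [set x : V | `|x| <= r].
Proof.
apply: bounded_closed_compact.
  by exists r; split; [exact: num_real|move=> M rM x /= xr; rewrite (le_trans xr)// ltW].
rewrite (_ : [set _ | _] = (@Num.norm _ V) @^-1` [set y | y <= r])//.
by apply: closed_comp => [x _|]; [exact: norm_continuous|exact: closed_le].
Qed.

Lemma ctest_test_function psi : ctest psi -> test_function setT psi.
Proof.
move=> /ctestP[sp [r h]]; split => //.
exists [set x | `|x| <= r]; split => //; first exact: compact_norm_le.
by move=> x /negP; rewrite -ltNge => /h.
Qed.

Lemma ctest_cmeas psi : ctest psi -> cmeas psi.
Proof. by move=> [t1 t2]; split; exact: rtest_measurable. Qed.

Lemma ctest_wt psi : ctest psi -> exists2 C, 0 <= C & forall x, modulus (psi x) <= C * wt x.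
Proof.
move=> [t1 t2]; have [C1 C10 h1] := rtest_wt t1; have [C2 C20 h2] := rtest_wt t2.
exists (C1 + C2); first exact: addr_ge0.
by move=> x; rewrite (le_trans (modulus_le _))// mulrDl lerD//; [exact: h1|exact: h2].
Qed.

Lemma wt_cintegrable f (C : R) : cmeas f -> (forall x, modulus (f x) <= C * wt x) ->
  cintegrable (leb n) setT f.
Proof.
move=> mf fC; apply: (le_cintegrable (g := fun x => C * wt x) mf) => //.
rewrite /comp; under eq_fun do rewrite EFinM.
by apply: integrableZl => //; exact: integrable_wt.
Qed.

Lemma ctest_cintegrable psi : ctest psi -> cintegrable (leb n) setT psi.
Proof.
move=> tp; have [C _ pC] := ctest_wt tp.
exact: wt_cintegrable (ctest_cmeas tp) pC.
Qed.

Definition invfourier f xi : R[i] :=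
  cintegral (leb n) setT (fun x => f x * cexp (2 * pi * dotp x xi)).

Lemma cmeas_cexp_dotp (a : R) xi : cmeas (fun x : V => cexp (a * dotp x xi)).
Proof.
by apply: cmeas_cexp; apply: measurable_funM => //; exact: measurable_dotpl.
Qed.

Lemma invfourierN f xi : invfourier f (- xi) = fourier f xi.
Proof.
apply: eq_cintegral => x; congr (_ * cexp _).
by rewrite dotpC dotpNl mulrN dotpC.
Qed.

Lemma invfourier_bounded f : cintegrable (leb n) setT f -> forall xi,
  modulus (invfourier f xi) <= 2 * \int[leb n]_x modulus (f x).
Proof.
move=> intf xi; apply: le_modulus_cintegral.
- by apply: cmeasM; [exact: cintegrable_cmeas intf|exact: cmeas_cexp_dotp].
- exact: integrable_modulus intf.
- by move=> x; rewrite modulusM modulus_cexp mulr1.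
Qed.

Lemma invfourier_ctrans f : cintegrable (leb n) setT f -> forall xi,
  complex.Re (invfourier f xi) = ctrans (@complex.Re R \o f) 0 xi -
    ctrans (@complex.Im R \o f) (- (pi / 2)) xi /\
  complex.Im (invfourier f xi) = ctrans (@complex.Re R \o f) (- (pi / 2)) xi +
    ctrans (@complex.Im R \o f) 0 xi.
Proof.
move=> [i1 i2] xi; rewrite /invfourier /cintegral/= /ctrans; split.
- rewrite -RintegralB; [|by []|exact: ctrans_integrable..].
  apply: eq_Rintegral => x _; rewrite cReM /= addr0.
  by rewrite -/(_ - _) cosBpihalf.
- rewrite -RintegralD; [|by []|exact: ctrans_integrable..].
  apply: eq_Rintegral => x _; rewrite cImM /= addr0.
  by rewrite -/(_ - _) cosBpihalf.
Qed.

Lemma smooth_invfourier psi : ctest psi -> smooth (invfourier psi).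
Proof.
move=> tp; have intp := ctest_cintegrable tp; have [t1 t2] := tp.
apply/smoothP; split.
- rewrite (_ : _ \o _ = fun xi => ctrans (@complex.Re R \o psi) 0 xi -
    ctrans (@complex.Im R \o psi) (- (pi / 2)) xi).
    by apply: rsmoothB; apply: rsmooth_ctrans; exact: rtest_moments.
  by apply/funext => xi; exact: (invfourier_ctrans intp xi).1.
- rewrite (_ : _ \o _ = (ctrans (@complex.Re R \o psi) (- (pi / 2))) \+
    ctrans (@complex.Im R \o psi) 0).
    by apply: rsmoothD; apply: rsmooth_ctrans; exact: rtest_moments.
  by apply/funext => xi; exact: (invfourier_ctrans intp xi).2.
Qed.

End complex_test.

Section approximate_identity.
Context {R : realType} {n : nat}.
Variable theta : 'rV[R]_n -> R.
Hypotheses (ttheta : rtest theta) (theta_ge0 : forall x, 0 <= theta x).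
Local Notation V := 'rV[R]_n.

(** After [z -> - z] this is the integral of [theta (x + w) * theta w] over [w]: compactly
    supported, with a nonnegative Fourier transform. *)
Definition autocor : V -> R := sconv (fun z => theta (- z)) 1 theta.

(* This is |theta^|^2, the Fourier transform of autocor. *)
Definition kern (z : V) : R := ctrans theta 0 z ^+ 2 + ctrans theta (- (pi / 2)) z ^+ 2.

Lemma rtest_reflect : rtest (fun z => theta (- z)).
Proof.
have [st [r h]] := ttheta; split; last by exists r => x; rewrite -normrN => /h.
have := rsmooth_comp (axial_affine (-1) 0) st.
by congr rsmooth; apply/funext => x /=; rewrite addr0 scaleN1r.
Qed.

Lemma rtest_autocor : rtest autocor.
Proof.
have ir := rtest_integrable rtest_reflect.
split; first exact: rsmooth_sconv.
have [_ [r h]] := ttheta; exists (`|r| + `|r|) => x xr.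
rewrite /autocor /sconv /Rintegral integral0_eq// => z _; congr EFin.
have [zr|zr] := leP `|z| `|r|; last first.
  by rewrite (h (- z)) ?mulr0// normrN (le_lt_trans (ler_norm r)).
rewrite scale1r (h (x - z)) ?mul0r//.
have := ler_normD (x - z) z; rewrite subrK.
by have := ler_norm r; move: xr zr; move: (`|x - z|) (`|x|) (`|z|) (`|r|) => *; lra.
Qed.

Lemma kern_ge0 z : 0 <= kern z.
Proof. by rewrite addr_ge0// sqr_ge0. Qed.

Lemma kern_continuous : continuous kern.
Proof.
have c b : rsmooth (ctrans theta b) := rsmooth_ctrans b (rtest_moments ttheta).
rewrite (_ : kern = (ctrans theta 0 \* ctrans theta 0) \+
  (ctrans theta (- (pi / 2)) \* ctrans theta (- (pi / 2)))).
  by have [+ _] := rsmooth_C1 (rsmoothD (rsmoothM (c 0) (c 0))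
  (rsmoothM (c (- (pi / 2))) (c (- (pi / 2))))).
by apply/funext => z; rewrite /kern !expr2.
Qed.

(** In each square one factor is bounded by a constant and the other supplies [m + 2 * n] powers of
    decay, of which [2 * n] are spent on the weight. *)
Lemma kern_decay m : exists2 C, 0 <= C & forall z, (1 + `|z|) ^+ m * kern z <= C * wt z.
Proof.
have [C0 C00 h0] := ctrans_decay 0 ttheta.
have [C C_ge0 h] := ctrans_decay (m + 2 * n) ttheta.
exists (2 * (C * C0)); first by rewrite !mulr_ge0.
move=> z; apply: (@le_trans _ _ (((1 + `|z|) ^+ (m + 2 * n) * kern z) * wt z)).
  rewrite (_ : _ * wt z = ((1 + `|z|) ^+ m * kern z) * ((1 + `|z|) ^+ (2 * n) * wt z)); last by rewrite exprD; ring.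
  rewrite ler_peMr ?wt_ge//.
  by rewrite mulr_ge0 ?kern_ge0// exprn_ge0// addr_ge0.
rewrite ler_wpM2r ?(ltW (wt_gt0 _))// /kern mulrDr (_ : 2 * (C * C0) = C * C0 + C * C0); last by ring.
have one b : (1 + `|z|) ^+ (m + 2 * n) * ctrans theta b z ^+ 2 <= C * C0.
  rewrite -real_normK ?num_real// expr2 mulrA; apply: ler_pM => //.
  by have := h0 b z; rewrite expr0 mul1r.
exact: lerD.
Qed.

Lemma kern_moment m : (leb n).-integrable setT (EFin \o (fun z => (1 + `|z|) ^+ m * kern z)).
Proof.
have [C _ h] := kern_decay m.
apply: (wt_bounded_integrable (C := C)).
  apply: measurable_funM.
    apply: measurable_funX; apply: measurable_funD => //.
    by apply: continuous_measurable_rV; exact: norm_continuous.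
  by apply: continuous_measurable_rV; exact: kern_continuous.
move=> z; rewrite ger0_norm//.
by rewrite mulr_ge0 ?kern_ge0// exprn_ge0// addr_ge0.
Qed.

Lemma kern_integrable : (leb n).-integrable setT (EFin \o kern).
Proof. by have := kern_moment 0; under eq_fun do rewrite expr0 mul1r. Qed.

(** [kern] is continuous and nonnegative, and at 0 it is at least the square of the integral of
    [theta], which is positive. *)
Lemma kern_mass_gt0 x0 : theta x0 != 0 -> 0 < \int[leb n]_z kern z.
Proof.
move=> t0; apply: (integral_gt0 (x0 := 0)).
- exact: kern_continuous.
- exact: kern_integrable.
- exact: kern_ge0.
rewrite ltr_wpDr ?sqr_ge0// exprn_gt0// /ctrans.
under eq_Rintegral do rewrite dotpC -(scale0r 0) dotpZl mul0r mulr0 addr0 cos0 mulr1.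
apply: (integral_gt0 (x0 := x0)) => //.
- exact: rtest_continuous.
- exact: rtest_integrable.
- by rewrite lt_neqAle eq_sym t0 theta_ge0.
Qed.

End approximate_identity.

Lemma wt_le1 {R : realType} n (x : 'rV[R]_n) : wt x <= 1.
Proof.
rewrite /wt (@le_trans _ _ (\prod_(i < n) 1))//; last by rewrite big1.
apply: ler_prod => i _; rewrite invr_ge0 addr_ge0 ?sqr_ge0//=.
by rewrite invf_le1 ?ltr_pwDl ?sqr_ge0// lerDl sqr_ge0.
Qed.

Section complex_real.
Context {R : realType} d (T : measurableType d) (mu : {measure set T -> \bar R}).

Lemma cintegral_real (h : T -> R) :
  cintegral mu setT (fun x => (h x)%:C%C) = (\int[mu]_x h x)%:C%C.
Proof. by apply: eq_complexP; rewrite /cintegral//= /Rintegral integral0. Qed.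

Lemma cintegrable_real (h : T -> R) : mu.-integrable setT (EFin \o h) ->
  cintegrable mu setT (fun x => (h x)%:C%C).
Proof. by move=> inth; split => //; exact: integrable0. Qed.

End complex_real.

Lemma continuous_rV_seq {R : realType} n (f : 'rV[R]_n -> R) (x z : 'rV[R]_n) (s : R) :
  continuous f -> f (x + (s * k.+1%:R^-1) *: z) @[k --> \oo] --> f x.
Proof.
move=> cf; apply/cvgrPdist_le => e e0.
have [r /= r0 h] := (nbhs_ballP _ _).1 ((cvgrPdist_le (F := nbhs x) _ _).1 (cf x) _ e0).
have : (s * `|z|) * k.+1%:R^-1 @[k --> \oo] --> (s * `|z|) * 0.
  by apply: cvgM; [exact: cvg_cst|exact: cvg_harmonic].
rewrite mulr0 => /cvgrPdist_lt/(_ _ r0); apply: filterS => k.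
rewrite sub0r normrN => kr; apply: h; rewrite mx_norm_ball /ball_/=.
rewrite opprD addNKr normrN normrZ; apply: le_lt_trans kr.
by rewrite !normrM normr_id mulrAC.
Qed.

Lemma cvg_bound0 {R : realType} (u v : nat -> R) : v k @[k --> \oo] --> (0 : R) ->
  (forall k, 0 <= u k <= v k) -> u k @[k --> \oo] --> (0 : R).
Proof.
move=> v0 uv; apply: (@squeeze_cvgr _ _ _ _ (cst 0) v) => //.
- exact: nearW.
- exact: cvg_cst.
Qed.

Section dotp_right.
Context {R : realType} {n : nat}.
Implicit Types x y z : 'rV[R]_n.

Lemma dotpDr x y z : dotp x (y + z) = dotp x y + dotp x z.
Proof. by rewrite dotpC dotpDl !(dotpC _ x). Qed.

Lemma dotpNr x y : dotp x (- y) = - dotp x y.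
Proof. by rewrite dotpC dotpNl dotpC. Qed.

Lemma dotpZr (a : R) x y : dotp x (a *: y) = a * dotp x y.
Proof. by rewrite dotpC dotpZl dotpC. Qed.

Lemma cmeas_cexpN_dotp z : cmeas (fun x : 'rV[R]_n => cexp (- (2 * pi * dotp x z))).
Proof.
apply: cmeas_cexp; apply: measurableT_comp => //.
by apply: measurable_funM => //; exact: measurable_dotpl.
Qed.

Lemma cintegrable_fourier (f : 'rV[R]_n -> R[i]) z : cintegrable (leb n) setT f ->
  cintegrable (leb n) setT (fun x => f x * cexp (- (2 * pi * dotp x z))).
Proof.
move=> intf; apply: (cintegrableMr (M := 1)) => //; first exact: cmeas_cexpN_dotp.
by move=> x; rewrite modulus_cexp.
Qed.

End dotp_right.

(** * Recovering a tempered distribution from its Fourier transform *)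

Section fourier_approximation.
Context {R : realType} {n : nat}.
Variable theta : 'rV[R]_n -> R.
Hypotheses (ttheta : rtest theta) (theta_ge0 : forall x, 0 <= theta x).
Local Notation V := 'rV[R]_n.
Local Notation chi := (autocor theta).
Local Notation K := (kern theta).
Implicit Types (psi f : V -> R[i]) (x xi y z : V) (e : R).

(** Fubini splits the transform of the autocorrelation into the Fourier transform of [theta] times
    its inverse transform; as [theta] is real, the two are conjugate. *)
Lemma fourier_autocor z : fourier (fun xi => (chi xi)%:C%C) z = (K z)%:C%C.
Proof.
have mt := rtest_measurable ttheta; have it := rtest_integrable ttheta.
have [M M0 tM] := rtest_bounded ttheta; have [_ [r0 tr0]] := ttheta.
pose r := `|r0|; have r_ge0 : 0 <= r by exact: normr_ge0.
have tr x : r < `|x| -> theta x = 0 by move=> h; apply: tr0; rewrite (le_lt_trans (ler_norm r0)).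
pose F xi w := (theta (xi - w) * theta (- w))%:C%C * cexp (- (2 * pi * dotp xi z)).
have msub : measurable_fun setT (fun p : V * V => p.1 - p.2).
  apply: measurable_fun_rV => i; under eq_fun do rewrite !mxE.
  apply: measurable_funB.
    exact: (measurableT_comp (measurable_coord i) measurable_fst).
  exact: (measurableT_comp (measurable_coord i) measurable_snd).
have mopp : measurable_fun setT (fun x : V => - x).
  have := measurable_affine (-1) (0 : V); congr measurable_fun.
  by apply/funext => x; rewrite scaleN1r addr0.
have mF : cmeas (fun p => F p.1 p.2).
  apply: cmeasM.
    apply: cmeas_real; apply: measurable_funM; first exact: (measurableT_comp mt msub).
    exact: (measurableT_comp mt (measurableT_comp mopp measurable_snd)).
  apply: cmeas_cexp; apply: measurableT_comp => //.
  apply: measurable_funM => //; exact: (measurableT_comp (measurable_dotpl z) measurable_fst).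
pose A (s : R) := M * (1 + `|s|) ^+ (2 * n).
have A0 s : 0 <= A s by rewrite mulr_ge0// exprn_ge0// addr_ge0.
have iw (c : R) : (leb n).-integrable setT (EFin \o (fun x : V => c * wt x)).
  by rewrite /comp; under eq_fun do rewrite EFinM; apply: integrableZl => //; exact: integrable_wt.
(* For [|w| > r] the factor [theta (- w)] vanishes; otherwise [theta (xi - w)] vanishes once
   [|xi| > r + r]. This gives a product bound. *)
have FB xi w : modulus (F xi w) <= (A (r + r) * wt xi) * (A r * wt w).
  rewrite /F modulusM modulus_cexp mulr1 modulus_real normrM.
  have wt0 (x : V) := ltW (wt_gt0 x).
  have [wr|wr] := leP `|w| r; last first.
    by rewrite (tr (- w)) ?normrN// normr0 mulr0 !mulr_ge0.
  apply: ler_pM => //.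
    apply: (@compact_support_wt _ _ (fun xi => theta (xi - w)) (r + r) M) => [x xr|x]; last exact: tM.
    apply: tr; have := ler_normD (x - w) w; rewrite subrK.
    by move: xr wr; move: (`|x|) (`|w|) (`|x - w|) => *; lra.
  have := @compact_support_wt _ _ (fun w => theta (- w)) r M.
  apply => [x xr|x]; last exact: tM.
  by apply: tr; rewrite normrN.
have intF xi : cintegrable (leb n) setT (fun w => (theta (xi - w) * theta (- w))%:C%C).
  apply: cintegrable_real.
  have := sconv_integrable (rtest_integrable (rtest_reflect ttheta)) 1 xi mt tM.
  by under eq_fun do rewrite scale1r.
transitivity (cintegral (leb n) setT (fun xi => cintegral (leb n) setT (F xi))).
  apply: eq_cintegral => xi; rewrite /F cintegralZr//; congr (_ * _).
  rewrite cintegral_real /autocor /sconv; congr (_%:C)%C.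
  by apply: eq_Rintegral => w _; rewrite scale1r.
rewrite (cFubini mF (iw _) (iw _) FB).
transitivity (cintegral (leb n) setT (fun w => (theta (- w))%:C%C *
    cexp (- (2 * pi * dotp w z)) * fourier (fun x => (theta x)%:C%C) z)).
  apply: eq_cintegral => w.
  have intT := cintegrable_fourier z (cintegrable_real it).
  have intG := cintegrableZ ((theta (- w))%:C%C * cexp (- (2 * pi * dotp w z))) intT.
  rewrite -/(fourier _ _) -cintegralZ// -(cintegral_shift (- w) intG).
  apply: eq_cintegral => x; rewrite /F.
  have -> : cexp (- (2 * pi * dotp x z)) =
     cexp (- (2 * pi * dotp w z)) * cexp (- (2 * pi * dotp (x - w) z)).
    by rewrite -cexpD dotpDl dotpNl; congr cexp; ring.
  by rewrite rmorphM/=; ring.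
have intR := cintegrable_fourier z (cintegrable_real (rtest_integrable (rtest_reflect ttheta))).
rewrite cintegralZr//.
have -> : cintegral (leb n) setT (fun w => (theta (- w))%:C%C * cexp (- (2 * pi * dotp w z))) =
    invfourier (fun x => (theta x)%:C%C) z.
  have intT : cintegrable (leb n) setT (fun x => (theta x)%:C%C * cexp (2 * pi * dotp x z)).
    apply: (cintegrableMr (M := 1)).
    - exact: cmeas_cexp_dotp.
    - by move=> x; rewrite modulus_cexp.
    - exact: cintegrable_real.
  rewrite /invfourier -(cintegral_reflect 0 intT); apply: eq_cintegral => w.
  by rewrite sub0r dotpNl mulrN.
have intC : cintegrable (leb n) setT (fun x => (theta x)%:C%C) by exact: cintegrable_real.
rewrite -invfourierN.
have [re1 im1] := invfourier_ctrans intC z; have [re2 im2] := invfourier_ctrans intC (- z).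
have c0 b w : ctrans (@complex.Im R \o (fun x => (theta x)%:C%C)) b w = 0.
  by rewrite /ctrans; under eq_Rintegral do rewrite /= mul0r; rewrite /Rintegral integral0.
have cN1 : ctrans theta 0 (- z) = ctrans theta 0 z.
  by apply: eq_Rintegral => x _; rewrite dotpC dotpNl mulrN !addr0 cosN dotpC.
have cN2 : ctrans theta (- (pi / 2)) (- z) = - ctrans theta (- (pi / 2)) z.
  rewrite -[RHS]mulN1r /ctrans -RintegralZl//; last exact: ctrans_integrable.
  by apply: eq_Rintegral => x _; rewrite dotpC dotpNl mulrN !cosBpihalf sinN dotpC; ring.
rewrite !c0 -/theta ?subr0 ?addr0 in re1 im1 re2 im2.
apply: eq_complexP; rewrite ?cReM ?cImM.
  by rewrite re1 re2 im1 im2 -[_ \o _]/theta cN1 cN2 /kern /=; ring.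
by rewrite re1 re2 im1 im2 -[_ \o _]/theta cN1 cN2 /=; ring.
Qed.

Lemma kern_bounded : exists2 C, 0 <= C & forall z, K z <= C.
Proof.
have [C C0 h] := kern_decay ttheta 0; exists C => // z.
by have := h z; rewrite expr0 mul1r => /le_trans -> //; rewrite ler_piMr ?wt_le1.
Qed.

(** Cutting the inverse transform off at frequencies of order [1 / e] mollifies [psi] at scale [e]:
    by Fubini the integral over [xi] is the transform of the rescaled [chi], that is a rescaled
    [K]. *)
Lemma fourier_cutoff psi (C : R) e x : cmeas psi ->
  (forall x, modulus (psi x) <= C * wt x) -> 0 < e ->
  fourier (fun xi => (chi (e *: xi))%:C%C * invfourier psi xi) x =
  cintegral (leb n) setT (fun z => psi (x - e *: z) * (K z)%:C%C).
Proof.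
move=> mpsi psiC e0.
have e_neq0 : e != 0 by rewrite gt_eqF.
have intpsi := wt_cintegrable mpsi psiC.
have tchi := rtest_autocor ttheta.
have ichi := rtest_integrable tchi; have mchi := rtest_measurable tchi.
have maff : measurable_fun setT (fun xi : V => e *: xi).
  by have := measurable_affine e (0 : V); under eq_fun do rewrite addr0.
pose G xi y := (chi (e *: xi))%:C%C * (psi y * cexp (2 * pi * dotp xi (y - x))).
have mG : cmeas (fun p => G p.1 p.2).
  apply: cmeasM.
    by apply: cmeas_real; exact: (measurableT_comp mchi (measurableT_comp maff measurable_fst)).
  apply: cmeasM; first exact: cmeas_comp mpsi measurable_snd.
  apply: cmeas_cexp; apply: measurable_funM => //.
  apply: measurable_sum => i; apply: measurable_funM.
    exact: (measurableT_comp (measurable_coord i) measurable_fst).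
  under eq_fun do rewrite !mxE; apply: measurable_funB => //.
  exact: (measurableT_comp (measurable_coord i) measurable_snd).
have ig : (leb n).-integrable setT (EFin \o (fun xi => `|chi (e *: xi)|)).
  have := integrable_affine 0 e_neq0 (integrable_norm ichi).
  by under eq_fun do rewrite addr0.
have ih := integrable_modulus intpsi.
have GB xi y : modulus (G xi y) <= `|chi (e *: xi)| * modulus (psi y).
  by rewrite !modulusM modulus_real modulus_cexp mulr1.
have mexp w : cmeas (fun xi => cexp (2 * pi * dotp xi w)) by exact: cmeas_cexp_dotp.
transitivity (cintegral (leb n) setT (fun xi => cintegral (leb n) setT (G xi))).
  apply: eq_cintegral => xi.
  have i1 : cintegrable (leb n) setT (fun y => psi y * cexp (2 * pi * dotp y xi)).
    by apply: (cintegrableMr (M := 1)) => // y; rewrite modulus_cexp.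
  rewrite /invfourier -mulrA -cintegralZr// -cintegralZ; last first.
    by apply: (cintegrableMr (M := 1)) => //; [exact: cmeas_cst|move=> y; rewrite modulus_cexp].
  apply: eq_cintegral => y; rewrite /G -mulrA -cexpD; congr (_ * (_ * cexp _)).
  by rewrite (dotpC y) dotpDr dotpNr; ring.
rewrite (cFubini mG ig ih GB).
pose H y := psi y * (K (e^-1 *: (x - y)))%:C%C.
have [CK CK0 KC] := kern_bounded.
have mK : measurable_fun setT K by apply: continuous_measurable_rV; exact: kern_continuous.
have intH : cintegrable (leb n) setT H.
  apply: (cintegrableMr (M := CK)) => //.
    apply: cmeas_real; apply: (measurableT_comp mK).
    have := measurable_affine (- e^-1) (e^-1 *: x); congr measurable_fun.
    by apply/funext => y; rewrite scalerBr scaleNr addrC.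
  by move=> y; rewrite modulus_real ger0_norm ?kern_ge0.
transitivity (cintegral (leb n) setT (fun y => ((`|e|^-1 ^+ n)%:C)%C * H y)).
  apply: eq_cintegral => y.
  pose F xi := (chi xi)%:C%C * cexp (- (2 * pi * dotp xi (e^-1 *: (x - y)))).
  have intF : cintegrable (leb n) setT F.
    exact: cintegrable_fourier (cintegrable_real ichi).
  have := cintegral_affine 0 e_neq0 intF.
  rewrite -/(fourier _ _) fourier_autocor => FE.
  rewrite /H mulrCA -FE -cintegralZ; last exact: cintegrable_affine.
  apply: eq_cintegral => xi; rewrite /F /G addr0 mulrCA; congr (_ * (_ * cexp _)).
  by rewrite dotpZl dotpZr !dotpDr !dotpNr; field.
rewrite cintegralZ//.
have eN0 : - e != 0 by rewrite oppr_eq0.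
have := cintegral_affine x eN0 intH; rewrite normrN => <-.
apply: eq_cintegral => z; rewrite /H scaleNr addrC; congr (_ * (K _)%:C)%C.
by rewrite opprB addrCA subrr addr0 scalerA mulVf// scale1r.
Qed.

Lemma foldr_rpartial_lin (a : R) (f g : V -> R) s : rsmooth f -> rsmooth g ->
  foldr rpartial (fun x => g x - a * f x) s =
  (fun x => foldr rpartial g s x - a * foldr rpartial f s x).
Proof.
move=> sf sg; elim: s => // i s /= ->.
have c1 := rsmooth_C1 (rsmooth_foldr s sf); have c2 := rsmooth_C1 (rsmooth_foldr s sg).
have ca : C1 (cst (- a) : V -> R) := rsmooth_C1 (rsmooth_cst (- a)).
rewrite (_ : (fun x => _) = foldr rpartial g s \+ (cst (- a) \* foldr rpartial f s)); last first.
  by apply/funext => x /=; rewrite mulNr.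
rewrite (rpartialD i c2 (C1M ca c1)) (rpartialM i ca c1).
apply/funext => x /=; rewrite (rpartialE _ (cst (- a))) derive_cst mul0r addr0.
by rewrite mulNr.
Qed.

Lemma prod_le_norm (a : 'I_n -> nat) x :
  \prod_(i < n) `|x 0 i| ^+ a i <= (1 + `|x|) ^+ (\sum_i a i).
Proof.
rewrite -prodrXr; apply: ler_prod => i _; rewrite exprn_ge0//=.
rewrite lerXn2r ?nnegrE ?addr_ge0//.
by rewrite (le_trans (rV_coord_le_norm _ _))// lerDr.
Qed.

Lemma ctest_schwartz psi : ctest psi -> schwartz psi.
Proof.
move=> tp; have [sp _] := (ctestP psi).1 tp; split => // a b.
have [t1 t2] := tp.
pose s := seq_of_multi b.
have [M1 M10 h1] := rtest_bounded (rtest_foldr s t1).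
have [M2 M20 h2] := rtest_bounded (rtest_foldr s t2).
have [_ [r1 v1]] := rtest_foldr s t1; have [_ [r2 v2]] := rtest_foldr s t2.
pose r := Num.max r1 r2.
exists ((1 + `|r|) ^+ (\sum_i a i) * (M1 + M2)) => _ [x _ <-].
rewrite /schwartz_weight mpartial_seq foldr_partialE -/s.
have [xr|xr] := leP `|x| r; last first.
  move: xr; rewrite gt_max => /andP[/v1 -> /v2 ->].
  by rewrite modulus0 mulr0 mulr_ge0 ?exprn_ge0 ?addr_ge0.
apply: ler_pM; rewrite ?modulus_ge0 ?prodr_ge0//.
  apply: le_trans (prod_le_norm a x) _; rewrite lerXn2r ?nnegrE ?addr_ge0// lerD2l.
  exact: le_trans xr (ler_norm _).
by apply: le_trans (modulus_le _) _; apply: lerD; [exact: h1|exact: h2].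
Qed.

Lemma autocor_continuous : continuous chi.
Proof. exact: rtest_continuous (rtest_autocor ttheta). Qed.

(** A tempered functional is controlled by finitely many Schwartz seminorms, so the mollification
    has to converge in each of them; derivatives commute with [sconv], which reduces this to
    [sconv_approx]. *)
Lemma cutoff_error_schwartz psi (c := \int[leb n]_z K z)
    (D := fun e x => cintegral (leb n) setT (fun z => psi (x - e *: z) * (K z)%:C%C) -
                     c%:C%C * psi x) : ctest psi ->
  (forall e, 0 < e <= 1 -> schwartz (D e)) /\
  forall a b, exists2 C, 0 <= C & forall e, 0 < e <= 1 -> schwartz_seminorm a b (D e) <= C * e.
Proof.
move=> tp; have [t1 t2] := tp.
have iK := kern_integrable ttheta.
pose S1 e := sconv K e (@complex.Re R \o psi); pose S2 e := sconv K e (@complex.Im R \o psi).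
have DE e : D e = fun x => ((S1 e x - c * complex.Re (psi x)) +i* (S2 e x - c * complex.Im (psi x)))%C.
  apply/funext => x; rewrite /D /S1 /S2 /sconv.
  apply: eq_complexP; rewrite ?cReD ?cImD ?cReN ?cImN ?cReM ?cImM /= ?mul0r ?subr0 ?addr0;
    congr (_ - _); apply: eq_Rintegral => z _; rewrite ?cReM ?cImM /= mulr0.
  - by rewrite subr0.
  - by rewrite add0r.
have weight a b : exists2 C, 0 <= C & forall e, 0 < e <= 1 -> forall x, schwartz_weight a b (D e) x <= C * e.
  pose s := seq_of_multi b; pose m := (\sum_i a i)%N.
  have [C1 C10 h1] := sconv_approx iK (rtest_foldr s t1) (kern_ge0 theta) (kern_moment ttheta m.+1).
  have [C2 C20 h2] := sconv_approx iK (rtest_foldr s t2) (kern_ge0 theta) (kern_moment ttheta m.+1).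
  exists (C1 + C2); first exact: addr_ge0.
  move=> e e01 x; rewrite /schwartz_weight mpartial_seq foldr_partialE -/s DE.
  have E1 : foldr rpartial (fun x => S1 e x - c * complex.Re (psi x)) s =
      fun x => sconv K e (foldr rpartial (@complex.Re R \o psi) s) x -
               c * foldr rpartial (@complex.Re R \o psi) s x.
    by rewrite (foldr_rpartial_lin c s t1.1 (rsmooth_sconv iK e t1)) sconv_foldr.
  have E2 : foldr rpartial (fun x => S2 e x - c * complex.Im (psi x)) s =
      fun x => sconv K e (foldr rpartial (@complex.Im R \o psi) s) x -
               c * foldr rpartial (@complex.Im R \o psi) s x.
    by rewrite (foldr_rpartial_lin c s t2.1 (rsmooth_sconv iK e t2)) sconv_foldr.
  rewrite /= in E1 E2.
  apply: le_trans (ler_wpM2l _ (modulus_le _)) _; first by rewrite prodr_ge0.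
  rewrite /= [X in `|X _|]E1 [X in _ + `|X _|]E2 mulrDr mulrDl; apply: lerD.
  - apply: le_trans _ (h1 e x e01); rewrite ler_wpM2r//; exact: prod_le_norm.
  - apply: le_trans _ (h2 e x e01); rewrite ler_wpM2r//; exact: prod_le_norm.
split=> [e e01|a b].
  split.
    rewrite DE; apply/smoothP; split.
    - exact: (rsmoothB (rsmooth_sconv iK e t1) (rsmoothZ c t1.1)).
    - exact: (rsmoothB (rsmooth_sconv iK e t2) (rsmoothZ c t2.1)).
  move=> a b; have [C C0 h] := weight a b; exists (C * e) => _ [x _ <-].
  exact: h.
have [C C0 h] := weight a b; exists C => // e e01.
apply: ge_sup; first by exists (schwartz_weight a b (D e) 0), 0.
by move=> _ [x _ <-]; exact: h.
Qed.

Lemma cexp_smoothM f g : smooth f -> smooth g -> smooth (fun x => f x * g x).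
Proof.
move=> /smoothP[f1 f2] /smoothP[g1 g2]; apply/smoothP; split.
- rewrite (_ : _ \o _ = fun x => ((@complex.Re R \o f) \* (@complex.Re R \o g)) x -
    ((@complex.Im R \o f) \* (@complex.Im R \o g)) x).
    by apply: rsmoothB; exact: rsmoothM.
  by apply/funext => x /=; rewrite cReM.
- rewrite (_ : _ \o _ = ((@complex.Re R \o f) \* (@complex.Im R \o g)) \+
    ((@complex.Im R \o f) \* (@complex.Re R \o g))).
    by apply: rsmoothD; exact: rsmoothM.
  by apply/funext => x /=; rewrite cImM.
Qed.

Lemma ctest_cutoff psi e : ctest psi -> 0 < e ->
  ctest (fun xi => (chi (e *: xi))%:C%C * invfourier psi xi).
Proof.
move=> tp e0; have [sc [r h]] := rtest_autocor ttheta.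
apply/ctestP; split.
  apply: cexp_smoothM; last exact: smooth_invfourier.
  apply/smoothP; split; last exact: (rsmooth_cst 0).
  have := rsmooth_comp (axial_affine e 0) sc.
  by congr rsmooth; apply/funext => x /=; rewrite addr0.
exists (r / e) => x xr; rewrite h ?mul0r//.
by rewrite normrZ gtr0_norm// mulrC -ltr_pdivrMr.
Qed.

(** Dominated convergence: [chi] is bounded and continuous at 0, and [invfourier psi] is bounded. *)
Lemma cutoff_limit g psi : cintegrable (leb n) setT g -> ctest psi ->
  modulus (cintegral (leb n) setT
     (fun xi => g xi * ((chi (k.+1%:R^-1 *: xi))%:C%C * invfourier psi xi)) -
   (chi 0)%:C%C * cintegral (leb n) setT (fun xi => g xi * invfourier psi xi))
  @[k --> \oo] --> (0 : R).
Proof.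
move=> intg tp; have intp := ctest_cintegrable tp.
have tchi := rtest_autocor ttheta.
have [M M0 cM] := rtest_bounded tchi.
have invB := invfourier_bounded intp.
set B := 2 * _ in invB.
have minv : cmeas (invfourier psi).
  have /smoothP[s1 s2] := smooth_invfourier tp.
  by split; apply: continuous_measurable_rV; [exact: (rsmooth_C1 s1).1|exact: (rsmooth_C1 s2).1].
have mg := cintegrable_cmeas intg.
have intgi : cintegrable (leb n) setT (fun xi => g xi * invfourier psi xi).
  exact: cintegrableMr invB intg.
rewrite -cintegralZ//.
apply: (dominated_cintegral (g := fun xi => M * B * modulus (g xi))).
- move=> k; apply: cmeasM => //; apply: cmeasM => //; apply: cmeas_real.
  apply: (measurableT_comp (rtest_measurable tchi)).
  by have := measurable_affine k.+1%:R^-1 (0 : V); under eq_fun do rewrite addr0.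
- move=> xi.
  have cv : chi (k.+1%:R^-1 *: xi) @[k --> \oo] --> chi 0.
    have := continuous_rV_seq (x := 0) xi 1 autocor_continuous.
    by under eq_fun do rewrite add0r mul1r.
  have E k : modulus (g xi * ((chi (k.+1%:R^-1 *: xi))%:C%C * invfourier psi xi) -
     (chi 0)%:C%C * (g xi * invfourier psi xi)) =
     `|chi (k.+1%:R^-1 *: xi) - chi 0| * modulus (g xi * invfourier psi xi).
    rewrite -modulus_real -modulusM; congr modulus.
    by rewrite rmorphB/=; ring.
  apply: (cvg_bound0 (v := fun k => `|chi (k.+1%:R^-1 *: xi) - chi 0| *
      modulus (g xi * invfourier psi xi))); last first.
    by move=> k; rewrite E lexx -E modulus_ge0.
  rewrite -[X in _ --> X](mul0r (modulus (g xi * invfourier psi xi))).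
  apply: cvgM; last exact: cvg_cst.
  rewrite -[X in _ --> X](@normr0 _ R); apply: cvg_norm.
  by rewrite -(subrr (chi 0)); apply: cvgB; [exact: cv|exact: cvg_cst].
- rewrite /comp; under eq_fun do rewrite EFinM.
  by apply: integrableZl => //; exact: integrable_modulus.
- move=> k xi; rewrite !modulusM modulus_real mulrC ler_wpM2r ?modulus_ge0//.
  by apply: ler_pM; rewrite ?modulus_ge0.
Qed.

(** [represents] speaks of compactly supported functions, and [invfourier psi] need not be one: it
    is cut off by a dilate of [chi]. As the cutoff is removed, the functional converges by
    temperedness and the integral by domination. Fourier inversion would make the two constants
    equal; carrying their quotient as [kap] avoids it. *)
Lemma tempered_repr (u : @functional R n) g psi : tempered u ->
  represents setT (dist_fourier u) g -> cintegrable (leb n) setT g -> ctest psi ->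
  (\int[leb n]_z K z)%:C%C * u psi =
  (chi 0)%:C%C * cintegral (leb n) setT (fun xi => g xi * invfourier psi xi).
Proof.
move=> [ulin [C [m uC]]] [_ grepr] intg tp.
set c := (\int[leb n]_z K z)%:C%C.
have [Dschwartz Dsemi] := cutoff_error_schwartz tp.
pose D e x := cintegral (leb n) setT (fun z => psi (x - e *: z) * (K z)%:C%C) - c * psi x.
have [C' C'0 psiC'] := ctest_wt tp.
pose e (k : nat) : R := k.+1%:R^-1.
have e0 k : 0 < e k by rewrite invr_gt0.
have e01 k : 0 < e k <= 1 by rewrite e0/= invf_le1// ler1n.
pose rho k xi := (chi (e k *: xi))%:C%C * invfourier psi xi.
have uE k : cintegral (leb n) setT (fun xi => g xi * rho k xi) = c * u psi + u (D (e k)).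
  rewrite -(grepr (rho k)); last by apply: ctest_test_function; exact: ctest_cutoff.
  rewrite -ulin; [|exact: ctest_schwartz|exact: Dschwartz].
  congr u; apply/funext => x.
  by rewrite (fourier_cutoff x (ctest_cmeas tp) psiC' (e0 k)) /D addrCA subrr addr0.
have [A AP] : exists A, forall k, modulus (u (D (e k))) <= A * e k.
  have /choice[F FP] : forall ab : {ffun 'I_n -> 'I_m.+1} * {ffun 'I_n -> 'I_m.+1},
      exists C, forall e, 0 < e <= 1 ->
      schwartz_seminorm (fun i => ab.1 i) (fun i => ab.2 i) (D e) <= C * e.
    by move=> [a b]; have [F _ h] := Dsemi (fun i => a i) (fun i => b i); exists F.
  exists (`|C| * \sum_(a : {ffun 'I_n -> 'I_m.+1}) \sum_(b : {ffun 'I_n -> 'I_m.+1}) `|F (a, b)|) => k.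
  apply: le_trans (uC _ (Dschwartz _ (e01 k))) _.
  rewrite -mulrA; apply: (@le_trans _ _ (C * \sum_(a : {ffun 'I_n -> 'I_m.+1})
    \sum_(b : {ffun 'I_n -> 'I_m.+1}) schwartz_seminorm (fun i => a i) (fun i => b i) (D (e k)))) => //.
  have sn0 a b : 0 <= schwartz_seminorm a b (D (e k)).
    have [_ /(_ a b) ub] := Dschwartz _ (e01 k).
    apply: le_trans (ub_le_sup ub (imageT _ 0)).
    by rewrite mulr_ge0 ?modulus_ge0// prodr_ge0// => i _; exact: exprn_ge0.
  apply: le_trans (ler_norm _) _; rewrite normrM ler_wpM2l// ger0_norm; last first.
    by do 2 apply: sumr_ge0 => ? _.
  rewrite mulr_suml; apply: ler_sum => a _; rewrite mulr_suml; apply: ler_sum => b _.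
  apply: le_trans (FP (a, b) _ (e01 k)) _.
  by rewrite ler_wpM2r ?(ltW (e0 k))// ler_norm.
apply/eqP; rewrite -subr_eq0; apply/eqP; apply: modulus_eq0; apply/eqP.
rewrite eq_le modulus_ge0 andbT; set I := _ * cintegral _ _ _.
have lim := cutoff_limit intg tp; rewrite -/I in lim.
have he : A * e k @[k --> \oo] --> (0 : R).
  by rewrite -(mulr0 A); apply: cvgM; [exact: cvg_cst|exact: cvg_harmonic].
have hs : modulus (cintegral (leb n) setT (fun xi => g xi * rho k xi) - I) + A * e k
    @[k --> \oo] --> (0 : R).
  by rewrite -(addr0 0); exact: cvgD.
apply: (ler_cvg_to (cvg_cst _) hs); apply: nearW => k.
rewrite uE; apply: le_trans (lerD (lexx _) (AP k)).
rewrite (_ : c * u psi - I = (c * u psi + u (D (e k)) - I) - u (D (e k))); last by ring.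
by apply: le_trans (modulusD _ _) _; rewrite modulusN.
Qed.

(** If the transform vanished everywhere, every mollification of [phi] would be 0 by
    [fourier_cutoff]; so would its pointwise limit, which is [phi] times the positive mass of the
    kernel. *)
Lemma fourier_neq0 phi (C : R) x0 : theta x0 != 0 -> cmeas phi ->
  (forall x, modulus (phi x) <= C * wt x) ->
  continuous (@complex.Re R \o phi) -> continuous (@complex.Im R \o phi) ->
  phi <> cst 0 -> exists xi, fourier phi xi != 0.
Proof.
move=> tx0 mphi phiC c1 c2 phi0; apply: contrapT => /forallNP h; apply: phi0.
have h0 xi : invfourier phi xi = 0.
  by rewrite -(opprK xi) invfourierN; apply/eqP/negPn/negP/h.
apply/funext => x; have cK := kern_mass_gt0 ttheta theta_ge0 tx0.
have iK := kern_integrable ttheta.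
have mK : measurable_fun setT K by apply: continuous_measurable_rV; exact: kern_continuous.
have C0 : 0 <= C by have := le_trans (modulus_ge0 _) (phiC 0); rewrite pmulr_lge0// wt_gt0.
have lim : modulus (cintegral (leb n) setT (fun z => phi (x - k.+1%:R^-1 *: z) * (K z)%:C%C) -
    cintegral (leb n) setT (fun z => phi x * (K z)%:C%C)) @[k --> \oo] --> (0 : R).
  apply: (dominated_cintegral (g := fun z => C * K z)).
  - move=> k; apply: cmeasM; last exact: cmeas_real.
    apply: (cmeas_comp mphi); have := measurable_affine (- k.+1%:R^-1) x.
    by congr measurable_fun; apply/funext => z; rewrite scaleNr addrC.
  - move=> z.
    have cv (f : V -> R) : continuous f -> f (x - k.+1%:R^-1 *: z) @[k --> \oo] --> f x.
      move=> cf; have := continuous_rV_seq (x := x) z (-1) cf.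
      by under eq_fun do rewrite mulN1r scaleNr.
    have cv0 (f : V -> R) : continuous f -> `|f (x - k.+1%:R^-1 *: z) - f x| @[k --> \oo] --> (0 : R).
      move=> cf; rewrite -[X in _ --> X](@normr0 _ R); apply: cvg_norm.
      by rewrite -(subrr (f x)); apply: cvgB; [exact: cv|exact: cvg_cst].
    apply: (cvg_bound0 (v := fun k => (`|complex.Re (phi (x - k.+1%:R^-1 *: z)) - complex.Re (phi x)| +
      `|complex.Im (phi (x - k.+1%:R^-1 *: z)) - complex.Im (phi x)|) * K z)).
      rewrite -[X in _ --> X](mul0r (K z)); apply: cvgM; last exact: cvg_cst.
      by rewrite -(addr0 0); apply: cvgD; [exact: (cv0 _ c1)|exact: (cv0 _ c2)].
    move=> k; rewrite modulus_ge0 -mulrBl modulusM modulus_real ger0_norm ?kern_ge0//=.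
    rewrite ler_wpM2r ?kern_ge0//.
    by apply: le_trans (modulus_le _) _; rewrite cReD cReN cImD cImN.
  - by rewrite /comp; under eq_fun do rewrite EFinM; exact: integrableZl.
  - move=> k z; rewrite modulusM modulus_real ger0_norm ?kern_ge0// ler_wpM2r ?kern_ge0//.
    by apply: le_trans (phiC _) _; rewrite ler_piMr// wt_le1.
have z0 k : cintegral (leb n) setT (fun z => phi (x - k.+1%:R^-1 *: z) * (K z)%:C%C) = 0.
  rewrite -(fourier_cutoff x mphi phiC); last by rewrite invr_gt0.
  rewrite /fourier (_ : (fun xi => _) = fun=> 0) ?cintegral0//.
  by apply/funext => xi; rewrite h0 mulr0 mul0r.
have : modulus (phi x * (\int[leb n]_z K z)%:C%C) = 0.
  have E : modulus (0 - cintegral (leb n) setT (fun z => phi x * (K z)%:C%C)) @[k --> \oo] --> (0 : R).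
    by move: lim; under eq_fun do rewrite z0.
  have := cvg_unique _ E (cvg_cst _).
  rewrite sub0r modulusN cintegralZ; last exact: cintegrable_real.
  by rewrite cintegral_real => ->.
move/modulus_eq0/eqP; rewrite mulf_eq0 => /orP[/eqP//|/eqP[/eqP]].
by rewrite gt_eqF.
Qed.

End fourier_approximation.

(** * Weak derivatives of ridge functions *)

Section complex_calculus.
Context {R : realType} {n : nat}.
Local Notation V := 'rV[R]_n.
Implicit Types (f g : V -> R[i]).

Definition cC1 f := C1 (@complex.Re R \o f) /\ C1 (@complex.Im R \o f).

Lemma smooth_cC1 f : smooth f -> cC1 f.
Proof. by move=> /smoothP[s1 s2]; split; exact: rsmooth_C1. Qed.

Lemma smooth_partial f i : smooth f -> smooth (partial i f).
Proof.
move=> /smoothP[s1 s2]; have := foldr_partialE f [:: i] => /= ->.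
by apply/smoothP; split; exact: rsmooth_rpartial.
Qed.

Lemma smooth_foldr f s : smooth f -> smooth (foldr partial f s).
Proof.
move=> sf; elim: s => [|i s IHs]; first exact: sf.
exact: (smooth_partial i IHs).
Qed.

Lemma partialE i f : partial i f =
  (fun x => (rpartial i (@complex.Re R \o f) x +i* rpartial i (@complex.Im R \o f) x)%C).
Proof. exact: (foldr_partialE f [:: i]). Qed.

Lemma partialM i f g : cC1 f -> cC1 g ->
  partial i (fun x => f x * g x) = (fun x => partial i f x * g x + f x * partial i g x).
Proof.
move=> [f1 f2] [g1 g2].
have E1 : @complex.Re R \o (fun x => f x * g x) =
  ((@complex.Re R \o f) \* (@complex.Re R \o g)) \+
  ((cst (-1)) \* ((@complex.Im R \o f) \* (@complex.Im R \o g))).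
  by apply/funext => x /=; rewrite cReM mulN1r.
have E2 : @complex.Im R \o (fun x => f x * g x) =
  ((@complex.Re R \o f) \* (@complex.Im R \o g)) \+
  ((@complex.Im R \o f) \* (@complex.Re R \o g)).
  by apply/funext => x /=; rewrite cImM.
have Cc : C1 (cst (-1 : R) : V -> R) := rsmooth_C1 (rsmooth_cst (-1)).
have Dc : rpartial i (cst (-1 : R) : V -> R) = cst 0.
  by apply/funext => x; rewrite rpartialE derive_cst.
have [f1g1 f2g2 f1g2 f2g1] := And4 (C1M f1 g1) (C1M f2 g2) (C1M f1 g2) (C1M f2 g1).
rewrite !partialE E1 E2 (rpartialD _ f1g1 (C1M Cc f2g2)) (rpartialD _ f1g2 f2g1).
rewrite (rpartialM _ Cc f2g2) (rpartialM _ f1 g1) (rpartialM _ f2 g2).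
rewrite (rpartialM _ f1 g2) (rpartialM _ f2 g1) Dc.
apply/funext => x; apply: eq_complexP; rewrite ?(cReD, cImD, cReM, cImM) /=; ring.
Qed.

Lemma ctest_partial f i : ctest f -> ctest (partial i f).
Proof.
move=> [t1 t2]; rewrite partialE.
by split; [rewrite (_ : _ \o _ = rpartial i (@complex.Re R \o f))|
  rewrite (_ : _ \o _ = rpartial i (@complex.Im R \o f))] => //; exact: rtest_rpartial.
Qed.

Lemma ctest_foldr f s : ctest f -> ctest (foldr partial f s).
Proof.
move=> tf; elim: s => [|i s IHs]; first exact: tf.
exact: (ctest_partial i IHs).
Qed.

Lemma ctestM f g : ctest f -> smooth g -> ctest (fun x => f x * g x).
Proof.
move=> /ctestP[sf [r f0]] sg; apply/ctestP; split; first exact: cexp_smoothM.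
by exists r => x xr; rewrite f0 // mul0r.
Qed.

Lemma ctest_smooth f : ctest f -> smooth f.
Proof. by case/ctestP. Qed.

End complex_calculus.

Lemma partial_axial {R : realType} {m d : nat} io a k (f : 'rV[R]_d -> R[i]) j :
  axial io a k -> cC1 f -> cC1 (f \o io) /\
  partial j (f \o io) = (fun x : 'rV[R]_m => (a j)%:C%C * partial (k j) f (io x)).
Proof.
move=> hio [f1 f2].
have [c1 e1] := C1_comp hio f1; have [c2 e2] := C1_comp hio f2.
split; first exact: (conj c1 c2).
rewrite !partialE; apply/funext => x.
rewrite -[_ \o (f \o io)]/((@complex.Re R \o f) \o io) e1.
rewrite -[@complex.Im R \o (f \o io)]/((@complex.Im R \o f) \o io) e2.
by apply: eq_complexP; rewrite ?(cReM, cImM) /=; ring.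
Qed.

Lemma smooth_axial {R : realType} {m d : nat} (io : 'rV[R]_m -> 'rV[R]_d) a k
  (f : 'rV[R]_d -> R[i]) : axial io a k -> smooth f -> smooth (f \o io).
Proof.
move=> hio /smoothP[s1 s2]; apply/smoothP; split.
  exact: (rsmooth_comp hio s1).
exact: (rsmooth_comp hio s2).
Qed.

(** * One variable: the du Bois-Reymond lemma and bounded representatives *)

Section line_integrals.
Context {R : realType}.

Lemma integral_leb1 (f : R -> \bar R) : measurable_fun setT f ->
  (\int[leb 1]_v f (v ord0 ord0) = \int[@lebesgue_measure R]_x f x)%E.
Proof.
move=> mf; rewrite [RHS]integralE [LHS]integralE.
rewrite -[(fun v : 'rV[R]_1 => f (v ord0 ord0))]/(f \o (fun v : 'rV[R]_1 => v ord0 ord0)).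
rewrite funepos_comp funeneg_comp.
have h1 := ge0_integral_leb1 (measurable_funepos mf) (fun x => funepos_ge0 f x).
have h2 := ge0_integral_leb1 (measurable_funeneg mf) (fun x => funeneg_ge0 f x).
congr (_ - _)%E.
  exact: h1.
exact: h2.
Qed.

Lemma measurable_on_line d (T : measurableType d) (w : R -> T) : measurable_fun setT w ->
  measurable_fun setT (fun v : 'rV[R]_1 => w (v 0 0)).
Proof. by move=> mw; apply: measurableT_comp => //; exact: measurable_coord. Qed.

Lemma locally_integrable_test (w : R -> R) (psi : 'rV[R]_1 -> R) :
  locally_integrable setT w -> rtest psi ->
  (leb 1).-integrable setT (EFin \o (fun v : 'rV[R]_1 => w (v 0 0) * psi v)).
Proof.
move=> [mw _ iw] tpsi; have [M M0 pM] := rtest_bounded tpsi.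
have [_ [r pr]] := tpsi.
apply/integrableP; split.
  apply/measurable_EFinP; apply: measurable_funM; last exact: rtest_measurable.
  exact: measurable_on_line.
pose B := `[- r, r]%classic : set R.
pose F (x : R) : \bar R := (M%:E * (`|w x|%:E * (\1_B x)%:E))%E.
have mF : measurable_fun setT F.
  apply: emeasurable_funM => //; apply: emeasurable_funM => //.
    by apply/measurable_EFinP; exact: measurableT_comp.
  by apply/measurable_EFinP; apply: measurable_indic; exact: measurable_itv.
have F0 x : (0 <= F x)%E by rewrite !mule_ge0 // lee_fin // indicE.
apply: (@le_lt_trans _ _ (\int[leb 1]_v F (v ord0 ord0))%E).
  apply: ge0_le_integral => //.
  - apply/measurable_EFinP; apply: measurableT_comp => //; apply: measurable_funM.
      exact: measurable_on_line.
    exact: rtest_measurable.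
  - exact: measurable_on_line.
  - move=> v _; rewrite /F /= lee_fin normrM mulrC indicE.
    have [vB|vB] := boolP (v 0 0 \in B); first by rewrite mulr1 ler_wpM2r.
    rewrite pr ?normr0 ?mul0r ?mulr0 //; apply: (lt_le_trans _ (rV_coord_le_norm v 0)).
    by rewrite ltNge; apply: contra vB; rewrite inE /B /= in_itv /= ler_norml.
rewrite integral_leb1 // ge0_integralZl // ?lee_fin //; last first.
  apply: emeasurable_funM.
    by apply/measurable_EFinP; exact: measurableT_comp.
  by apply/measurable_EFinP; apply: measurable_indic; exact: measurable_itv.
apply: lte_mul_pinfty; rewrite ?lee_fin //.
have -> : (\int[@lebesgue_measure R]_x (`|w x|%:E * (\1_B x)%:E) =
           \int[@lebesgue_measure R]_(x in B) `|w x|%:E)%E.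
  rewrite [RHS]integral_mkcond; apply: eq_integral => x _.
  by rewrite patchE indicE; case: ifPn; rewrite ?mule1 ?mule0.
by apply: iw => //; exact: segment_compact.
Qed.

End line_integrals.

Section du_bois_reymond.
Context {R : realType}.
Local Notation mu := (@lebesgue_measure R).
Variables (rho : 'rV[R]_1 -> R).
Hypotheses (trho : rtest rho) (rho_mass : 0 < \int[leb 1]_v rho v).

(* At a Lebesgue point of w, compare w x with its means against bumps rho
   shrinking to x. *)
Lemma du_bois_reymond (w : R -> R) : locally_integrable setT w ->
  (forall psi, rtest psi -> \int[leb 1]_v (w (v 0 0) * psi v) = 0) ->
  {ae mu, forall x, w x = 0}.
Proof.
move=> lw w0; have [mw _ iw] := lw.
have := lebesgue_differentiation lw.
apply: (@filterS _ _ (ae_filter_ringOfSetsType mu)) => x lx.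
have [M M0 rM] := rtest_bounded trho.
have [srho [r0 rho0]] := trho.
pose r := `|r0| + 1; have r_gt0 : 0 < r by rewrite ltr_wpDl.
have rhor v : r <= `|v| -> rho v = 0.
  by move=> h; apply: rho0; apply: lt_le_trans h; rewrite (le_lt_trans (ler_norm _)) // ltrDl.
pose c := \int[leb 1]_v rho v.
(* Test against [rho ((v - x) / e)], of mass [e * c] and supported in the ball of radius [e * r]. As
   [w] integrates to 0 against it, [w x * e * c] is the integral of [(w x - w v)] against it, at
   most [M * 2 * e * r] times the mean oscillation. *)
have key e : 0 < e -> ((`|w x| * c)%R%:E <= (2 * M * r)%R%:E * davg w x (e * r)%R)%E.
  move=> e0.
  pose io (v : 'rV[R]_1) := e^-1 *: v + const_mx (- x / e).
  have tp : rtest (rho \o io).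
    split; first exact: rsmooth_comp (axial_affine _ _) srho.
    exists (`|x| + e * r) => v vr; apply: rhor.
    apply: contraTT vr; rewrite -!leNgt -ltNge => vr.
    pose y : 'rV[R]_1 := const_mx x.
    have -> : v = e *: (io v + e^-1 *: y).
      by rewrite /io /y; apply/rowP => i; rewrite !mxE; field; rewrite gt_eqF.
    rewrite scalerDr scalerA mulfV ?gt_eqF // scale1r (le_trans (ler_normD _ _)) // addrC.
    rewrite normrZ gtr0_norm // lerD // ?ler_pM2l // ?(ltW vr) //.
    by apply: rV_norm_le => // i; rewrite mxE.
  have i1 := locally_integrable_test lw tp.
  have ir := rtest_integrable tp.
  have i2 : (leb 1).-integrable setT (EFin \o (fun v => w x * (rho \o io) v)).
    by have := integrableZl measurableT (w x) ir.
  have E : w x * (e * c) = \int[leb 1]_v ((w x - w (v 0 0)) * rho (io v)).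
    under eq_Rintegral do rewrite mulrBl.
    rewrite RintegralB // (w0 _ tp) subr0 RintegralZl //; congr (_ * _).
    rewrite /Rintegral (integral_affine _ _ (rtest_integrable trho)) ?invr_eq0 ?gt_eqF //.
    rewrite expr1 fineM ?integrable_fin_num //; last exact: rtest_integrable.
    by rewrite /= normfV invrK gtr0_norm.
  have mi : measurable_fun setT (fun v : 'rV[R]_1 => (w x - w (v 0 0)) * rho (io v)).
    apply: measurable_funM; last exact: (rtest_measurable tp).
    by apply: measurable_funB => //; exact: measurable_on_line.
  pose B : set R := ball x (e * r).
  pose F (y : R) : \bar R := (M%:E * (`|w y - w x|%:E * (\1_B y)%:E))%E.
  have mG : measurable_fun setT (fun y => (`|w y - w x|%:E * (\1_B y)%:E)%E).
    apply: emeasurable_funM.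
      by apply/measurable_EFinP; apply: measurableT_comp => //; exact: measurable_funB.
    by apply/measurable_EFinP; apply: measurable_indic; exact: measurable_ball.
  have mF : measurable_fun setT F by apply: emeasurable_funM.
  have h1 : ((`|w x| * (e * c))%R%:E <= \int[leb 1]_v F (v ord0 ord0))%E.
    rewrite -[X in _ * X]gtr0_norm ?mulr_gt0 // -normrM E.
    have iG : (leb 1).-integrable setT
        (EFin \o (fun v : 'rV[R]_1 => (w x - w (v 0 0)) * rho (io v))).
      have := integrableB measurableT i2 i1; congr (_.-integrable setT).
      by apply/funext => v /=; rewrite mulrBl.
    apply: (@le_trans _ _ (\int[leb 1]_v `|(w x - w (v 0 0)) * rho (io v)|)%:E).
      by rewrite lee_fin; exact: le_normr_Rintegral.
    have iN := integrable_norm iG.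
    rewrite /Rintegral fineK; last exact: (integrable_fin_num measurableT iN).
    apply: ge0_le_integral => //.
    - by apply/measurable_EFinP; exact: measurableT_comp mi.
    - exact: measurable_on_line.
    move=> v _; rewrite /F lee_fin normrM indicE mulrC distrC.
    have [vB|vB] := boolP (v 0 0 \in B); first by rewrite mulr1 ler_wpM2r.
    rewrite rhor ?normr0 ?mul0r ?mulr0 //.
    apply: le_trans (rV_coord_le_norm _ 0); rewrite !mxE.
    move: vB; rewrite notin_setE /B /ball /= => /negP; rewrite -leNgt => h.
    rewrite (_ : _ + _ = e^-1 * (v 0 0 - x)); last by field; rewrite gt_eqF.
    by rewrite normrM gtr0_norm ?invr_gt0 // ler_pdivlMl // distrC.
  have h2 : (\int[leb 1]_v F (v ord0 ord0) = (M * (2 * e * r))%R%:E * davg w x (e * r)%R)%E.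
    rewrite integral_leb1 // ge0_integralZl // ?lee_fin //.
    rewrite /davg /iavg lebesgue_measure_ball; last by rewrite ltW // mulr_gt0.
    have -> : (\int[mu]_y (`|w y - w x|%:E * (\1_B y)%:E) =
               \int[mu]_(y in B) `|(((center (w x)) \o w) y)%:E|)%E.
      rewrite [RHS]integral_mkcond; apply: eq_integral => y _.
      by rewrite patchE indicE; case: ifPn; rewrite ?mule1 ?mule0.
    have er0 : e * r *+ 2 != 0 by rewrite mulrn_eq0 /= mulf_neq0 ?gt_eqF.
    rewrite inver (negbTE er0) muleA -!EFinM; congr (_%:E * _)%E.
    have -> : e * r *+ 2 = 2 * (e * r) by rewrite mulr_natl.
    by field; rewrite !gt_eqF.
  have e'0 : (0%:E <= (e^-1)%:E :> \bar R)%E by rewrite lee_fin invr_ge0 ltW.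
  have := lee_wpmul2l e'0 h1; rewrite h2 muleA -!EFinM => h3.
  rewrite (_ : `|w x| * c = e^-1 * (`|w x| * (e * c))); last by field; rewrite gt_eqF.
  by rewrite (_ : 2 * M * r = e^-1 * (M * (2 * e * r))) //; field; rewrite gt_eqF.
have [->//|wx] := eqVneq (w x) 0.
(* A threshold below which the mean oscillation contradicts [key]; the added 1 keeps the denominator
   positive when [M = 0]. *)
pose del := `|w x| * c / (2 * M * r + 1) / 2.
have K0 : 0 < 2 * M * r + 1 by rewrite ltr_wpDl // !mulr_ge0 // ltW.
have del0 : 0 < del by rewrite !divr_gt0 // mulr_gt0 // normr_gt0.
have /lx : nbhs (0 : \bar R)%E [set y : \bar R | y < del%:E]%E.
  by apply: open_nbhs_nbhs; split; [exact: open_ereal_lt_ereal|rewrite /= lte_fin].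
move=> [s /= s0 hs].
have : (davg w x (s / 2 / r * r) < del%:E)%E.
  rewrite divfK ?gt_eqF //; apply: hs; last by rewrite divr_gt0.
  by rewrite /= sub0r normrN gtr0_norm ?divr_gt0 // gtr_pMr // invf_lt1 // ltr1n.
have se : 0 < s / 2 / r by rewrite !divr_gt0.
have := key _ se; move: (davg w x (s / 2 / r * r)) (davg_ge0 w x (s / 2 / r * r)) => [y| |] //=.
rewrite lee_fin lte_fin => y0 h1 h2; exfalso.
rewrite -EFinM lee_fin in h1.
have h3 : 2 * M * r * y <= 2 * M * r * del.
  by rewrite ler_wpM2l ?(ltW h2) // !mulr_ge0 // ltW.
have : `|w x| * c = del * 2 * (2 * M * r + 1).
  by rewrite /del; field; rewrite gt_eqF.
move: h1 h3; have : 0 <= M * r * del by exact: (mulr_ge0 (mulr_ge0 M0 (ltW r_gt0)) (ltW del0)).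
by move: del0; rewrite -/c; lra.
Qed.

End du_bois_reymond.

Section weak_derivatives_line.
Context {R : realType}.
Local Notation mu := (@lebesgue_measure R).

Lemma loc_integrable_cmeas n (h : 'rV[R]_n -> R[i]) : loc_integrable setT h -> cmeas h.
Proof.
move=> lh.
pose K (m : nat) := [set x : 'rV[R]_n | `|x| <= m%:R].
have UK : \bigcup_m K m = setT.
  apply/seteqP; split => // x _; exists (Num.truncn `|x|).+1 => //=.
  by rewrite /K /= ltW // truncnS_gt.
have mK m : measurable (K m).
  by apply: closed_measurable_rV; apply: compact_closed; [exact: norm_hausdorff|exact: compact_norm_le].
by split; rewrite -UK; apply/(measurable_fun_bigcup _ mK) => m;
  have [/integrableP[/measurable_EFinP h1 _] /integrableP[/measurable_EFinP h2 _]] :=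
    lh _ (@compact_norm_le R n m%:R) (@subsetT _ _).
Qed.

Lemma seq_of_multi1 (j : nat) : seq_of_multi (fun _ : 'I_1 => j) = nseq j ord0.
Proof. by rewrite /seq_of_multi enum_ordSl enum_ord0 /= cats0. Qed.

(** Replacing [h] by 0 where it exceeds an essential bound yields a bound at every point, so that
    later dominations need no almost-everywhere clause; the result is also moved from ['rV_1] to the
    line. *)
Lemma essentially_bounded_truncation (h : 'rV[R]_1 -> R[i]) :
  cmeas h -> (Lp_norm setT +oo%E h < +oo)%E ->
  exists h' : R -> R[i], exists M : R, [/\ 0 <= M, cmeas h',
    forall x, modulus (h' x) <= M & {ae leb 1, forall v, h v = h' (v 0 0)}].
Proof.
move=> mh; rewrite /Lp_norm unlock.
have -> : (leb 1 [set: 'rV[R]_1] > 0)%E by apply: leb_open_gt0; [exact: openT|exists 0].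
set f := _ \o _ => fy.
have [M [M0 fM]] : exists M : R, 0 <= M /\ \forall v \ae leb 1, (f v <= M%:E)%E.
  have := ess_sup_inf.ess_sup_ge (leb 1) f; move: fy.
  case: (ess_sup_inf.ess_sup (leb 1) f) => [y _|//|_] fle.
    exists (Num.max y 0); split; first by rewrite le_max lexx orbT.
    by apply: filterS fle => v hv; apply: (le_trans hv); rewrite lee_fin le_max lexx.
  exists 0; split => //.
  by apply: filterS fle => v; rewrite leeNy_eq => /eqP ->; rewrite leNye.
pose tr (x : R) := h (const_mx x).
have mc : measurable_fun setT (fun x : R => const_mx x : 'rV[R]_1).
  by apply: measurable_fun_rV => i; under eq_fun do rewrite mxE; exact: measurable_id.
have mtr : cmeas tr := cmeas_comp mh mc.
pose A := [set x : R | modulus (tr x) <= M].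
have mA : measurable A.
  have := measurable_modulus mtr measurableT (measurable_itv `]-oo, M]).
  by rewrite setTI; congr measurable; apply/seteqP; split => x /=; rewrite in_itv.
exists (fun x => (\1_A x)%:C%C * tr x), M; split => //.
- by apply: cmeasM => //; apply: cmeas_real; exact: measurable_indic.
- move=> x; rewrite modulusM modulus_real indicE.
  have [|_] := boolP (x \in A); last by rewrite normr0 mul0r.
  by rewrite inE /A /= normr1 mul1r.
apply: filterS fM => v; rewrite /f /= indicT mulr1 lee_fin ger0_norm ?modulus_ge0 // => hv.
have vE : const_mx (v 0 0) = v.
  by apply/rowP => i; rewrite mxE (ord1 i).
rewrite /tr vE indicE (_ : _ \in A) ?mul1r //.
by rewrite inE /A /= /tr vE.
Unshelve. all: by end_near.
Qed.

(** [H j] stands for the weak derivative of [sigma] of order [j]; the sign is that of [j]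
    integrations by parts. *)
Lemma weak_derivative_chain (k : nat) (sigma : R -> R[i]) :
  sobolev k +oo%E setT (on_line sigma) ->
  exists H : nat -> R -> R[i], exists M : nat -> R, [/\ forall j, 0 <= M j,
    forall j, cmeas (H j), forall j x, modulus (H j x) <= M j &
    forall j psi, (j <= k)%N -> ctest psi ->
      (-1) ^+ j * cintegral (leb 1) setT (fun v => sigma (v 0 0) * foldr partial psi (nseq j 0) v) =
      cintegral (leb 1) setT (fun v => H j (v 0 0) * psi v)].
Proof.
move=> [ls sS].
have ms : cmeas (on_line sigma) := loc_integrable_cmeas ls.
have /choice[H HP] : forall j, exists p : (R -> R[i]) * R, [/\ 0 <= p.2, cmeas p.1,
    forall x, modulus (p.1 x) <= p.2 & forall psi, (j <= k)%N -> ctest psi ->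
      (-1) ^+ j * cintegral (leb 1) setT (fun v => sigma (v 0 0) * foldr partial psi (nseq j 0) v) =
      cintegral (leb 1) setT (fun v => p.1 (v 0 0) * psi v)].
  move=> j; have [jk|kj] := leqP j k; last first.
    (* Beyond order [k] the equation is vacuous; the zero function makes [H] total. *)
    exists (fun=> 0, 0); split => [|||psi]; [exact: lexx|exact: cmeas_cst|by move=> x; rewrite modulus0|by []].
  have [|h [lh hrep] hy] := sS (fun=> j); first by rewrite big_ord1.
  have mh := loc_integrable_cmeas lh.
  have [h' [M [M0 mh' hM hh']]] := essentially_bounded_truncation mh hy.
  exists (h', M); split => // psi _ tpsi /=.
  have := hrep psi (ctest_test_function tpsi).
  rewrite /dist_mpartial big_ord1 mpartial_seq seq_of_multi1 /functional_of /on_line => ->.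
  apply: ae_eq_cintegral.
  - by apply: cmeasM => //; exact: ctest_cmeas.
  - by apply: cmeasM; [exact: cmeas_comp mh' (measurable_coord 0)|exact: ctest_cmeas].
  - by apply: filterS hh' => v ->.
exists (fun j => (H j).1), (fun j => (H j).2); split => [j|j|j x|j psi jk tpsi];
  have [h1 h2 h3 h4] := HP j => //.
exact: h4.
Qed.

Lemma locally_integrable_of_line (f : R -> R) : measurable_fun setT f ->
  (forall r, (leb 1).-integrable [set v | `|v| <= r] (EFin \o (fun v : 'rV[R]_1 => f (v 0 0)))) ->
  locally_integrable setT f.
Proof.
move=> mf hf; split => //; first exact: openT.
move=> K _ cK; have [r [_ /(_ (r + 1)) Kr]] := compact_bounded cK.
have mK : measurable K := compact_measurable cK.
have {}Kr x : K x -> `|x| <= r + 1 by apply: Kr; rewrite ltrDl.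
pose F (x : R) : \bar R := (`|f x|%:E * (\1_K x)%:E)%E.
have mF : measurable_fun setT F.
  apply: emeasurable_funM; first by apply/measurable_EFinP; exact: measurableT_comp.
  by apply/measurable_EFinP; exact: measurable_indic.
have -> : (\int[mu]_(x in K) `|f x|%:E = \int[mu]_x F x)%E.
  rewrite [LHS]integral_mkcond; apply: eq_integral => x _.
  by rewrite patchE /F indicE; case: ifPn; rewrite ?mule1 ?mule0.
rewrite -integral_leb1 //.
have /integrableP[mfr] := hf (r + 1); apply: le_lt_trans.
rewrite [leRHS]integral_mkcond; apply: ge0_le_integral => //.
- by move=> v _; rewrite mule_ge0 // lee_fin indicE.
- exact: measurable_on_line.
- apply/(measurable_restrictT _ _).1; last exact: measurableT_comp.
  by apply: closed_measurable_rV; apply: compact_closed; [exact: norm_hausdorff|exact: compact_norm_le].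
move=> v _; rewrite /F patchE indicE.
have [vK|vK] := boolP (_ \in K); last by rewrite mule0; case: ifP.
rewrite mule1 mem_set //=; apply: rV_norm_le => [|i]; last by rewrite (ord1 i); apply: Kr; rewrite inE in vK.
by rewrite inE in vK; exact: le_trans (Kr _ vK).
Qed.

(** The du Bois-Reymond lemma for the real and imaginary parts of [sigma - h]. It ties the
    dictionary, built on [sigma] itself, to the bounded version that the estimates use. *)
Lemma ae_bounded_representative (rho : 'rV[R]_1 -> R) (sigma h : R -> R[i]) :
  rtest rho -> 0 < \int[leb 1]_v rho v ->
  loc_integrable setT (on_line sigma) -> cmeas h -> (exists M, forall x, modulus (h x) <= M) ->
  (forall psi, ctest psi -> cintegral (leb 1) setT (fun v => sigma (v 0 0) * psi v) =
      cintegral (leb 1) setT (fun v => h (v 0 0) * psi v)) ->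
  {ae mu, forall x, sigma x = h x}.
Proof.
move=> trho rho0 ls mh [M hM] shE.
have mol : cmeas (on_line sigma) := loc_integrable_cmeas ls.
have mc : measurable_fun setT (fun x : R => const_mx x : 'rV[R]_1).
  by apply: measurable_fun_rV => i; under eq_fun do rewrite mxE; exact: measurable_id.
have ms : cmeas sigma.
  by have := cmeas_comp mol mc; congr cmeas; apply/funext => x; rewrite /on_line mxE.
have lb (f : R -> R) : measurable_fun setT f -> (forall x, `|f x| <= M) -> locally_integrable setT f.
  move=> mf fM; split => //; first exact: openT.
  move=> K _ cK; apply: (@le_lt_trans _ _ (\int[mu]_(x in K) M%:E)%E).
    have mK : measurable K := compact_measurable cK.
    apply: ge0_le_integral => //.
    - by apply/measurable_EFinP; apply: measurableT_comp => //; exact: measurable_funS mf.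
    - by move=> x _; rewrite lee_fin.
  rewrite integral_cst ?lte_mul_pinfty ?lee_fin //; first exact: le_trans (fM 0).
  - exact: compact_finite_measure.
  - exact: compact_measurable.
have ls1 := fun r => ls _ (@compact_norm_le R 1 r) (@subsetT _ _).
have l1 := locally_integrable_of_line ms.1 (fun r => (ls1 r).1).
have l2 := locally_integrable_of_line ms.2 (fun r => (ls1 r).2).
have k1 := lb _ mh.1 (fun x => le_trans (modulus_Re _) (hM x)).
have k2 := lb _ mh.2 (fun x => le_trans (modulus_Im _) (hM x)).
have E psi : rtest psi ->
    \int[leb 1]_v (complex.Re (sigma (v 0 0)) * psi v) = \int[leb 1]_v (complex.Re (h (v 0 0)) * psi v) /\
    \int[leb 1]_v (complex.Im (sigma (v 0 0)) * psi v) = \int[leb 1]_v (complex.Im (h (v 0 0)) * psi v).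
  move=> tpsi.
  have cpsi : ctest (fun v => (psi v)%:C%C).
    split => //=; rewrite (_ : _ \o _ = cst 0) //; split; first exact: rsmooth_cst.
    by exists 0.
  have e z (a : R) : complex.Re (z * a%:C%C) = complex.Re z * a /\ complex.Im (z * a%:C%C) = complex.Im z * a.
    by rewrite cReM cImM /= !mulr0 subr0 add0r.
  have I (s : R -> R[i]) : cintegral (leb 1) setT (fun v => s (v 0 0) * (psi v)%:C%C) =
      ((\int[leb 1]_v (complex.Re (s (v 0 0)) * psi v)) +i*
       (\int[leb 1]_v (complex.Im (s (v 0 0)) * psi v)))%C.
    by congr (_ +i* _)%C; apply: eq_Rintegral => v _; rewrite ?(e _ _).1 ?(e _ _).2.
  by have := shE _ cpsi; rewrite !I => -[].
have D (f g : R -> R) : locally_integrable setT f -> locally_integrable setT g ->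
    (forall psi, rtest psi -> \int[leb 1]_v (f (v 0 0) * psi v) = \int[leb 1]_v (g (v 0 0) * psi v)) ->
    {ae mu, forall x, f x = g x}.
  move=> lf lg fg.
  have := du_bois_reymond trho rho0 (locally_integrableB lf lg).
  move=> H; apply: (@filterS _ _ (ae_filter_ringOfSetsType mu) _ _ _ (H _)) => [x /eqP|psi tpsi].
    by rewrite /= subr_eq0 => /eqP.
  under eq_Rintegral do rewrite mulrBl.
  by rewrite RintegralB // ?fg ?subrr //; exact: locally_integrable_test.
have a1 := D _ _ l1 k1 (fun psi tp => (E psi tp).1).
have a2 := D _ _ l2 k2 (fun psi tp => (E psi tp).2).
by apply: (@filterS2 _ _ (ae_filter_ringOfSetsType mu) _ _ _ _ a1 a2) => x; exact: eq_complexP.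
Qed.

End weak_derivatives_line.

Section ridge_weak_derivative.
Context {R : realType} {n : nat}.
Local Notation V := 'rV[R]_n.

Lemma axial_line m (x : 'rV[R]_m) i :
  axial (fun v : 'rV[R]_1 => x + v 0 0 *: delta_mx 0 i) (fun=> 1) (fun=> i).
Proof.
split; last first.
  by move=> j v k; rewrite (ord1 j) -addrA -scalerDl !mxE /= !mulr1.
move=> v; apply: (cvgrPdist_le (F := nbhs v) _ _).2 => e e0.
apply/nbhs_ballP; exists e => // w; rewrite mx_norm_ball /ball_ /= => vw.
rewrite opprD addrACA subrr add0r -scalerBl; apply: le_trans _ (ltW vw).
apply: rV_norm_le => // j; rewrite !mxE normrM.
have -> : v 0 0 - w 0 0 = (v - w) 0 0 by rewrite !mxE.
apply: le_trans (rV_coord_le_norm _ 0); rewrite ler_piMr //.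
by case: (_ && _); rewrite /= ?normr1 ?normr0.
Qed.

Lemma ctest_affine m (a : R) (w : 'rV[R]_m) (psi : 'rV[R]_m -> R[i]) : a != 0 -> ctest psi ->
  ctest (fun x => psi (a *: x + w)).
Proof.
move=> a0 /ctestP[spsi [r psi0]]; apply/ctestP; split.
  exact: (smooth_axial (axial_affine a w) spsi).
exists ((`|r| + `|w|) / `|a|) => x xr; apply: psi0.
move: xr; rewrite ltr_pdivrMr ?normr_gt0 // mulrC -normrZ => h.
have : `|a *: x| <= `|a *: x + w| + `|w|.
  by rewrite -{1}(addrK w (a *: x)) (le_trans (ler_normB _ _)).
have := ler_norm r; lra.
Qed.

Lemma cintegral_partial m (psi : 'rV[R]_m -> R[i]) i : ctest psi ->
  cintegral (leb m) setT (partial i psi) = 0.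
Proof.
move=> [[s1 [r1 h1]] [s2 [r2 h2]]]; rewrite partialE; apply: eq_complexP => /=.
  by apply: (integral_rpartial (rsmooth_C1 s1) (rsmooth_C1 (rsmooth_rpartial i s1)).1 h1).
by apply: (integral_rpartial (rsmooth_C1 s2) (rsmooth_C1 (rsmooth_rpartial i s2)).1 h2).
Qed.

(** An affine substitution reduces to [a = 1], [c = 0], the derivative of the substituted test
    function producing a factor [a^-1]. For [a = 0] the left side is a constant times the integral
    of a derivative, hence 0. *)
Lemma line_weak_derivative (h h' : R -> R[i]) (M : R) :
  cmeas h -> cmeas h' -> (forall x, modulus (h x) <= M) -> (forall x, modulus (h' x) <= M) ->
  (forall psi, ctest psi -> cintegral (leb 1) setT (fun v => h (v 0 0) * partial 0 psi v) =
     - cintegral (leb 1) setT (fun v => h' (v 0 0) * psi v)) ->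
  forall (a c : R) psi, ctest psi ->
  cintegral (leb 1) setT (fun v => h (a * v 0 0 + c) * partial 0 psi v) =
  - (a%:C%C * cintegral (leb 1) setT (fun v => h' (a * v 0 0 + c) * psi v)).
Proof.
move=> mh mh' hM hM' hh' a c psi tpsi.
have ib (f : R -> R[i]) (g : 'rV[R]_1 -> R[i]) : cmeas f -> (forall x, modulus (f x) <= M) -> ctest g ->
    cintegrable (leb 1) setT (fun v => f (v 0 0) * g v).
  move=> mf fM tg; apply: (cintegrableMl (M := M)) => //; last exact: ctest_cintegrable.
  exact: cmeas_comp mf (measurable_coord 0).
have [->|a0] := eqVneq a 0.
  rewrite mul0r oppr0; under eq_cintegral do rewrite mul0r add0r.
  by rewrite cintegralZ ?cintegral_partial ?mulr0 //; apply/ctest_cintegrable/ctest_partial.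
pose io (v : 'rV[R]_1) := a^-1 *: v + const_mx (- c / a).
have hio := axial_affine a^-1 (const_mx (- c / a) : 'rV[R]_1).
have tio g : ctest g -> ctest (g \o io) by exact: ctest_affine (invr_neq0 a0).
have [_ dq] := partial_axial 0 hio (smooth_cC1 (ctest_smooth tpsi)).
have subst (f : R -> R[i]) (g : 'rV[R]_1 -> R[i]) : cmeas f -> (forall x, modulus (f x) <= M) -> ctest g ->
   cintegral (leb 1) setT (fun v => f (a * v 0 0 + c) * g v) =
   (`|a|^-1)%:C%C * cintegral (leb 1) setT (fun v => f (v 0 0) * g (io v)).
  move=> mf fM tg.
  rewrite -[`|a|^-1 in RHS]expr1 -(cintegral_affine (const_mx c) a0 (ib _ _ mf fM (tio _ tg))).
  apply: eq_cintegral => v; rewrite !mxE; congr (_ * g _).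
  by rewrite /io; apply/rowP => i; rewrite !mxE; field.
rewrite (subst _ _ mh hM (ctest_partial _ tpsi)) (subst _ _ mh' hM' tpsi).
have := hh' _ (tio _ tpsi); rewrite dq => E.
have -> : cintegral (leb 1) setT (fun v => h (v 0 0) * partial 0 psi (io v)) =
    a%:C%C * cintegral (leb 1) setT (fun v => h (v 0 0) * ((a^-1)%:C%C * partial 0 psi (io v))).
  rewrite -cintegralZ.
    apply: eq_cintegral => v; rewrite mulrCA; congr (_ * _).
    by rewrite mulrA -rmorphM /= mulfV // mul1r.
  have := cintegrableZ (a^-1)%:C%C (ib _ _ mh hM (tio _ (ctest_partial 0 tpsi))).
  by congr cintegrable; apply/funext => v /=; rewrite mulrCA.
by rewrite E mulrN mulrN mulrCA.
Qed.

(** Translating [x] by [v] in direction [i] moves the ridge argument by [a i * v], so for fixed [v]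
    the integral over [x] is [rho v] times a quantity independent of [v]; Fubini leaves the mass of
    [rho]. *)
Lemma ridge_shift (H : R -> R[i]) (M : R) (rho : 'rV[R]_1 -> R) (psi : V -> R[i]) (a : 'I_n -> R) (b : R) i :
  cmeas H -> (forall x, modulus (H x) <= M) -> rtest rho -> ctest psi ->
  let F (x : V) := cintegral (leb 1) setT (fun v =>
    H (a i * v 0 0 + (\sum_j a j * x 0 j + b)) * (rho v)%:C%C * psi (x + v 0 0 *: delta_mx 0 i)) in
  [/\ forall x : V, cintegrable (leb 1) setT (fun v =>
    H (a i * v 0 0 + (\sum_j a j * x 0 j + b)) * (rho v)%:C%C * psi (x + v 0 0 *: delta_mx 0 i)),
  cintegrable (leb n) setT F &
  cintegral (leb n) setT F =
  (\int[leb 1]_v rho v)%:C%C * cintegral (leb n) setT (fun x => H (\sum_j a j * x 0 j + b) * psi x)].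
Proof.
move=> mH HM trho tpsi F.
have M0 : 0 <= M := le_trans (modulus_ge0 _) (HM 0).
pose G (x : V) (v : 'rV[R]_1) := H (a i * v 0 0 + (\sum_j a j * x 0 j + b)) * (rho v)%:C%C *
  psi (x + v 0 0 *: delta_mx 0 i).
have [_ [r1 rho0]] := trho; have [_ [r2 psi0]] := (ctestP _).1 tpsi.
have [P P0 psiP] := ctest_wt tpsi.
have mrho : measurable_fun setT rho := rtest_measurable trho.
have ml : measurable_fun setT (fun x : V => \sum_j a j * x 0 j + b).
  apply: measurable_funD => //; apply: measurable_sum => j; apply: measurable_funM => //.
  exact: measurable_coord.
have mp : measurable_fun setT (fun p : V * 'rV[R]_1 => p.1 + p.2 0 0 *: delta_mx 0 i).
  apply: measurable_fun_rV => j.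
  rewrite (_ : (fun _ => _) = (fun p : V * 'rV[R]_1 => p.1 0 j + p.2 0 0 * (delta_mx 0 i : V) 0 j)).
    apply: measurable_funD; first exact: (measurableT_comp (measurable_coord j) measurable_fst).
    apply: measurable_funM => //; exact: (measurableT_comp (measurable_coord 0) measurable_snd).
  by apply/funext => p; rewrite !mxE.
have mG : cmeas (fun p => G p.1 p.2).
  apply: cmeasM; last exact: cmeas_comp (ctest_cmeas tpsi) mp.
  apply: cmeasM; last exact: cmeas_comp (cmeas_real mrho) measurable_snd.
  apply: (cmeas_comp mH); apply: measurable_funD; last exact: (measurableT_comp ml measurable_fst).
  apply: measurable_funM => //; exact: (measurableT_comp (measurable_coord 0) measurable_snd).
(* If [|v| <= r1] and the translated [psi] does not vanish, then [|x|] is at most this [r]; hence a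
   product bound. *)
pose r := `|r1| + `|r2|.
pose C := P * (1 + `|r|) ^+ (2 * n).
have bG x v : modulus (G x v) <= C * wt x * (M * `|rho v|).
  rewrite /G !modulusM modulus_real.
  have [vr|/rho0 ->] := leP `|v| r1; last by rewrite !normr0 !mulr0 mul0r.
  rewrite mulrC; apply: ler_pM; rewrite ?mulr_ge0 ?modulus_ge0 ?ler_wpM2r //.
  pose f (y : V) := if `|y| <= r then P else 0.
  have fx y : r < `|y| -> f y = 0 by rewrite /f ltNge => /negbTE ->.
  have fP y : `|f y| <= P by rewrite /f; case: ifP; rewrite ?normr0 // ger0_norm.
  apply: le_trans (compact_support_wt fx fP x); apply: le_trans (ler_norm _).
  rewrite /f; have [xr|xr] := leP `|x| r.
    by apply: (le_trans (psiP _)); rewrite ler_piMr // wt_le1.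
  rewrite psi0 ?modulus0 //.
  have : `|x| <= `|x + v 0 0 *: delta_mx 0 i| + `|v|.
    rewrite -{1}(addrK (v 0 0 *: delta_mx 0 i) x) (le_trans (ler_normB _ _)) // lerD2l.
    apply: rV_norm_le => // j; rewrite !mxE normrM.
    apply: le_trans (rV_coord_le_norm v 0); rewrite ler_piMr //.
    by case: (_ && _); rewrite /= ?normr1 ?normr0.
  have := ler_norm r1; have := ler_norm r2; move: xr vr; rewrite /r; lra.
have iwt : (leb n).-integrable setT (EFin \o (fun x : V => C * wt x)).
  apply: (wt_bounded_integrable (C := `|C|)).
    by apply: measurable_funM => //; exact: measurable_wt.
  by move=> x; rewrite normrM (gtr0_norm (wt_gt0 x)).
have irho : (leb 1).-integrable setT (EFin \o (fun v : 'rV[R]_1 => M * `|rho v|)).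
  exact: (integrableZl measurableT M (integrable_norm (rtest_integrable trho))).
split.
- move=> x; apply: (le_cintegrable (g := fun v => C * wt x * (M * `|rho v|))).
  + exact: cmeas_comp mG (measurable_pair1 x).
  + exact: (integrableZl measurableT (C * wt x) irho).
  + exact: bG.
- exact: (cintegrable_fubini1 mG iwt irho bG).
rewrite [LHS](cFubini mG iwt irho bG) /=.
have iH : cintegrable (leb n) setT (fun x => H (\sum_j a j * x 0 j + b) * psi x).
  by apply: (cintegrableMl (M := M)) => //; [exact: cmeas_comp mH ml|exact: ctest_cintegrable].
rewrite -cintegral_real -cintegralZr; last exact/cintegrable_real/rtest_integrable.
apply: eq_cintegral => v.
rewrite -(cintegral_shift (v 0 0 *: delta_mx 0 i) iH) -cintegralZ; last first.
  have := cintegrable_affine (v 0 0 *: delta_mx 0 i) (oner_neq0 _) iH.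
  by congr cintegrable; apply/funext => x; rewrite scale1r.
apply: eq_cintegral => x; rewrite /G mulrAC mulrC; congr (_ * (H _ * _)).
rewrite addrA; congr (_ + _).
under [in RHS]eq_bigr do rewrite !mxE mulrDr.
rewrite big_split /= addrC; congr (_ + _).
rewrite (bigD1 i) //= !eqxx mulr1 big1 ?addr0 // => j ji.
by rewrite (negbTE ji) !mulr0.
Qed.

(* Averaging translates in direction i against rho reduces the integral over
   the whole space to integrals over lines, where the weak derivative is known. *)
Lemma ridge_weak_derivative (rho : 'rV[R]_1 -> R) (h h' : R -> R[i]) (M : R) :
  rtest rho -> \int[leb 1]_v rho v != 0 ->
  cmeas h -> cmeas h' -> (forall x, modulus (h x) <= M) -> (forall x, modulus (h' x) <= M) ->
  (forall psi, ctest psi -> cintegral (leb 1) setT (fun v => h (v 0 0) * partial 0 psi v) =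
     - cintegral (leb 1) setT (fun v => h' (v 0 0) * psi v)) ->
  forall (a : 'I_n -> R) b i psi, ctest psi ->
  cintegral (leb n) setT (fun x => h (\sum_j a j * x 0 j + b) * partial i psi x) =
  - ((a i)%:C%C * cintegral (leb n) setT (fun x => h' (\sum_j a j * x 0 j + b) * psi x)).
Proof.
move=> trho rho0 mh mh' hM hM' hh' a b i psi tpsi.
pose l (x : V) := \sum_j a j * x 0 j + b.
pose io (x : V) (v : 'rV[R]_1) := x + v 0 0 *: delta_mx 0 i.
have tdrho : rtest (rpartial 0 rho) := rtest_rpartial 0 trho.
(* The derivative of [rho] has mass zero, which removes the term where the product rule
   differentiates [rho]. *)
have drho0 : \int[leb 1]_v rpartial 0 rho v = 0.
  have [s1 [r1 h1]] := trho.
  exact: (integral_rpartial (rsmooth_C1 s1) (rsmooth_C1 (rsmooth_rpartial 0 s1)).1 h1).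
have [I1 J1 E1] := ridge_shift a b i mh hM trho (ctest_partial i tpsi).
have [I2 J2 E2] := ridge_shift a b i mh hM tdrho tpsi.
have [I3 J3 E3] := ridge_shift a b i mh' hM' trho tpsi.
(* The one-variable weak derivative along the line through [x] in direction [i], tested against
   [rho v * psi (io x v)]. *)
have key x : cintegral (leb 1) setT (fun v => h (a i * v 0 0 + l x) * (rho v)%:C%C * partial i psi (io x v)) =
  - ((a i)%:C%C * cintegral (leb 1) setT (fun v => h' (a i * v 0 0 + l x) * (rho v)%:C%C * psi (io x v)))
  - cintegral (leb 1) setT (fun v => h (a i * v 0 0 + l x) * (rpartial 0 rho v)%:C%C * psi (io x v)).
  have hio : axial (io x) (fun=> 1) (fun=> i) := axial_line x i.
  have spsi := ctest_smooth tpsi.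
  have [cp dp] := partial_axial 0 hio (smooth_cC1 spsi).
  have srho : smooth (fun v => (rho v)%:C%C).
    by apply/smoothP; split; [exact: trho.1|exact: rsmooth_cst].
  have tq : ctest (fun v => (rho v)%:C%C * psi (io x v)).
    apply/ctestP; split; first exact: cexp_smoothM srho (smooth_axial hio spsi).
    by have [_ [r h0]] := trho; exists r => v /h0 ->; rewrite mul0r.
  have := line_weak_derivative mh mh' hM hM' hh' (a i) (l x) tq.
  rewrite (partialM 0 (smooth_cC1 srho) cp) dp.
  have -> : partial 0 (fun v => (rho v)%:C%C) = (fun v => (rpartial 0 rho v)%:C%C).
    rewrite partialE; apply/funext => v; congr (_ +i* _)%C.
    by rewrite (_ : _ \o _ = cst 0) // rpartialE derive_cst.
  move=> E.
  have H1 : cintegral (leb 1) setT (fun v => h (a i * v 0 0 + l x) *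
      ((rpartial 0 rho v)%:C%C * psi (io x v) + (rho v)%:C%C * (1%:C%C * partial i psi (io x v)))) =
    cintegral (leb 1) setT (fun v => h (a i * v 0 0 + l x) * (rpartial 0 rho v)%:C%C * psi (io x v)) +
    cintegral (leb 1) setT (fun v => h (a i * v 0 0 + l x) * (rho v)%:C%C * partial i psi (io x v)).
    rewrite -(cintegralD (I2 x) (I1 x)); apply: eq_cintegral => v; rewrite mulrDr mul1r !mulrA; congr (_ + _).
  rewrite H1 in E; apply: (addrI (cintegral (leb 1) setT (fun v => h (a i * v 0 0 + l x) *
     (rpartial 0 rho v)%:C%C * psi (io x v)))).
  rewrite E addrCA subrr addr0; congr (- (_ * _)).
  by apply: eq_cintegral => v; rewrite mulrA.

apply: (mulfI (x := (\int[leb 1]_v rho v)%:C%C)).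
  by rewrite -(rmorph0 (real_complex R)) (inj_eq (@complexI R)).
rewrite -E1 (eq_cintegral _ key) cintegralB ?cintegralN ?cintegralZ //.
  by rewrite E2 drho0 mul0r subr0 E3 mulrN mulrCA.
- exact: cintegrableZ.
- exact/cintegrableN/cintegrableZ.
Qed.

End ridge_weak_derivative.

Lemma sobolev_ridge_chain {R : realType} (rho : 'rV[R]_1 -> R) (k : nat) (sigma : R -> R[i]) :
  rtest rho -> 0 < \int[leb 1]_v rho v -> sobolev k +oo%E setT (on_line sigma) ->
  exists H : nat -> R -> R[i], exists M : nat -> R, [/\ forall j, 0 <= M j,
    forall j, cmeas (H j), forall j x, modulus (H j x) <= M j,
    {ae @lebesgue_measure R, forall x, sigma x = H 0%N x} &
    forall j n (a : 'I_n -> R) b i psi, (j < k)%N -> ctest psi ->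
      cintegral (leb n) setT (fun x => H j (\sum_j a j * x 0 j + b) * partial i psi x) =
    - ((a i)%:C%C * cintegral (leb n) setT (fun x => H j.+1 (\sum_j a j * x 0 j + b) * psi x))].
Proof.
move=> trho rho0 sS; have [ls _] := sS.
have [H [M [M0 mH hM HE]]] := weak_derivative_chain sS.
exists H, M; split => //.
  apply: (ae_bounded_representative trho rho0 ls (mH 0%N)); first by exists (M 0%N).
  by move=> psi tpsi; have := HE 0%N psi (leq0n _) tpsi; rewrite expr0 mul1r.
move=> j n a b i psi jk tpsi.
apply: (ridge_weak_derivative (M := M j + M j.+1) trho _ (mH j) (mH j.+1)) => //.
- by rewrite gt_eqF.
- by move=> x; rewrite (le_trans (hM j x)) // lerDl.
- by move=> x; rewrite (le_trans (hM j.+1 x)) // lerDr.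
move=> q tq; rewrite -(HE _ _ (ltnW jk) (ctest_partial 0 tq)) -(HE _ _ jk tq).
by rewrite exprS mulN1r mulNr opprK -(addn1 j) nseqD foldr_cat.
Qed.

(** * Dictionary atoms and plane wave synthesis *)

Section schwartz_bounds.
Context {R : realType} {n : nat}.
Implicit Types (f : 'rV[R]_n -> R[i]).

(** Expanding the product of the [1 + x_i^2] writes [1 / wt] as a finite sum of monomials, each of
    which is controlled by one Schwartz seminorm. *)
Lemma wtV (x : 'rV[R]_n) : (wt x)^-1 =
  \sum_(J : {set 'I_n}) \prod_(i < n) `|x 0 i| ^+ (if i \in J then 2 else 0).
Proof.
rewrite /wt -prodfV; under eq_bigr do rewrite invrK addrC -real_normK ?num_real //.
rewrite bigA_distr; apply: eq_bigr => J _; apply: eq_bigr => i _.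
by case: ifP.
Qed.

Lemma schwartz_wt f (l : seq 'I_n) : schwartz f ->
  exists2 C, 0 <= C & forall x, modulus (foldr partial f l x) <= C * wt x.
Proof.
move=> [sf bf]; pose b i := count_mem i l.
have /choice[C CP] : forall J : {set 'I_n}, exists C, forall x : 'rV[R]_n,
    schwartz_weight (fun i => if i \in J then 2%N else 0%N) b f x <= C.
  move=> J; have [C CP] := bf (fun i => if i \in J then 2%N else 0%N) b.
  by exists C => x; apply: CP; exists x.
have C0 J : 0 <= C J.
  by apply: le_trans (CP J 0); rewrite mulr_ge0 ?modulus_ge0 // prodr_ge0 // => i _; exact: exprn_ge0.
exists (\sum_J C J); first exact: sumr_ge0.
move=> x; rewrite -ler_pdivrMr ?wt_gt0 // wtV mulr_sumr foldr_partial_count //.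
by apply: ler_sum => J _; rewrite mulrC; exact: CP.
Qed.

End schwartz_bounds.

Section dictionary.
Context {R : realType} {d : nat}.
Local Notation V := 'rV[R]_d.
Variables (H : nat -> R -> R[i]) (M : nat -> R) (k : nat).
Variables (varphi : R -> R[i]) (phi : V -> R[i]) (t : R).
Hypotheses (M0 : forall j, 0 <= M j) (mH : forall j, cmeas (H j)).
Hypothesis HM : forall j x, modulus (H j x) <= M j.
Hypothesis Hweak : forall j (a : 'I_d -> R) b i psi, (j < k)%N -> ctest psi ->
  cintegral (leb d) setT (fun x => H j (\sum_j a j * x 0 j + b) * partial i psi x) =
  - ((a i)%:C%C * cintegral (leb d) setT (fun x => H j.+1 (\sum_j a j * x 0 j + b) * psi x)).
Hypotheses (varphiS : schwartz (on_line varphi)) (phiS : schwartz phi).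
Implicit Types (a : 'I_d -> R) (b : R) (x y : V) (l s : seq 'I_d) (i : 'I_d) (j p : nat).

(** Everything but the rough factor [H j]. Being smooth, it can be joined to the test function when
    [H j] is differentiated weakly. *)
Definition envelope a b y p l x : R[i] :=
  foldr partial (on_line varphi) (nseq p 0) (ridge a (b - t) x) *
  foldr partial phi l (1 *: x + (- y)).

Definition atom a b y j p l x : R[i] :=
  H j (\sum_i a i * x 0 i + b) * envelope a b y p l x.

(* The Leibniz rule for weak derivatives along s; j, p and l record the
   derivatives that have fallen on H, varphi and phi. *)
Fixpoint atom_deriv a b y s j p l x : R[i] :=
  if s is i :: s' then
    (a i)%:C%C * (atom_deriv a b y s' j.+1 p l x + atom_deriv a b y s' j p.+1 l x) +
    atom_deriv a b y s' j p (i :: l) x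
  else atom a b y j p l x.

Lemma smooth_envelope a b y p l : smooth (envelope a b y p l).
Proof.
apply: cexp_smoothM.
  exact: (smooth_axial (axial_ridge a (b - t)) (smooth_foldr _ varphiS.1)).
exact: (smooth_axial (axial_affine 1 (- y)) (smooth_foldr _ phiS.1)).
Qed.

Lemma partial_envelope a b y p l i : partial i (envelope a b y p l) =
  (fun x => (a i)%:C%C * envelope a b y p.+1 l x + envelope a b y p (i :: l) x).
Proof.
have [c1 d1] := partial_axial i (axial_ridge a (b - t))
  (smooth_cC1 (smooth_foldr (nseq p 0) varphiS.1)).
have [c2 d2] := partial_axial i (axial_affine 1 (- y)) (smooth_cC1 (smooth_foldr l phiS.1)).
by rewrite (partialM i c1 c2) d1 d2; apply/funext => x; rewrite /envelope /= mul1r mulrA.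
Qed.

Lemma atom_cmeas d0 (Z : measurableType d0) (a : Z -> 'I_d -> R) (b : Z -> R) (y x : Z -> V) j p l :
  (forall i, measurable_fun setT (fun z => a z i)) -> measurable_fun setT b ->
  measurable_fun setT y -> measurable_fun setT x ->
  cmeas (fun z => atom (a z) (b z) (y z) j p l (x z)).
Proof.
move=> ma mb my mx.
have ml : measurable_fun setT (fun z => \sum_i a z i * x z 0 i).
  apply: measurable_sum => i; apply: measurable_funM; first exact: ma.
  exact: (measurableT_comp (measurable_coord i) mx).
apply: cmeasM; first by apply: (cmeas_comp (mH j)); exact: measurable_funD.
apply: cmeasM.
  apply: (cmeas_comp (smooth_cmeas (smooth_foldr _ varphiS.1))).
  apply: measurable_fun_rV => i; under eq_fun do rewrite mxE.
  by apply: measurable_funD => //; exact: measurable_funB.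
apply: (cmeas_comp (smooth_cmeas (smooth_foldr _ phiS.1))).
apply: measurable_fun_rV => i; under eq_fun do rewrite !mxE mul1r.
apply: measurable_funB; first exact: (measurableT_comp (measurable_coord i) mx).
exact: (measurableT_comp (measurable_coord i) my).
Qed.

Lemma atom_deriv_cmeas d0 (Z : measurableType d0) (a : Z -> 'I_d -> R) (b : Z -> R) (y x : Z -> V) s j p l :
  (forall i, measurable_fun setT (fun z => a z i)) -> measurable_fun setT b ->
  measurable_fun setT y -> measurable_fun setT x ->
  cmeas (fun z => atom_deriv (a z) (b z) (y z) s j p l (x z)).
Proof.
move=> ma mb my mx; elim: s j p l => [|i s IHs] j p l; first exact: atom_cmeas.
apply: cmeasD => //; apply: cmeasM; last exact: cmeasD.
exact: cmeas_real.
Qed.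

Definition ridge_wt a b x : R := wt (ridge a (b - t) x).

(** A derivative falling on [H] or [varphi] costs a factor [|a i| <= L], one falling on [phi] brings
    no such factor; [L >= 1] lets all Leibniz terms carry the same power of [L]. *)
Lemma atom_deriv_bound s j p l : exists2 C, 0 <= C & forall a b y x (L : R), 1 <= L ->
  (forall i, `|a i| <= L) ->
  modulus (atom_deriv a b y s j p l x) <= C * L ^+ size s * ridge_wt a b x * wt (x - y).
Proof.
elim: s j p l => [|i s IHs] j p l.
  have [C1 C10 h1] := schwartz_wt (nseq p 0) varphiS.
  have [C2 C20 h2] := schwartz_wt l phiS.
  exists (M j * (C1 * C2)) => [|a b y x L L1 aL]; first by rewrite !mulr_ge0.
  rewrite expr0 mulr1 /atom_deriv /atom /envelope !modulusM scale1r.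
  rewrite -[leRHS]mulrA -[leRHS]mulrA mulrACA; apply: ler_pM; rewrite ?mulr_ge0 ?modulus_ge0 //.
  by apply: ler_pM; rewrite ?modulus_ge0.
have [C1 C10 h1] := IHs j.+1 p l; have [C2 C20 h2] := IHs j p.+1 l.
have [C3 C30 h3] := IHs j p (i :: l).
exists (C1 + C2 + C3) => [|a b y x L L1 aL]; first by rewrite !addr_ge0.
have {}h1 := h1 a b y x L L1 aL; have {}h2 := h2 a b y x L L1 aL; have {}h3 := h3 a b y x L L1 aL.
rewrite /=; set A1 := atom_deriv _ _ _ _ j.+1 _ _ _; set A2 := atom_deriv _ _ _ _ _ p.+1 _ _.
apply: le_trans (modulusD _ _) _; rewrite modulusM modulus_real.
have W0 : 0 <= ridge_wt a b x * wt (x - y) by rewrite mulr_ge0 // ltW // wt_gt0.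
set W := _ * _ in W0; have P0 : 0 <= L ^+ size s by rewrite exprn_ge0 // (le_trans _ L1).
move: h1 h2 h3; rewrite exprS -!mulrA -/W => h1 h2 h3.
have B : modulus (A1 + A2) <= (C1 + C2) * (L ^+ size s * W).
  by apply: le_trans (modulusD _ _) _; rewrite mulrDl lerD.
have PW : 0 <= L ^+ size s * W by rewrite mulr_ge0.
have B1 := ler_pM (normr_ge0 _) (modulus_ge0 _) (aL i) B.
have : C3 * (L ^+ size s * W) <= C3 * (L * (L ^+ size s * W)).
  by rewrite ler_wpM2l // ler_peMl.
lra.
Qed.

Lemma cintegrable_atom_deriv a b y s j p l psi : ctest psi ->
  cintegrable (leb d) setT (fun x => atom_deriv a b y s j p l x * psi x).
Proof.
move=> tpsi; have [C C0 h] := atom_deriv_bound s j p l.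
pose L := 1 + \sum_i `|a i|.
have L1 : 1 <= L by rewrite lerDl sumr_ge0.
have aL i : `|a i| <= L.
  by rewrite /L (bigD1 i) //= addrCA lerDl addr_ge0 ?ler01 ?sumr_ge0.
apply: (cintegrableMl (M := C * L ^+ size s)); last exact: ctest_cintegrable.
  by apply: atom_deriv_cmeas => [i|||]; [exact: measurable_cst|exact: measurable_cst|
    exact: measurable_cst|exact: measurable_id].
move=> x; apply: (le_trans (h a b y x L L1 aL)).
have CL : 0 <= C * L ^+ size s by rewrite mulr_ge0 // exprn_ge0 // (le_trans _ L1).
rewrite -mulrA ler_piMr //; by apply: mulr_ile1; rewrite ?wt_le1 // ltW // wt_gt0.
Qed.

(** Each integration by parts may put one more derivative on [H], whence [j + size s <= k]. [Hweak]
    is applied to envelope times test function, and the product rule there yields the terms that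
    [atom_deriv] collects. *)
Lemma atom_deriv_ibp a b y s j p l psi : (j + size s <= k)%N -> ctest psi ->
  cintegral (leb d) setT (fun x => atom a b y j p l x * foldr partial psi s x) =
  (-1) ^+ size s * cintegral (leb d) setT (fun x => atom_deriv a b y s j p l x * psi x).
Proof.
move=> jk tpsi; elim: s j p l jk => [|i s IHs] j p l; first by rewrite mul1r.
rewrite /= addnS => jk; set q := foldr partial psi s.
have tq : ctest q := ctest_foldr s tpsi.
have sQ := smooth_envelope a b y p l.
have tQq : ctest (fun x => envelope a b y p l x * q x).
  have := ctestM tq sQ; congr ctest; apply/funext => x; exact: mulrC.
have := Hweak a b i (leq_ltn_trans (leq_addr _ _) jk) tQq.
have := ctest_partial i tQq.
rewrite (partialM i (smooth_cC1 sQ) (smooth_cC1 (ctest_smooth tq))) partial_envelope => tP E.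
pose J j p l := cintegral (leb d) setT (fun x => atom a b y j p l x * q x).
have I j' p' l' r : ctest r -> cintegrable (leb d) setT (fun x => atom a b y j' p' l' x * r x).
  exact: (cintegrable_atom_deriv a b y [::] j' p' l').
have {}E : cintegral (leb d) setT (fun x => atom a b y j p l x * partial i q x) =
  - ((a i)%:C%C * J j.+1 p l) - ((a i)%:C%C * J j p.+1 l + J j p (i :: l)).
  have <- : cintegral (leb d) setT (fun x =>
      H j.+1 (\sum_j a j * x 0 j + b) * (envelope a b y p l x * q x)) = J j.+1 p l.
    by apply: eq_cintegral => x; rewrite mulrA.
  rewrite -E /J -cintegralZ; last exact: I.
  rewrite -cintegralD; [|exact/cintegrableZ/I|exact: I].
  rewrite -cintegralB.
  - apply: eq_cintegral => x; rewrite /atom; ring.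
  - apply: (cintegrableMl (M := M j)) => //; last exact: ctest_cintegrable.
    apply: (cmeas_comp (mH j)); apply: measurable_funD => //.
    by apply: measurable_sum => m; apply: measurable_funM => //; exact: measurable_coord.
  - by apply: cintegrableD; [exact/cintegrableZ/I|exact: I].
rewrite E /J !IHs //; try by rewrite ?addSn // ltnW.
pose A j p l := cintegral (leb d) setT (fun x => atom_deriv a b y s j p l x * psi x).
have -> : cintegral (leb d) setT (fun x => ((a i)%:C%C *
    (atom_deriv a b y s j.+1 p l x + atom_deriv a b y s j p.+1 l x) +
    atom_deriv a b y s j p (i :: l) x) * psi x) =
  (a i)%:C%C * (A j.+1 p l + A j p.+1 l) + A j p (i :: l).
  rewrite /A -cintegralD; try exact: cintegrable_atom_deriv.
  rewrite -cintegralZ; last by apply: cintegrableD; exact: cintegrable_atom_deriv.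
  rewrite -cintegralD; last exact: cintegrable_atom_deriv.
    by apply: eq_cintegral => x; ring.
  by apply/cintegrableZ/cintegrableD; exact: cintegrable_atom_deriv.
rewrite -/(A _ _ _) -/(A _ _ _) -/(A _ _ _) exprS; ring.
Qed.

End dictionary.

(** * Weights under translation and rescaling *)

Section weight_translation.
Context {R : realType}.

Lemma wtN n (x : 'rV[R]_n) : wt (- x) = wt x.
Proof. by apply: eq_bigr => i _; rewrite mxE sqrrN. Qed.

(** A Peetre inequality in each coordinate: [1 + y^2 <= (2 + 2 r^2) (1 + (x - y)^2)] for
    [|x| <= r]. *)
Lemma wt_shift n (r : R) (x y : 'rV[R]_n) : `|x| <= r ->
  wt (x - y) <= (2 + 2 * r ^+ 2) ^+ n * wt y.
Proof.
move=> xr; rewrite /wt.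
rewrite -[X in _ ^+ X](card_ord n) -prodr_const -big_split /=.
apply: ler_prod => i _; rewrite invr_ge0 addr_ge0 ?sqr_ge0 //= !mxE.
have xi : x 0 i ^+ 2 <= r ^+ 2.
  rewrite -real_normK ?num_real // lerXn2r ?nnegrE //; first exact: le_trans xr.
  exact: le_trans (rV_coord_le_norm x i) xr.
have p1 : 0 < 1 + (x 0 i - y 0 i) ^+ 2 by rewrite ltr_pwDl // sqr_ge0.
have p2 : 0 < 1 + y 0 i ^+ 2 by rewrite ltr_pwDl // sqr_ge0.
rewrite ler_pdivlMr // -ler_pdivlMl ?invr_gt0 // invrK.
have := sqr_ge0 (2 * x 0 i - y 0 i); have := sqr_ge0 (x 0 i - y 0 i); have := sqr_ge0 (x 0 i).
have := mulr_ge0 (sqr_ge0 (x 0 i - y 0 i)) (sqr_ge0 r).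
nra.
Qed.

(** The reason for rescaling [b]: if [L >= 1] also dominates the offset [e], then
    [1 + b^2 <= 3 (1 + (e + L b)^2)], and the decay in [b] is uniform in the slope and in [x]. *)
Lemma ridge_wt_width n (a : 'I_n -> R) (L b t : R) (x : 'rV[R]_n) :
  1 <= L -> `|\sum_i a i * x 0 i - t| <= L ->
  ridge_wt t a (L * b) x <= 3 * (1 + b ^+ 2)^-1.
Proof.
move=> L1; rewrite /ridge_wt /wt big_ord1 mxE addrA [_ + L * b - t]addrAC.
move: (_ - t) => e eL.
have p1 : 0 < 1 + (e + L * b) ^+ 2 by rewrite ltr_pwDl // sqr_ge0.
have p2 : 0 < 1 + b ^+ 2 by rewrite ltr_pwDl // sqr_ge0.
rewrite ler_pdivlMr // -ler_pdivlMl ?invr_gt0 // invrK mulrC.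
have e2 : e ^+ 2 <= L ^+ 2.
  by rewrite -[e ^+ 2]real_normK ?num_real // lerXn2r ?nnegrE // (le_trans _ L1).
have L2 : 1 <= L ^+ 2 by rewrite exprn_ege1.
have : b ^+ 2 <= 2 + 2 * (e + L * b) ^+ 2.
  rewrite -(ler_pM2l (lt_le_trans ltr01 L2)).
  have := sqr_ge0 (2 * e + L * b).
  have := mulr_ge0 (sqr_ge0 (e + L * b)) (_ : 0 <= L ^+ 2 - 1); rewrite subr_ge0 => /(_ L2).
  nra.
have := sqr_ge0 (e + L * b); lra.
Qed.

End weight_translation.

Section product_sfm.
Context {R : realType} d1 d2 (T1 : measurableType d1) (T2 : measurableType d2).
Context (m1 : {sigma_finite_measure set T1 -> \bar R}) (m2 : {sigma_finite_measure set T2 -> \bar R}).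

(* The library has no inferable sigma_finite_measure structure on m1 \x m2. *)
Definition prod_sigma : set (T1 * T2) -> \bar R := (m1 \x m2)%E.

HB.instance Definition _ := Measure.copy prod_sigma (m1 \x m2)%E.

Lemma prod_sigma_finite : sigma_finite setT prod_sigma.
Proof.
have /sigma_finiteP[F [TF ndF Foo]] := sigma_finiteT m1.
have /sigma_finiteP[G [TG ndG Goo]] := sigma_finiteT m2.
exists (fun k => F k `*` G k) => [|k].
  rewrite -setXTT TF TG predeqE => -[x y]; split => [[[k _ +] [l _ +]]|[k _ []]].
    move=> Fkx Gly; exists (maxn k l) => //; split.
      exact: (subsetPset _ _ (ndF _ _ (leq_maxl k l))) Fkx.
    exact: (subsetPset _ _ (ndG _ _ (leq_maxr k l))) Gly.
  by split; exists k.
have [mF Fk] := Foo k; have [mG Gk] := Goo k.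
split; first exact: measurableX.
by rewrite /prod_sigma product_measure1E // lte_mul_pinfty // ge0_fin_numE.
Qed.

HB.instance Definition _ := Measure_isSigmaFinite.Build _ _ _ prod_sigma prod_sigma_finite.

End product_sfm.

Section real_line_complex.
Context {R : realType}.
Local Notation mu := (@lebesgue_measure R).
Implicit Types f : R -> R[i].

Lemma cintegral_leb1 f : cmeas f ->
  cintegral (leb 1) setT (fun v => f (v 0 0)) = cintegral mu setT f.
Proof.
move=> [m1 m2]; congr (_ +i* _)%C; congr fine.
  by rewrite -integral_leb1 //; exact/measurable_EFinP.
by rewrite -integral_leb1 //; exact/measurable_EFinP.
Qed.

Lemma cintegrable_leb1 f : cmeas f ->
  cintegrable (leb 1) setT (fun v : 'rV[R]_1 => f (v 0 0)) -> cintegrable mu setT f.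
Proof.
have h (g : R -> R) : measurable_fun setT g ->
    (leb 1).-integrable setT (EFin \o (fun v : 'rV[R]_1 => g (v 0 0))) -> mu.-integrable setT (EFin \o g).
  move=> mg /integrableP[_ ig]; apply/integrableP; split; first exact/measurable_EFinP.
  rewrite -integral_leb1 //; exact/measurable_EFinP/measurableT_comp.
by move=> [m1 m2] [i1 i2]; split; exact: h.
Qed.

Lemma cintegral_affine_line (a c : R) f : a != 0 -> cmeas f ->
  cintegrable (leb 1) setT (fun v : 'rV[R]_1 => f (v 0 0)) ->
  cintegrable mu setT (fun b => f (a * b + c)) /\
  cintegral mu setT (fun b => f (a * b + c)) = (`|a|^-1)%:C%C * cintegral mu setT f.
Proof.
move=> a0 mf If.
have mfa : cmeas (fun b => f (a * b + c)).
  by apply: cmeas_comp mf _; apply: measurable_funD => //; exact: measurable_funM.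
split.
  apply: cintegrable_leb1 => //.
  have := cintegrable_affine (const_mx c) a0 If.
  by congr cintegrable; apply/funext => v; rewrite !mxE.
rewrite -!cintegral_leb1 // -[`|a|^-1]expr1 -(cintegral_affine (const_mx c) a0 If).
by apply: eq_cintegral => v; rewrite !mxE.
Qed.

End real_line_complex.

Lemma cintegral_prodM {R : realType} d1 d2 (T1 : measurableType d1) (T2 : measurableType d2)
  (m1 : {sigma_finite_measure set T1 -> \bar R})
  (m2 : {sigma_finite_measure set T2 -> \bar R}) (f : T1 -> R[i]) (g : T2 -> R[i]) :
  cintegrable m1 setT f -> cintegrable m2 setT g ->
  cintegrable (m1 \x m2)%E setT (fun p => f p.1 * g p.2) /\
  cintegral (m1 \x m2)%E setT (fun p => f p.1 * g p.2) = cintegral m1 setT f * cintegral m2 setT g.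
Proof.
move=> If Ig.
have Ip : cintegrable (m1 \x m2)%E setT (fun p => f p.1 * g p.2).
  apply: (le_cintegrable (g := fun p => modulus (f p.1) * modulus (g p.2))).
  - apply: cmeasM; first exact: cmeas_comp (cintegrable_cmeas If) measurable_fst.
    exact: cmeas_comp (cintegrable_cmeas Ig) measurable_snd.
  - exact: (integrable_prodM (integrable_modulus If) (integrable_modulus Ig)).
  - by move=> p; rewrite modulusM.
split=> //; rewrite -(cintegral12 Ip).2 -cintegralZr //; apply: eq_cintegral => x /=.
exact: cintegralZ.
Qed.

(** * Rescaled atoms and the synthesis of plane waves *)

Section features.
Context {R : realType} {d : nat}.
Local Notation V := 'rV[R]_d.
Local Notation Theta := (V * (measurableTypeR R * V))%type.
Variables (H : nat -> R -> R[i]) (M : nat -> R) (varphi : R -> R[i]) (phi : V -> R[i]).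
Variables (t tau r : R) (zeta0 : V).
Hypotheses (M0 : forall j, 0 <= M j) (mH : forall j, cmeas (H j)).
Hypothesis HM : forall j x, modulus (H j x) <= M j.
Hypotheses (varphiS : schwartz (on_line varphi)) (phiS : schwartz phi).
Hypotheses (tau_neq0 : tau != 0) (r_ge0 : 0 <= r).

Definition slope (xi : V) (i : 'I_d) : R := (xi 0 i + zeta0 0 i) / tau.

(** The constant is large enough for [width] to dominate every [|slope xi i|] and, when [|x| <= r],
    the offset of the ridge from [t], as [atom_deriv_bound] and [ridge_wt_width] demand. *)
Definition width (xi : V) : R :=
  (1 + `|t| + (1 + d%:R * r) * (1 + `|zeta0|) / `|tau|) * (1 + `|xi|).

Definition feature s (th : Theta) (x : V) : R[i] :=
  atom_deriv H varphi phi t (slope th.1) (width th.1 * th.2.1) th.2.2 s 0 0 [::] x.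

Lemma width_ge1 xi : 1 <= width xi.
Proof.
rewrite /width mulr_ege1 ?lerDl // -addrA lerDl addr_ge0 // divr_ge0 //.
by rewrite mulr_ge0 // addr_ge0 // mulr_ge0.
Qed.

Lemma slope_le xi i : `|slope xi i| <= (1 + `|zeta0|) / `|tau| * (1 + `|xi|).
Proof.
rewrite /slope normf_div mulrAC ler_pM2r ?invr_gt0 ?normr_gt0 //.
have := rV_coord_le_norm xi i; have := rV_coord_le_norm zeta0 i.
have := ler_normD (xi 0 i) (zeta0 0 i).
have := mulr_ge0 (normr_ge0 xi) (normr_ge0 zeta0).
lra.
Qed.

Lemma slope_width xi i : `|slope xi i| <= width xi.
Proof.
apply: le_trans (slope_le xi i) _; rewrite /width ler_wpM2r ?addr_ge0 //.
rewrite -[leLHS]add0r lerD ?addr_ge0 // -mulrA ler_peMl ?divr_ge0 ?addr_ge0 //.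
by rewrite lerDl mulr_ge0.
Qed.

Lemma slope_dot_width xi (x : V) : `|x| <= r ->
  `|\sum_i slope xi i * x 0 i - t| <= width xi.
Proof.
move=> xr; set B := (1 + `|zeta0|) / `|tau| * (1 + `|xi|).
have B0 : 0 <= B by rewrite mulr_ge0 ?divr_ge0 ?addr_ge0.
have : `|\sum_i slope xi i * x 0 i| <= d%:R * (B * r).
  apply: le_trans (ler_norm_sum _ _ _) _.
  rewrite -[d in d%:R](card_ord d) mulr_natl -sumr_const.
  apply: ler_sum => i _; rewrite normrM; apply: ler_pM => //; first exact: slope_le.
  exact: le_trans (rV_coord_le_norm x i) xr.
have := ler_normB (\sum_i slope xi i * x 0 i) t.
have -> : width xi = (1 + `|t|) * (1 + `|xi|) + B + d%:R * (B * r).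
  by rewrite /width /B; ring.
have := mulr_ge0 (addr_ge0 ler01 (normr_ge0 t)) (normr_ge0 xi).
by lra.
Qed.

Definition theta_wt (p : measurableTypeR R * V) : R := (1 + p.1 ^+ 2)^-1 * wt p.2.

Lemma feature_bound s : exists2 C, 0 <= C & forall th x, `|x| <= r ->
  modulus (feature s th x) <= C * (1 + `|th.1|) ^+ size s * theta_wt th.2.
Proof.
have [C C0 hC] := atom_deriv_bound t M0 HM varphiS phiS s 0 0 [::].
pose A := 1 + `|t| + (1 + d%:R * r) * (1 + `|zeta0|) / `|tau|.
have A0 : 0 <= A.
  by rewrite /A !addr_ge0 // divr_ge0 // mulr_ge0 // addr_ge0 // mulr_ge0.
exists (C * A ^+ size s * 3 * (2 + 2 * r ^+ 2) ^+ d).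
  by rewrite mulr_ge0 ?exprn_ge0 // ?mulr_ge0 ?exprn_ge0 // addr_ge0 // mulr_ge0 // sqr_ge0.
move=> [xi [b y]] x xr /=.
apply: le_trans (hC _ _ _ _ _ (width_ge1 xi) (slope_width xi)) _.
have h1 := ridge_wt_width b (width_ge1 xi) (slope_dot_width xi xr).
have h2 := wt_shift y xr.
rewrite /width -/A exprMn in h1 *.
rewrite (_ : _ * (1 + `|xi|) ^+ size s * theta_wt (b, y) =
  C * (A ^+ size s * (1 + `|xi|) ^+ size s) * (3 * (1 + b ^+ 2)^-1) * ((2 + 2 * r ^+ 2) ^+ d * wt y)).
  have w0 : 0 <= C * (A ^+ size s * (1 + `|xi|) ^+ size s).
    exact: mulr_ge0 C0 (mulr_ge0 (exprn_ge0 _ A0) (exprn_ge0 _ (addr_ge0 ler01 (normr_ge0 xi)))).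
  apply: ler_pM => //; [exact: mulr_ge0 w0 (ltW (wt_gt0 _))|exact: ltW (wt_gt0 _)|].
  exact: ler_wpM2l w0 _ _ h1.
rewrite /theta_wt /=; ring.
Qed.

Lemma measurable_width : measurable_fun setT width.
Proof.
apply: measurable_funM => //; apply: measurable_funD => //.
by apply: continuous_measurable_rV => x; exact: norm_continuous.
Qed.

Lemma measurable_slope i : measurable_fun setT (fun xi => slope xi i).
Proof.
apply: measurable_funM => //; apply: measurable_funD => //.
exact: measurable_coord.
Qed.

Lemma feature_cmeas d0 (Z : measurableType d0) (th : Z -> Theta) (x : Z -> V) s :
  measurable_fun setT th -> measurable_fun setT x ->
  cmeas (fun z => feature s (th z) (x z)).
Proof.
move=> mth mx.
have m1 : measurable_fun setT (fun z => (th z).1) by exact: measurableT_comp mth.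
have m2 : measurable_fun setT (fun z => (th z).2.1).
  by apply: measurableT_comp => //; exact: measurableT_comp mth.
have m3 : measurable_fun setT (fun z => (th z).2.2).
  by apply: measurableT_comp => //; exact: measurableT_comp mth.
apply: atom_deriv_cmeas => // [i|].
  exact: (measurableT_comp (measurable_slope i) m1).
apply: measurable_funM => //; exact: (measurableT_comp measurable_width m1).
Qed.

Definition window_measure : {sigma_finite_measure set (measurableTypeR R * V)%type -> \bar R} :=
  prod_sigma (@lebesgue_measure R) (leb d).

Definition theta_measure : {sigma_finite_measure set Theta -> \bar R} :=
  prod_sigma (leb d) window_measure.

Lemma integrable_theta_wt : window_measure.-integrable setT (EFin \o theta_wt).
Proof.
have i1 : (@lebesgue_measure R).-integrable setT (EFin \o (fun b : R => (1 + b ^+ 2)^-1)).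
  apply/integrableP; split.
    by apply/measurable_EFinP; apply: continuous_measurable_fun; exact: continuous_oneDsqrV.
  under eq_integral => b _ do rewrite /= ger0_norm ?invr_ge0 ?addr_ge0 ?sqr_ge0 //.
  by rewrite integral_wt1 ltry.
exact: (@integrable_prodM _ _ _ _ _ (@lebesgue_measure R) (leb d) _ _ i1 (integrable_wt d)).
Qed.

Variable c0 : R[i].

(** The unimodular factors select the frequency [tau] in the ridge variable and [zeta0] in [y]; the
    last factor is the Jacobian of [b -> width * b]. *)
Definition density (g : V -> R[i]) (th : Theta) : R[i] :=
  c0 * g th.1 * (cexp (- (2 * pi * dotp th.2.2 zeta0)) *
    cexp (- (2 * pi * (width th.1 * th.2.1) * tau))) * (width th.1)%:C%C.

Definition feature_wt N (g : V -> R[i]) (th : Theta) : R :=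
  modulus (g th.1) * (1 + `|th.1|) ^+ N * theta_wt th.2.

(** The exponent exceeds the number of derivatives by one because of the Jacobian in [density]. *)
Lemma density_feature_bound s : exists2 C, 0 <= C & forall g th x, `|x| <= r ->
  modulus (density g th * feature s th x) <= C * feature_wt (size s).+1 g th.
Proof.
have [C C0 hC] := feature_bound s.
pose A := 1 + `|t| + (1 + d%:R * r) * (1 + `|zeta0|) / `|tau|.
have A0 : 0 <= A.
  by rewrite /A !addr_ge0 // divr_ge0 // mulr_ge0 // addr_ge0 // mulr_ge0.
have c00 := modulus_ge0 c0.
exists (modulus c0 * A * C); first exact: mulr_ge0 (mulr_ge0 c00 A0) C0.
move=> g th x xr; rewrite /density !modulusM !modulus_cexp modulus_real !mulr1.
rewrite (ger0_norm (le_trans ler01 (width_ge1 _))) /width -/A.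
have x1 : 0 <= 1 + `|th.1| by rewrite addr_ge0.
have := ler_wpM2l (mulr_ge0 (mulr_ge0 c00 (modulus_ge0 (g th.1))) (mulr_ge0 A0 x1)) (hC th x xr).
move=> h; apply: (le_trans h).
by rewrite /feature_wt exprS le_eqVlt; apply/orP; left; apply/eqP; ring.
Qed.

Lemma density_cmeas g d0 (Z : measurableType d0) (th : Z -> Theta) :
  cmeas g -> measurable_fun setT th -> cmeas (fun z => density g (th z)).
Proof.
move=> mg mth.
have m1 : measurable_fun setT (fun z => (th z).1) by exact: measurableT_comp mth.
have m2 : measurable_fun setT (fun z => (th z).2.1).
  by apply: measurableT_comp => //; exact: measurableT_comp mth.
have m3 : measurable_fun setT (fun z => (th z).2.2).
  by apply: measurableT_comp => //; exact: measurableT_comp mth.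
have mw : measurable_fun setT (fun z => width (th z).1) := measurableT_comp measurable_width m1.
apply: cmeasM; last exact: cmeas_real.
apply: cmeasM; first by apply: cmeasM; [exact: cmeas_cst|exact: cmeas_comp mg m1].
apply: cmeasM; apply: cmeas_cexp; apply: measurableT_comp => //.
  by apply: measurable_funM => //; exact: (measurableT_comp (measurable_dotpl zeta0) m3).
by apply: measurable_funM => //; apply: measurable_funM => //; exact: measurable_funM.
Qed.

Lemma integrable_feature_wt N g :
  (leb d).-integrable setT (EFin \o (fun xi => modulus (g xi) * (1 + `|xi|) ^+ N)) ->
  theta_measure.-integrable setT (EFin \o feature_wt N g).
Proof.
move=> ig.
exact: (integrable_prodM (m2 := window_measure) ig integrable_theta_wt).
Qed.

(** With [c] the value at [x] of the linear form of slope [xi], the substitution [s = L b + c]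
    splits off a wave of phase [c * tau = x . (xi + zeta0)], and its factor [1 / L] cancels the
    Jacobian. The [y]-integral gives [invfourier phi zeta0] and a wave of phase [- x . zeta0]; what
    remains is the plane wave at [xi]. *)
Lemma cintegral_window xi (x : V) :
  cintegral window_measure setT (fun p => density (fun=> 1) (xi, p) * feature [::] (xi, p) x) =
  c0 * cintegral (@lebesgue_measure R) setT (fun s => H 0%N s * varphi (s - t) * cexp (- (2 * pi * s * tau))) *
  invfourier phi zeta0 * cexp (2 * pi * dotp x xi).
Proof.
pose W s := H 0%N s * varphi (s - t) * cexp (- (2 * pi * s * tau)).
pose c := \sum_i slope xi i * x 0 i.
have L1 := width_ge1 xi; set L := width xi in L1 *.
have L0 : 0 < L := lt_le_trans ltr01 L1.
have [Cv Cv0 hv] := schwartz_wt [::] varphiS.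
have mv : cmeas varphi := line_cmeas (smooth_cmeas varphiS.1).
have mW : cmeas W.
  apply: cmeasM; last by apply: cmeas_cexp; apply: measurableT_comp => //; do 2 apply: measurable_funM => //.
  by apply: cmeasM => //; apply: (cmeas_comp mv); exact: measurable_funB.
have IW : cintegrable (leb 1) setT (fun v : 'rV[R]_1 => W (v 0 0)).
  apply: (wt_cintegrable (C := M 0 * (Cv * (2 + 2 * `|t| ^+ 2) ^+ 1))).
    exact: cmeas_comp mW (measurable_coord 0).
  move=> v; rewrite /W !modulusM modulus_cexp mulr1 -!mulrA.
  apply: ler_pM; rewrite ?modulus_ge0 ?HM //.
  have := hv (v - const_mx t); rewrite /= /on_line !mxE => h; apply: (le_trans h).
  rewrite ler_wpM2l // -wtN opprB; apply: wt_shift.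
  by apply: rV_norm_le => // i; rewrite mxE.
have [IA EA] := cintegral_affine_line c (lt0r_neq0 L0) mW IW.
pose B y := phi (x - y) * cexp (- (2 * pi * dotp y zeta0)).
have [Cp Cp0 hp] := schwartz_wt [::] phiS.
have Ip : cintegrable (leb d) setT phi := wt_cintegrable (smooth_cmeas phiS.1) hp.
pose B' z := phi z * cexp (2 * pi * dotp z zeta0).
have IB' : cintegrable (leb d) setT B'.
  apply: (cintegrableMr (M := 1)) => //; first exact: cmeas_cexp_dotp.
  by move=> z; rewrite modulus_cexp.
have EB y : B y = cexp (- (2 * pi * dotp x zeta0)) * B' (x - y).
  rewrite /B /B' mulrCA -cexpD; congr (_ * cexp _); rewrite dotpDl dotpNl; ring.
have IB : cintegrable (leb d) setT B.
  have := cintegrableZ (cexp (- (2 * pi * dotp x zeta0)))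
    (cintegrable_affine x (_ : (-1 : R) != 0) IB').
  rewrite oppr_eq0 oner_neq0 => /(_ isT); congr cintegrable.
  by apply/funext => y; rewrite EB scaleN1r [- y + x]addrC.
have EcB : cintegral (leb d) setT B = cexp (- (2 * pi * dotp x zeta0)) * invfourier phi zeta0.
  have IB'' : cintegrable (leb d) setT (fun y => B' (x - y)).
    have := cintegrable_affine x (_ : (-1 : R) != 0) IB'.
    rewrite oppr_eq0 oner_neq0 => /(_ isT); congr cintegrable.
    by apply/funext => y; rewrite scaleN1r [- y + x]addrC.
  by rewrite (eq_cintegral _ EB) cintegralZ // (cintegral_reflect x IB').
transitivity (cintegral window_measure setT (fun p : measurableTypeR R * V =>
    c0 * L%:C%C * cexp (2 * pi * c * tau) * (W (L * p.1 + c) * B p.2))).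
  apply: eq_cintegral => -[b y] /=.
  rewrite /density /feature /= /atom /envelope /= /W /B /on_line !mxE /= -/c -/L scale1r addrA [c + L * b]addrC.
  have -> : cexp (- (2 * pi * (L * b) * tau)) =
      cexp (2 * pi * c * tau) * cexp (- (2 * pi * (L * b + c) * tau)).
    by rewrite -cexpD; congr cexp; ring.
  ring.
have [IAB EAB] := cintegral_prodM (m1 := @lebesgue_measure R) (m2 := leb d) IA IB.
rewrite (cintegralZ _ IAB) [X in _ * X]EAB.
rewrite EA EcB gtr0_norm //.
have cE : c * tau = dotp x xi + dotp x zeta0.
  rewrite /c /dotp mulr_suml -big_split; apply: eq_bigr => i _ /=.
  by rewrite /slope; field.
have -> : 2 * pi * dotp x xi = 2 * pi * c * tau + - (2 * pi * dotp x zeta0).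
  by rewrite -[_ * c * tau]mulrA cE; ring.
have LV : L%:C%C * (L^-1)%:C%C = 1 :> R[i] by rewrite -rmorphM /= mulfV ?gt_eqF.
rewrite cexpD -/W.
transitivity ((L%:C%C * (L^-1)%:C%C) * (c0 * cintegral (@lebesgue_measure R) setT W * invfourier phi zeta0 *
  (cexp (2 * pi * c * tau) * cexp (- (2 * pi * dotp x zeta0))))); first ring.
by rewrite LV mul1r.
Qed.

(** For fixed [xi], Fubini moves the integral over [(b, y)] inside that over [x], where
    [cintegral_window] yields a plane wave, and the [x]-integral becomes [invfourier q]. The support
    of [q] lies where the feature bounds hold. *)
Lemma synthesis (g q : V -> R[i]) : cmeas g ->
  (leb d).-integrable setT (EFin \o (fun xi => modulus (g xi) * (1 + `|xi|) ^+ 1)) ->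
  ctest q -> (forall x : V, r < `|x| -> q x = 0) ->
  cintegral theta_measure setT (fun th => cintegral (leb d) setT (fun x =>
    density g th * feature [::] th x * q x)) =
  c0 * cintegral (@lebesgue_measure R) setT (fun s => H 0%N s * varphi (s - t) * cexp (- (2 * pi * s * tau))) *
  invfourier phi zeta0 * cintegral (leb d) setT (fun xi => g xi * invfourier q xi).
Proof.
move=> mg ig tq q0; set K := c0 * _ * _.
have [C C0 hC] := density_feature_bound [::].
have bf g' th x : modulus (density g' th * feature [::] th x * q x) <=
    C * feature_wt 1 g' th * modulus (q x).
  rewrite modulusM; have [xr|xr] := leP `|x| r; last by rewrite q0 // modulus0 !mulr0.
  by rewrite ler_wpM2r ?modulus_ge0 ?hC.
have iq := integrable_modulus (ctest_cintegrable tq).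
have mf d0 (Z : measurableType d0) (th : Z -> Theta) (x : Z -> V) g' : cmeas g' ->
    measurable_fun setT th -> measurable_fun setT x ->
    cmeas (fun z => density g' (th z) * feature [::] (th z) (x z)).
  by move=> mg' mth mx; apply: cmeasM; [exact: density_cmeas|exact: feature_cmeas].
have mfq d0 (Z : measurableType d0) (th : Z -> Theta) (x : Z -> V) g' : cmeas g' ->
    measurable_fun setT th -> measurable_fun setT x ->
    cmeas (fun z => density g' (th z) * feature [::] (th z) (x z) * q (x z)).
  by move=> mg' mth mx; apply: cmeasM; [exact: mf|exact: cmeas_comp (ctest_cmeas tq) mx].
have iG : theta_measure.-integrable setT (EFin \o (fun th => C * feature_wt 1 g th)).
  exact: (integrableZl measurableT C (integrable_feature_wt ig)).
have IF : cintegrable theta_measure setT (fun th => cintegral (leb d) setT (fun x =>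
    density g th * feature [::] th x * q x)).
  apply: (cintegrable_fubini1 _ iG iq (bf g)).
  exact: (mfq _ _ fst snd g mg measurable_fst measurable_snd).
rewrite -[LHS]/(cintegral (leb d \x window_measure)%E setT _) -(cintegral12 IF).2.
have mpair (xi : V) : measurable_fun setT (fun p : measurableTypeR R * V => (xi, p)).
  exact: measurable_pair1.
have inner xi : cintegral window_measure setT (fun p => cintegral (leb d) setT (fun x =>
    density g (xi, p) * feature [::] (xi, p) x * q x)) = K * (g xi * invfourier q xi).
  have iP : window_measure.-integrable setT (EFin \o (fun p => C * feature_wt 1 g (xi, p))).
    have := integrableZl measurableT (C * (modulus (g xi) * (1 + `|xi|) ^+ 1)) integrable_theta_wt.
    by congr (_.-integrable setT); apply/funext => p /=; rewrite -EFinM /feature_wt !mulrA.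
  rewrite (cFubini (g := fun p => C * feature_wt 1 g (xi, p)) (h := fun x => modulus (q x)) _ iP iq); last first.
  - by move=> p x; exact: bf.
  - apply: (mfq _ _ (fun z => (xi, z.1)) snd g mg); last exact: measurable_snd.
    exact: (measurableT_comp (mpair xi) measurable_fst).
  rewrite [K * _]mulrA -cintegralZ; last first.
    by apply: (cintegrableMr (M := 1)) (ctest_cintegrable tq);
      [exact: cmeas_cexp_dotp|move=> x; rewrite modulus_cexp].
  apply: eq_cintegral => x.
  have [xr|/q0 qx] := leP `|x| r; last first.
    by rewrite qx !(mul0r, mulr0); under eq_cintegral do rewrite mulr0; rewrite cintegral0.
  have m1 : cmeas (fun _ : V => 1 : R[i]) := cmeas_cst _ _.
  have I1 : cintegrable window_measure setT (fun p => density (fun=> 1) (xi, p) * feature [::] (xi, p) x).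
    apply: (le_cintegrable (g := fun p => C * feature_wt 1 (fun=> 1) (xi, p))).
    - exact: (mf _ _ (fun p => (xi, p)) (fun=> x) _ m1 (mpair xi) (measurable_cst _)).
    - have := integrableZl measurableT (C * (modulus (1 : R[i]) * (1 + `|xi|) ^+ 1)) integrable_theta_wt.
      by congr (_.-integrable setT); apply/funext => p /=; rewrite -EFinM /feature_wt !mulrA.
    - by move=> p; exact: hC.
  transitivity (cintegral window_measure setT (fun p => (g xi * q x) *
      (density (fun=> 1) (xi, p) * feature [::] (xi, p) x))).
    by apply: eq_cintegral => p; rewrite /density /=; ring.
  by rewrite cintegralZ // cintegral_window -/K; ring.
rewrite (eq_cintegral _ inner) cintegralZ //.
have ib := invfourier_bounded (ctest_cintegrable tq).
apply: (cintegrableMr _ ib).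
  by have [] := smooth_invfourier tq [::] => c1 c2 _; split; exact: continuous_measurable_rV.
apply: (le_cintegrable mg ig) => xi.
by rewrite ler_peMr ?modulus_ge0 // expr1 lerDl.
Qed.

End features.

(** * Almost every ridge avoids a null set *)

Section generic_ridges.
Context {R : realType} {d : nat}.
Local Notation V := 'rV[R]_d.
Local Notation Theta := (V * (measurableTypeR R * V))%type.
Variables (t tau r : R) (zeta0 : V).
Hypothesis (r_ge0 : 0 <= r).

Let line (th : Theta) (x : V) : R :=
  \sum_i slope tau zeta0 th.1 i * x 0 i + width t tau r zeta0 th.1 * th.2.1.

Lemma measurable_line d0 (Z : measurableType d0) (th : Z -> Theta) (x : Z -> V) :
  measurable_fun setT th -> measurable_fun setT x -> measurable_fun setT (fun z => line (th z) (x z)).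
Proof.
move=> mth mx.
have m1 : measurable_fun setT (fun z => (th z).1) by exact: measurableT_comp mth.
have m2 : measurable_fun setT (fun z => (th z).2.1).
  by apply: measurableT_comp => //; exact: measurableT_comp mth.
apply: measurable_funD.
  apply: measurable_sum => i; apply: measurable_funM.
    exact: (measurableT_comp (measurable_slope tau zeta0 i) m1).
  exact: (measurableT_comp (measurable_coord i) mx).
apply: measurable_funM => //; exact: (measurableT_comp (measurable_width t tau r zeta0) m1).
Qed.

(** For fixed [xi], [y] and [x] the argument is affine in [b] with coefficient [width >= 1], so it
    meets [A] only for [b] in a null set; Tonelli turns this into a null set of [x] for almost every
    parameter. Zero slopes, for which a particular [b] may fail, are covered too. *)
Lemma ae_ridge_null (A : set R) : measurable A -> @lebesgue_measure R A = 0%E ->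
  {ae theta_measure (R := R) (d := d), forall th : Theta, leb d [set x | A (line th x)] = 0%E}.
Proof.
move=> mA A0.
pose F (z : Theta * V) : \bar R := (\1_A (line z.1 z.2))%:E.
have mF : measurable_fun setT F.
  apply/measurable_EFinP; apply: (measurableT_comp (f := (\1_A : R -> R))).
    exact: measurable_indic.
  exact: (measurable_line measurable_fst measurable_snd).
have F0 z : (0 <= F z)%E by rewrite lee_fin indicE.
pose k th := (\int[leb d]_x F (th, x))%E.
have mk : measurable_fun setT k :=
  @measurable_fun_fubini_tonelli_F _ _ (V * (measurableTypeR R * V))%type V R (leb d) F mF F0.
have k0 th : (0 <= k th)%E by apply: integral_ge0.
have : (\int[theta_measure (R := R) (d := d)]_th `|k th| = 0)%E.
  under eq_integral do rewrite gee0_abs //.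
  rewrite -[LHS]/(\int[(leb d \x window_measure (R := R) (d := d))%E]_th k th)%E.
  rewrite fubini_tonelli1 //; apply: integral0_eq => xi _; rewrite /fubini_F.
  have mkp : measurable_fun setT (fun p => k (xi, p)) by exact: (measurableT_comp mk (measurable_pair1 xi)).
  rewrite -[LHS]/(\int[(@lebesgue_measure R \x leb d)%E]_p k (xi, p))%E.
  rewrite fubini_tonelli1 // fubini_tonelli //; apply: integral0_eq => y _; rewrite /fubini_G /=.
  pose G (p : measurableTypeR R * V) := F ((xi, (p.1, y)), p.2).
  have mG : measurable_fun setT G.
    apply/measurable_EFinP; apply: (measurableT_comp (f := (\1_A : R -> R))).
      exact: measurable_indic.
    apply: (measurable_line (th := fun p => (xi, (p.1, y)))); last exact: measurable_snd.
    exact: measurable_fun_pair (measurable_cst _) (measurable_fun_pair measurable_fst (measurable_cst _)).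
  rewrite -[LHS]/(\int[@lebesgue_measure R]_b fubini_F (leb d) G b)%E fubini_tonelli //; last by move=> p; exact: F0.
  apply: integral0_eq => x _; rewrite /fubini_G /G /F /line /=.
  under eq_integral do rewrite addrC.
  have L0 : width t tau r zeta0 xi != 0.
    by rewrite gt_eqF // (lt_le_trans ltr01) // width_ge1.
  have mI : measurable_fun setT (EFin \o (\1_A : R -> R)) by apply/measurable_EFinP; exact: measurable_indic.
  rewrite (ge0_integral_affine1 _ L0 mI) => [|z]; last by rewrite lee_fin indicE.
  rewrite [X in (_ * X)%E](_ : _ = 0)%E ?mule0 //.
  have := integral_indic (@lebesgue_measure R) measurableT mA; rewrite setIT => h.
  exact: etrans h A0.
move/(ae_eq_integral_abs _ measurableT mk).
apply: filterS => th /(_ I); rewrite /k /F /= => k0'.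
have mB : measurable [set x | A (line th x)].
  have := measurable_line (measurable_cst th) (@measurable_id _ V setT) measurableT mA.
  by rewrite setTI.
have := integral_indic (leb d) measurableT mB; rewrite setIT => h.
exact: etrans (esym h) k0'.
Qed.

Lemma ae_ridge_eq (f g : R -> R[i]) : {ae @lebesgue_measure R, forall s, f s = g s} ->
  {ae theta_measure (R := R) (d := d), forall th : Theta,
    {ae leb d, forall x, f (line th x) = g (line th x)}}.
Proof.
move=> [A [mA A0 fgA]]; have := ae_ridge_null mA A0.
apply: filterS => th h; exists [set x | A (line th x)]; split => //.
  have := measurable_line (measurable_cst th) (@measurable_id _ V setT) measurableT mA.
  by rewrite setTI.
by move=> x /= fgx; apply: fgA.
Qed.

End generic_ridges.

(** * Greedy sampling *)

(** From [exp (- z) >= 1 - z] and [(1 + z + 2 z^2) (1 - z) = 1 + z^2 (1 - 2 z) >= 1]. *)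
Lemma expR_quadratic {R : realType} (z : R) : `|z| <= 2^-1 -> expR z <= 1 + z + 2 * z ^+ 2.
Proof.
move=> z2; have z1 : 0 < 1 - z by move: z2; rewrite ler_norml => /andP[]; lra.
apply: (@le_trans _ _ (1 - z)^-1).
  rewrite -[z]opprK expRN lef_pV2 ?posrE ?expR_gt0 ?opprK //.
  by have := expR_ge1Dx (- z); rewrite addrC.
rewrite -[leLHS]mul1r ler_pdivrMr //.
have := mulr_ge0 (sqr_ge0 z) (_ : 0 <= 1 - 2 * z).
move: z2; rewrite ler_norml => /andP[a b] /(_ _); rewrite subr_ge0 => h.
have {}h : 0 <= z ^+ 2 * (1 - 2 * z) by apply: h; lra.
nra.
Qed.

Section greedy_sampling.
Context {R : realType} dT (T : measurableType dT) dX (X : measurableType dX).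
Context (mu : {sigma_finite_measure set T -> \bar R}) (nu : {sigma_finite_measure set X -> \bar R}).
Variables (I : finType) (Y : I -> T -> X -> R) (rho : T -> R) (w : X -> R) (good : set T).
Hypothesis mY : forall c, measurable_fun setT (fun p : T * X => Y c p.1 p.2).
Hypothesis Y1 : forall c th x, `|Y c th x| <= 1.
Hypotheses (rho0 : forall th, 0 <= rho th) (irho : mu.-integrable setT (EFin \o rho)).
Hypothesis rho_gt0 : 0 < \int[mu]_th rho th.
Hypothesis centered : forall c x, \int[mu]_th (rho th * Y c th x) = 0.
Hypotheses (w0 : forall x, 0 <= w x) (mw : measurable_fun setT w).
Hypothesis good_ae : {ae mu, forall th, good th}.

Definition potential (e : R) (S : I -> X -> R) : \bar R :=
  (\int[nu]_x (w x * \sum_c expR (e * S c x))%:E)%E.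

(* Averaging over th with density rho multiplies the potential by at most
   1 + 2 e^2, since the linear term vanishes; the slack 4 e^2 leaves room for
   choosing th in the conull set good. *)
Lemma greedy_step (e B : R) (S : I -> X -> R) : 0 < e <= 2^-1 -> 0 < B ->
  (forall c, measurable_fun setT (S c)) -> (potential e S <= B%:E)%E ->
  exists th, [/\ good th, 0 < rho th &
    (potential e (fun c x => S c x + Y c th x)%R <= ((1 + 4 * e ^+ 2) * B)%:E)%E].
Proof.
move=> /andP[e0 e2] B0 mS SB; apply: contrapT => hno.
pose m := \int[mu]_th rho th.
have mrho : measurable_fun setT rho by case/integrableP: irho => /measurable_EFinP.
pose F (p : T * X) : R := rho p.1 * (w p.2 * \sum_c expR (e * (S c p.2 + Y c p.1 p.2))).
have mF : measurable_fun setT F.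
  apply: measurable_funM; first exact: (measurableT_comp mrho measurable_fst).
  apply: measurable_funM; first exact: (measurableT_comp mw measurable_snd).
  apply: measurable_sum => c; apply: measurableT_comp => //; apply: measurable_funM => //.
  by apply: measurable_funD => //; exact: (measurableT_comp (mS c) measurable_snd).
have F0 p : 0 <= F p by rewrite !mulr_ge0 // sumr_ge0 // => c _; exact: expR_ge0.
have mF' : measurable_fun setT (EFin \o F) by exact/measurable_EFinP.
have F0' p : (0 <= (EFin \o F) p)%E by rewrite lee_fin.
have mFth th : measurable_fun setT (fun x => F (th, x)) by exact: (measurableT_comp mF (measurable_pair1 th)).
pose K := (1 + 4 * e ^+ 2) * B.
have K0 : 0 <= K by rewrite mulr_ge0 ?(ltW B0) // addr_ge0 // mulr_ge0 // sqr_ge0.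
have EFth th : (\int[nu]_x (F (th, x))%:E = (rho th)%:E * potential e (fun c x => S c x + Y c th x)%R)%E.
  rewrite /potential -ge0_integralZl ?lee_fin //.
  - apply/measurable_EFinP; apply: measurable_funM => //; apply: measurable_sum => c.
    apply: measurableT_comp => //; apply: measurable_funM => //.
    by apply: measurable_funD => //; exact: (measurableT_comp (mY c) (measurable_pair1 th)).
  - by move=> x _; rewrite lee_fin mulr_ge0 // sumr_ge0 // => c _; exact: expR_ge0.
(* By the contradiction hypothesis the potential exceeds [K] at every good [th] where [rho] is
   positive. *)
have lower : ((m * K)%:E <= \int[mu]_th \int[nu]_x (F (th, x))%:E)%E.
  have -> : ((m * K)%:E = \int[mu]_th (rho th * K)%:E)%E.
    have := RintegralZr K measurableT irho; rewrite /m => <-.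
    rewrite /Rintegral fineK //; apply: integrable_fin_num => //.
    have := integrableZl measurableT K irho; congr (_.-integrable setT).
    by apply/funext => th /=; rewrite -EFinM mulrC.
  apply: ae_ge0_le_integral => //.
  - by move=> th _; rewrite lee_fin mulr_ge0.
  - by apply/measurable_EFinP; exact: measurable_funM.
  - by move=> th _; apply: integral_ge0 => x _; rewrite lee_fin.
  - exact: (@measurable_fun_fubini_tonelli_F _ _ T X R nu (EFin \o F) mF' F0').
  apply: filterS good_ae => th gth _; rewrite EFth EFinM.
  have [->|rth] := eqVneq (rho th) 0; first by rewrite !mul0e.
  rewrite lee_wpmul2l ?lee_fin //; case: leP => // hlt; exfalso; apply: hno; exists th; split => //.
    by rewrite lt_def rth rho0.
  exact: ltW.
(* The linear term integrates to 0 by centering, and [Y ^+ 2 <= 1] bounds the quadratic one. *)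
have inner c x : (\int[mu]_th (rho th * expR (e * Y c th x))%:E <= (m * (1 + 2 * e ^+ 2))%:E)%E.
  have mYx : measurable_fun setT (fun th => Y c th x) by exact: (measurableT_comp (mY c) (measurable_pair2 x)).
  have iY : mu.-integrable setT (EFin \o (fun th => rho th * Y c th x)).
    apply: (le_integrable measurableT _ _ irho).
      by apply/measurable_EFinP; exact: measurable_funM.
    by move=> th _; rewrite /= lee_fin normrM ler_piMr.
  have i1 := integrableZl measurableT (1 + 2 * e ^+ 2) irho.
  have i2 := integrableZl measurableT e iY.
  have i12 := integrableD measurableT i1 i2.
  apply: (@le_trans _ _ (\int[mu]_th ((1 + 2 * e ^+ 2) * rho th + e * (rho th * Y c th x))%:E)%E).
    apply: ge0_le_integral => //.
    - by move=> th _; rewrite lee_fin mulr_ge0 // expR_ge0.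
    - apply/measurable_EFinP; apply: measurable_funM => //; apply: measurableT_comp => //.
      exact: measurable_funM.
    - apply/measurable_EFinP; apply: measurable_funD; apply: measurable_funM => //; exact: measurable_funM.
    move=> th _; rewrite lee_fin.
    have h : `|e * Y c th x| <= 2^-1.
      by rewrite normrM (gtr0_norm e0) (le_trans _ e2) // ler_piMr // ltW.
    have := expR_quadratic h; rewrite exprMn => hq.
    have Y2 : Y c th x ^+ 2 <= 1.
      by rewrite -real_normK ?num_real // exprn_ile1.
    have : expR (e * Y c th x) <= 1 + 2 * e ^+ 2 + e * Y c th x.
      have := ler_wpM2l (sqr_ge0 e) Y2; lra.
    move/(ler_wpM2l (rho0 th)); lra.
  rewrite le_eqVlt; apply/orP; left; apply/eqP.
  transitivity (\int[mu]_th ((1 + 2 * e ^+ 2) * rho th + e * (rho th * Y c th x)))%:E.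
    by rewrite /Rintegral fineK //; apply: integrable_fin_num.
  by rewrite RintegralD // !RintegralZl // centered mulr0 addr0 mulrC.
(* The exponential of a sum factors, so after exchanging the integrals [inner] bounds the average by
   [m * (1 + 2 * e ^+ 2)] times the old potential. *)
have upper : (\int[mu]_th \int[nu]_x (F (th, x))%:E <= (m * ((1 + 2 * e ^+ 2) * B))%:E)%E.
  rewrite [leLHS](@fubini_tonelli _ _ T X R mu nu (EFin \o F) mF' F0') /fubini_G /=.
  have m0 : 0 <= m * (1 + 2 * e ^+ 2) by rewrite mulr_ge0 ?(ltW rho_gt0) // addr_ge0 // mulr_ge0 // sqr_ge0.
  rewrite mulrA EFinM; apply: (@le_trans _ _ ((m * (1 + 2 * e ^+ 2))%:E * potential e S)%E); last first.
    by rewrite lee_wpmul2l ?lee_fin.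
  have mP : measurable_fun setT (fun x => w x * \sum_c expR (e * S c x)).
    apply: measurable_funM => //; apply: measurable_sum => c.
    by apply: measurableT_comp => //; exact: measurable_funM.
  rewrite /potential -ge0_integralZl ?lee_fin //; last 2 first.
  - exact/measurable_EFinP.
  - by move=> x _; rewrite lee_fin mulr_ge0 // sumr_ge0 // => c _; exact: expR_ge0.
  apply: ge0_le_integral => //.
  - by move=> x _; apply: integral_ge0 => th _; exact: F0'.
  - exact: (@measurable_fun_fubini_tonelli_G _ _ T X R mu (EFin \o F) mF' F0').
  - by apply/measurable_EFinP; exact: measurable_funM.
  move=> x _.
  have -> : (\int[mu]_th (F (th, x))%:E =
     \sum_c (w x * expR (e * S c x))%:E * \int[mu]_th (rho th * expR (e * Y c th x))%:E)%E.
    have mYx c : measurable_fun setT (fun th => Y c th x) by exact: (measurableT_comp (mY c) (measurable_pair2 x)).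
    have mE c : measurable_fun setT (fun th => (rho th * expR (e * Y c th x))%:E).
      apply/measurable_EFinP; apply: measurable_funM => //; apply: measurableT_comp => //.
      exact: measurable_funM.
    transitivity (\int[mu]_th \sum_c ((w x * expR (e * S c x))%:E * (rho th * expR (e * Y c th x))%:E))%E.
      apply: eq_integral => th _; rewrite sumEFin /F /= !mulr_sumr; congr (_%:E).
      by apply: eq_bigr => c _; rewrite mulrDr expRD; ring.
    rewrite ge0_integral_sum //; last 2 first.
    - by move=> c; exact: emeasurable_funM.
    - by move=> c th _; rewrite -EFinM lee_fin !mulr_ge0 // expR_ge0.
    apply: eq_bigr => c _; rewrite ge0_integralZl // ?lee_fin ?mulr_ge0 ?expR_ge0 //.
    by move=> th _; rewrite lee_fin mulr_ge0 // expR_ge0.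
  rewrite -EFinM mulrCA !mulr_sumr -sumEFin.
  apply: lee_sum => c _; rewrite (_ : w x * (_ * _) = w x * expR (e * S c x) * (m * (1 + 2 * e ^+ 2))); last ring.
  rewrite [in leRHS]EFinM; apply: lee_wpmul2l; last exact: inner.
  by rewrite lee_fin mulr_ge0 // expR_ge0.
have := le_trans lower upper; rewrite lee_fin ler_pM2l // ler_pM2r // leNgt => /negP; apply.
by rewrite ltrD2l ltr_pM2r ?exprn_gt0 // ltr_nat.
Qed.

Lemma greedy_sampling (N : nat) : (0 < N)%N -> nu.-integrable setT (EFin \o w) ->
  exists th : nat -> T, (forall j, (j < N)%N -> good (th j) /\ 0 < rho (th j)) /\
    (potential (2 * Num.sqrt N%:R)^-1%R (fun c x => \sum_(j < N) Y c (th j) x)%R <=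
     (expR 1 * (#|I|%:R * \int[nu]_x w x + 1))%:E)%E.
Proof.
(* For this [e], [4 * e ^+ 2 = 1 / N], so [N] steps multiply the bound by
   [(1 + 1 / N)^N <= exp 1]. *)
move=> N0 iw; set e := (2 * Num.sqrt N%:R)^-1.
have N1 : 1 <= Num.sqrt N%:R :> R.
  by have : (1 : R) <= N%:R by [rewrite ler1n]; move/ler_wsqrtr; rewrite sqrtr1.
have e0 : 0 < e by rewrite invr_gt0 mulr_gt0 // (lt_le_trans ltr01).
have e2 : e <= 2^-1 by rewrite /e lef_pV2 ?posrE; lra.
(* The added 1 keeps [B] positive even when the weight has mass zero, as [greedy_step] demands. *)
pose B := #|I|%:R * \int[nu]_x w x + 1.
have B0 : 0 < B by rewrite ltr_wpDl // mulr_ge0 // Rintegral_ge0.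
have e4 : 1 + 4 * e ^+ 2 = 1 + N%:R^-1.
  rewrite /e exprVn exprMn sqr_sqrtr ?ler0n // invfM; field.
  by rewrite pnatr_eq0 -lt0n N0.
have start : (potential e (fun _ _ => 0%R) <= B%:E)%E.
  have iwI := integrableZl measurableT (#|I|%:R : R) iw.
  have -> : potential e (fun _ _ => 0%R) = (\int[nu]_x (#|I|%:R * w x))%:E.
    rewrite /Rintegral fineK; last exact: integrable_fin_num iwI.
    apply: eq_integral => x _; congr (_%:E); under eq_bigr do rewrite mulr0 expR0.
    by rewrite sumr_const mulrC.
  by rewrite RintegralZl // lee_fin lerDl.
(* A first call of [greedy_step] serves only to inhabit [T], so that the sequence has values before
   any choice is made. *)
have [th0 _] : exists th : T, True.
  have [||th [_ _ _]] := greedy_step _ B0 _ start; last by exists th.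
  - by rewrite e0.
  - by move=> c; exact: measurable_cst.
have : forall n, exists th : nat -> T, (forall j, (j < n)%N -> good (th j) /\ 0 < rho (th j)) /\
    (potential e (fun c x => \sum_(j < n) Y c (th j) x)%R <= ((1 + N%:R^-1) ^+ n * B)%:E)%E.
  elim=> [|n [th [gth hth]]].
    exists (fun=> th0); split => //; rewrite mul1r; apply: le_trans start.
    by under eq_fun do under eq_fun do rewrite big_ord0.
  have Bn : 0 < (1 + N%:R^-1) ^+ n * B by rewrite mulr_gt0 // exprn_gt0 // ltr_wpDr // invr_ge0.
  have [||th1 [g1 r1 h1]] := greedy_step _ Bn _ hth.
  - by rewrite e0.
  - move=> c; apply: measurable_sum => j.
    exact: (measurableT_comp (mY c) (measurable_pair1 (th j))).
  exists (fun j => if (j < n)%N then th j else th1); split => [j|].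
    by rewrite ltnS leq_eqVlt => /predU1P[->|jn]; [rewrite ltnn|rewrite jn; exact: gth].
  rewrite e4 mulrA -exprS in h1; apply: le_trans h1; rewrite le_eqVlt; apply/orP; left; apply/eqP.
  congr potential; apply/funext => c; apply/funext => x; rewrite big_ord_recr /= ltnn.
  by congr (_ + _); apply: eq_bigr => j _; rewrite ltn_ord.
move=> /(_ N)[th [gth hth]]; exists th; split => //; apply: le_trans hth _.
rewrite lee_fin ler_wpM2r ?(ltW B0) //.
have := expR_ge1Dx (N%:R^-1 : R) => h.
have : (1 + N%:R^-1) ^+ N <= expR (N%:R^-1 : R) ^+ N.
  by rewrite lerXn2r ?nnegrE ?expR_ge0 // addr_ge0 // invr_ge0.
by rewrite -expRM_natl mulfV // pnatr_eq0 -lt0n.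
Qed.

End greedy_sampling.

(** Raise [s / r <= exp (s / r)] to the power [r]. *)
Lemma powR_le_expR {R : realType} (s r : R) : 0 <= s -> 0 < r -> s `^ r <= r `^ r * expR s.
Proof.
move=> s0 r0; have sr0 : 0 <= s / r by rewrite divr_ge0 // ltW.
have {1}-> : s = r * (s / r) by rewrite mulrCA mulfV ?gt_eqF // mulr1.
rewrite powRM ?(ltW r0) // ler_wpM2l ?powR_ge0 //.
have -> : expR s = expR (s / r) `^ r by rewrite -expRM divfK // gt_eqF.
apply: ge0_ler_powR; rewrite ?nnegrE ?expR_ge0 ?(ltW r0) //.
by have := expR_ge1Dx (s / r); lra.
Qed.

(** * From a bounded potential to an L^r error *)

Section sampling_norm.
Context {R : realType} dT (T : measurableType dT) dX (X : measurableType dX).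
Context (mu : {sigma_finite_measure set T -> \bar R}) (nu : {sigma_finite_measure set X -> \bar R}).
Variables (J : finType) (F : J -> T -> X -> R[i]) (rho : T -> R) (Omega : set X) (good : set T).
Hypothesis mF : forall c, cmeas (fun p : T * X => F c p.1 p.2).
Hypotheses (rho0 : forall th, 0 <= rho th) (irho : mu.-integrable setT (EFin \o rho)).
Hypothesis Frho : forall c th x, modulus (F c th x) <= rho th * \1_Omega x.
Hypotheses (mOmega : measurable Omega) (Omega_fin : (nu Omega < +oo)%E).
Hypothesis good_ae : {ae mu, forall th, good th}.
Variables (th_ : T) (r : R).
Hypothesis r_gt0 : 0 < r.

Let m := \int[mu]_th rho th.
Let G c x := cintegral mu setT (fun th => F c th x).
Let part (b : bool) (z : R[i]) : R := if b then complex.Re z else complex.Im z.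
Let sgn (s : bool) : R := if s then 1 else -1.
(** Importance sampling: under the probability density [rho / m], the mean of [m / rho * F] is [G].
    Real and imaginary parts enter with both signs because the potential bounds sums from one side
    only; [3 * m] adds [m] for the sample and [2 * m] for the mean. *)
Let Y (q : J * (bool * bool)) th x : R :=
  (3 * m)^-1 * (sgn q.2.2 * part q.2.1 ((m / rho th)%:C%C * F q.1 th x - G q.1 x)).

Let mrho : measurable_fun setT rho.
Proof. by case/integrableP: irho => /measurable_EFinP. Qed.

Let m0 : 0 <= m.
Proof. exact: Rintegral_ge0. Qed.

Let F_le_rho c th x : modulus (F c th x) <= rho th.
Proof.
apply: (le_trans (Frho c th x)); rewrite indicE ler_piMr //.
by case: (_ \in _).
Qed.

Let iF c x : cintegrable mu setT (fun th => F c th x).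
Proof.
by apply: (le_cintegrable (g := rho)) => //; exact: (cmeas_comp (mF c) (measurable_pair2 x)).
Qed.

Let G_le c x : modulus (G c x) <= 2 * m.
Proof. by apply: le_modulus_cintegral => //; exact: cintegrable_cmeas. Qed.

Let iOmega : nu.-integrable setT (EFin \o (\1_Omega : X -> R)).
Proof.
have := measurable_indic (R := R) (D := setT) mOmega => mI.
apply/integrableP; split; first exact/measurable_EFinP.
under eq_integral do rewrite /= ger0_norm ?ler0n //.
by rewrite integral_indic // setIT.
Qed.

(** Measurability of the mean comes out of Fubini, with the indicator of the finite-measure set
    [Omega] as integrable bound in [x]. *)
Lemma cmeas_mean c : cmeas (fun x => cintegral mu setT (fun th => F c th x)).
Proof.
apply: cintegrable_cmeas.
apply: (cintegrable_fubini1 (m1 := nu) (m2 := mu) (f := fun x th => F c th x) _ iOmega irho).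
  exact: cmeas_comp (mF c) (@measurable_swap _ _ _ _).
by move=> x th; rewrite mulrC.
Qed.

Lemma sampling_norm (N : nat) : (0 < N)%N ->
  exists (th : nat -> T) (a : nat -> R),
    (forall j, (j < N)%N -> a j != 0 -> good (th j)) /\
    forall c, (\int[nu]_x (modulus (G c x - \sum_(j < N) (a j)%:C%C * F c (th j) x) `^ r)%:E <=
      ((12 * r * m / Num.sqrt N%:R) `^ r *
       (expR 1 * (#|{: J * (bool * bool)}|%:R * \int[nu]_x \1_Omega x + 1)))%:E)%E.
Proof.
move=> N0; have [m_eq0|m_neq0] := eqVneq m 0.
  (* Without mass all means vanish and zero coefficients do; [th_] only fills the positions. *)
  exists (fun=> th_), (fun=> 0); split => [j _|c]; first by rewrite eqxx.
  under eq_integral => x _.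
    rewrite big1 => [|j _]; last by rewrite mul0r.
    have G0 : modulus (G c x) = 0.
      by apply/eqP; rewrite eq_le modulus_ge0 andbT (le_trans (G_le c x)) // m_eq0 mulr0.
    rewrite subr0 G0 powR0 ?gt_eqF //.
    over.
  rewrite integral0 lee_fin mulr_ge0 ?powR_ge0 // mulr_ge0 ?expR_ge0 // addr_ge0 // mulr_ge0 //.
  exact: Rintegral_ge0.
have m_gt0 : 0 < m by rewrite lt_def m_neq0.
have mY q : measurable_fun setT (fun p : T * X => Y q p.1 p.2).
  have mV : measurable_fun setT (fun p : T * X => m / rho p.1).
    apply: measurable_funM => //.
    under eq_fun do rewrite -powR_inv1 //.
    exact: (measurableT_comp (measurable_powR (-1)) (measurableT_comp mrho measurable_fst)).
  have mD : cmeas (fun p : T * X => (m / rho p.1)%:C%C * F q.1 p.1 p.2 - G q.1 p.2).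
    apply: cmeasB; first by apply: cmeasM => //; exact: cmeas_real.
    exact: cmeas_comp (cmeas_mean q.1) measurable_snd.
  apply: measurable_funM => //; apply: measurable_funM => //.
  by rewrite /part; case: q.2.1; [exact: mD.1|exact: mD.2].
have XF c th x : modulus ((m / rho th)%:C%C * F c th x) <= m.
  rewrite modulusM modulus_real ger0_norm ?divr_ge0 //.
  (* Where [rho] vanishes the quotient [m / rho] is 0 by convention, consistently with [F] vanishing
     there. *)
  have [->|rth] := eqVneq (rho th) 0; first by rewrite invr0 mulr0 mul0r.
  rewrite mulrAC ler_pdivrMr ?lt_def ?rth ?rho0 // ler_wpM2l //.
have m30 : 0 < (3 * m)^-1 by rewrite invr_gt0 mulr_gt0.
have partM b z : `|part b z| <= modulus z.
  by case: b; [exact: modulus_Re|exact: modulus_Im].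
have sgn1 s : `|sgn s| = 1 by case: s; rewrite /sgn ?normrN normr1.
have Y1 q th x : `|Y q th x| <= 1.
  rewrite /Y normrM (gtr0_norm m30) normrM sgn1 mul1r -ler_pdivlMl // mulr1 invrK.
  apply: le_trans (partM _ _) _; apply: le_trans (modulusD _ _) _; rewrite modulusN.
  have := XF q.1 th x; have := G_le q.1 x; lra.
have partD b z z' : part b (z + z') = part b z + part b z'.
  by case: b; rewrite /part ?cReD ?cImD.
have partN b z : part b (- z) = - part b z by case: b; rewrite /part ?cReN ?cImN.
have partZ b (a : R) z : part b (a%:C%C * z) = a * part b z.
  by case: b; rewrite /part ?cReM ?cImM /= mul0r ?subr0 ?addr0.
have centered q x : \int[mu]_th (rho th * Y q th x) = 0.
  have E th : rho th * Y q th x = (3 * m)^-1 * sgn q.2.2 *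
    (m * part q.2.1 (F q.1 th x) - part q.2.1 (G q.1 x) * rho th).
    rewrite /Y partD partN partZ.
    have [r0|rth] := eqVneq (rho th) 0; last by field; rewrite ?rth ?m_neq0.
    have F0 : F q.1 th x = 0.
      by apply: modulus_eq0; apply/eqP; rewrite eq_le modulus_ge0 andbT -r0.
    by rewrite r0 F0 (_ : part _ 0 = 0) ?mulr0 ?mul0r ?subr0 ?mulr0 //; case: q.2.1.
  have ip : mu.-integrable setT (EFin \o (fun th => part q.2.1 (F q.1 th x))).
    by have [i1 i2] := iF q.1 x; rewrite /part; case: q.2.1.
  have pG : part q.2.1 (G q.1 x) = \int[mu]_th part q.2.1 (F q.1 th x) by rewrite /part; case: q.2.1.
  under eq_Rintegral do rewrite E.
  have i1 := integrableZl measurableT m ip.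
  have i2 := integrableZl measurableT (part q.2.1 (G q.1 x)) irho.
  have i12 := integrableB measurableT i1 i2.
  rewrite RintegralZl // RintegralB // !RintegralZl // -pG -/m [X in _ * (_ - X)]mulrC subrr mulr0 //.
have mI : measurable_fun setT (\1_Omega : X -> R) by exact: measurable_indic.
have I0 x : 0 <= (\1_Omega x : R) by rewrite indicE.
have [th [gth hth]] := greedy_sampling (nu := nu) mY Y1 rho0 irho m_gt0 centered
  I0 mI good_ae N0 iOmega.
(* The empirical mean: equal shares [1 / N] of the importance weights [m / rho]. *)
exists th, (fun j => m / (N%:R * rho (th j))); split => [j jN _|c]; first by have [] := gth j jN.
pose e : R := (2 * Num.sqrt N%:R)^-1.
(* [e * (3 * m)^-1 * N = sqrt N / (6 * m)]: up to sign, the exponents of the potential are [kap]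
   times the components of the error [D]. *)
pose kap := Num.sqrt N%:R / (6 * m).
have sN : 0 < Num.sqrt N%:R :> R by rewrite sqrtr_gt0 ltr0n.
have sN2 : Num.sqrt N%:R * Num.sqrt N%:R = N%:R :> R by rewrite -expr2 sqr_sqrtr.
have kap0 : 0 < kap by rewrite divr_gt0 // mulr_gt0.
pose D x := G c x - \sum_(j < N) (m / (N%:R * rho (th j)))%:C%C * F c (th j) x.
have SY b s x : e * \sum_(j < N) Y (c, (b, s)) (th j) x = - (sgn s * (kap * part b (D x))).
  pose S := \sum_(j < N) m / rho (th j) * part b (F c (th j) x).
  have partS (I : finType) (z : I -> R[i]) : part b (\sum_i z i) = \sum_i part b (z i).
    by apply: big_morph; [exact: partD|case: (b)].
  have -> : part b (D x) = part b (G c x) - S / N%:R.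
    rewrite /D partD partN partS /S mulr_suml; congr (_ - _); apply: eq_bigr => j _.
    by rewrite partZ invfM; ring.
  have -> : \sum_(j < N) Y (c, (b, s)) (th j) x = (3 * m)^-1 * (sgn s * (S - N%:R * part b (G c x))).
    rewrite /Y -mulr_sumr -mulr_sumr; congr (_ * (_ * _)).
    under eq_bigr do rewrite partD partN partZ.
    by rewrite big_split /= sumr_const card_ord mulr_natl mulNrn.
  have alg (q mm sg s0 g0 : R) : q != 0 -> mm != 0 ->
      (2 * q)^-1 * ((3 * mm)^-1 * (sg * (s0 - q * q * g0))) = - (sg * (q / (6 * mm) * (g0 - s0 / (q * q)))).
    by move=> q0 mm0; field; rewrite q0 mm0.
  by have := alg (Num.sqrt N%:R) m (sgn s) S (part b (G c x)); rewrite sN2; apply; rewrite // gt_eqF.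
(* The real or the imaginary part carries at least half of [|D|]; with the right sign, its
   exponential is one term of the sum, and [powR_le_expR] passes to the power [r]. The constant is
   [2 / kap * r = 12 * r * m / sqrt N]. *)
have pt x : modulus (D x) `^ r <= (12 * r * m / Num.sqrt N%:R) `^ r *
    (\1_Omega x * \sum_q expR (e * \sum_(j < N) Y q (th j) x)).
  have [xO|xO] := boolP (x \in Omega); last first.
    have Fx0 c' th' : F c' th' x = 0.
      apply: modulus_eq0; apply/eqP; rewrite eq_le modulus_ge0 andbT.
      by apply: le_trans (Frho c' th' x) _; rewrite indicE (negbTE xO) mulr0.
    have -> : D x = 0.
      rewrite /D big1 => [|j _]; last by rewrite Fx0 mulr0.
      by rewrite subr0 /G; under eq_cintegral do rewrite Fx0; rewrite cintegral0.
    by rewrite modulus0 powR0 ?gt_eqF // mulr_ge0 ?powR_ge0 // indicE (negbTE xO) mul0r.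
  rewrite indicE xO mul1r.
  have [b hb] : exists b, modulus (D x) <= 2 * `|part b (D x)|.
    have := modulus_le (D x); have [h1|h1] := leP `|complex.Re (D x)| `|complex.Im (D x)|.
      by exists false; rewrite /part; lra.
    by exists true; rewrite /part; lra.
  have [s hs] : exists s, - (sgn s * part b (D x)) = `|part b (D x)|.
    have [h|h] := leP 0 (part b (D x)).
      by exists false; rewrite /sgn mulN1r opprK ger0_norm.
    by exists true; rewrite /sgn mul1r ltr0_norm.
  have le1 : expR (kap * `|part b (D x)|) <= \sum_q expR (e * \sum_(j < N) Y q (th j) x).
    rewrite (bigD1 (c, (b, s))) //= SY -hs mulrN mulrCA lerDl.
    by apply: sumr_ge0 => q _; exact: expR_ge0.
  have k2 : 0 <= 2 / kap by rewrite divr_ge0 // ltW.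
  apply: (@le_trans _ _ ((2 / kap * (kap * `|part b (D x)|)) `^ r)).
    have kp : 2 / kap * (kap * `|part b (D x)|) = 2 * `|part b (D x)|.
      by rewrite mulrA divfK ?gt_eqF.
    apply: ge0_ler_powR; rewrite ?nnegrE ?modulus_ge0 ?(ltW r_gt0) // kp //.
  rewrite (powRM _ k2 (mulr_ge0 (ltW kap0) (normr_ge0 _))).
  have -> : 12 * r * m / Num.sqrt N%:R = 2 / kap * r.
    by rewrite /kap; field; rewrite m_neq0 gt_eqF.
  rewrite (powRM _ k2 (ltW r_gt0)) -mulrA ler_wpM2l ?powR_ge0 //.
  apply: le_trans (powR_le_expR _ r_gt0) _; first exact: mulr_ge0 (ltW kap0) (normr_ge0 _).
  by rewrite ler_wpM2l ?powR_ge0.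
rewrite EFinM; apply: le_trans (lee_wpmul2l _ hth); last by rewrite lee_fin powR_ge0.
have mth q j : measurable_fun setT (fun x => Y q (th j) x).
  exact: (measurableT_comp (mY q) (measurable_pair1 (th j))).
have mexp : measurable_fun setT (fun x => \1_Omega x * \sum_q expR (e * \sum_(j < N) Y q (th j) x)).
  apply: measurable_funM; first exact: measurable_indic.
  apply: measurable_sum => q; apply: measurableT_comp => //; apply: measurable_funM => //.
  by apply: measurable_sum => j.
rewrite /potential -ge0_integralZl ?lee_fin ?powR_ge0 //; last 2 first.
- exact/measurable_EFinP.
- by move=> x _; rewrite lee_fin mulr_ge0 // sumr_ge0 // => q _; exact: expR_ge0.
apply: ge0_le_integral => //.
- by move=> x _; rewrite lee_fin powR_ge0.
- apply/measurable_EFinP; apply: (measurableT_comp (measurable_powR r)).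
  apply: measurable_modulus; apply: cmeasB; first exact: cmeas_mean.
  apply: cmeas_sum => j; apply: cmeasM; first exact: cmeas_cst.
  exact: cmeas_comp (mF c) (measurable_pair1 (th j)).
- by apply/measurable_EFinP; exact: measurable_funM.
by move=> x _; rewrite -EFinM lee_fin; exact: pt.
Qed.

End sampling_norm.

(** * Approximation of Barron functions *)

Section assembly_lemmas.
Context {R : realType} {d : nat}.
Local Notation V := 'rV[R]_d.
Implicit Types (psi f : V -> R[i]) (Omega U : set V).

Lemma foldr_partial_eq0 psi U s : open U -> (forall x, U x -> psi x = 0) ->
  forall x, U x -> foldr partial psi s x = 0.
Proof.
move=> oU psi0 x Ux; rewrite foldr_partialE.
have h (f : V -> R) : (forall x, U x -> f x = 0) -> forall x, U x -> foldr rpartial f s x = 0.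
  by move=> f0; elim: s => // i s IHs; exact: rpartial_eq0.
by rewrite !h // => y Uy /=; rewrite psi0.
Qed.

Lemma cintegral_support Omega f : (forall x, ~ Omega x -> f x = 0) ->
  cintegral (leb d) Omega f = cintegral (leb d) setT f.
Proof.
move=> f0; have h (g : V -> R) : (forall x, ~ Omega x -> g x = 0) ->
    \int[leb d]_(x in Omega) g x = \int[leb d]_x g x.
  move=> g0; rewrite /Rintegral [in LHS]integral_mkcond; congr fine.
  apply: eq_integral => x _; rewrite patchE; case: ifPn => //.
  by rewrite notin_setE => /g0 ->.
by rewrite /cintegral !h // => x Ox; rewrite f0.
Qed.

Lemma bounded_loc_integrable Omega f (M : R) : cmeas f -> (forall x, modulus (f x) <= M) ->
  loc_integrable Omega f.
Proof.
move=> [m1 m2] fM K cK _.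
have mK : measurable K.
  by apply: closed_measurable_rV; apply: compact_closed => //; exact: norm_hausdorff.
have [r [_ /(_ (r + 1)) Kr]] := compact_bounded cK.
have Kfin : (leb d K < +oo)%E.
  by apply: (leb_bounded_lty (M := r + 1)) => // x Kx; apply: Kr => //; rewrite ltrDl.
have h (g : V -> R) : measurable_fun setT g -> (forall x, `|g x| <= M) -> (leb d).-integrable K (EFin \o g).
  move=> mg gM; apply/integrableP; split; first by apply/measurable_EFinP; exact: measurable_funTS.
  apply: (@le_lt_trans _ _ (\int[leb d]_(x in K) M%:E)%E).
    apply: ge0_le_integral => //.
    - by apply/measurable_EFinP; apply: measurable_funTS; exact: measurableT_comp.
    - by move=> x _; rewrite lee_fin.
  rewrite integral_cst // lte_mul_pinfty // lee_fin; exact: le_trans (gM 0).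
by split; apply: h => // x; apply: le_trans (fM x); [exact: modulus_Re|exact: modulus_Im].
Qed.

Lemma open_sumset Omega : open Omega -> open (sumset Omega Omega).
Proof.
rewrite openE => oO z [x Ox [y Oy <-]].
have /nbhs_ballP[e e0 he] := oO x Ox.
apply/nbhs_ballP; exists e => // w; rewrite mx_norm_ball /ball_ /= => xyw.
exists (w - y); last by exists y => //; rewrite subrK.
apply: he; rewrite mx_norm_ball /ball_ /=.
by rewrite opprB addrA.
Qed.

Lemma norm_le_enorm (x : V) : `|x| <= enorm x.
Proof.
apply: rV_norm_le => [|i]; first exact: sqrtr_ge0.
rewrite -sqrtr_sqr ler_wsqrtr // /dotp (bigD1 i) //= expr2 lerDl.
by apply: sumr_ge0 => j _; rewrite -expr2 sqr_ge0.
Qed.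

End assembly_lemmas.

Lemma ae_cintegrable {R : realType} dT (T : measurableType dT) (mu : {measure set T -> \bar R})
  (f g : T -> R[i]) : cmeas f -> cintegrable mu setT g -> {ae mu, forall x, f x = g x} ->
  cintegrable mu setT f.
Proof.
move=> [f1 f2] [i1 i2] fg.
have h (a b : T -> R) : measurable_fun setT a -> mu.-integrable setT (EFin \o b) ->
    {ae mu, forall x, a x = b x} -> mu.-integrable setT (EFin \o a).
  move=> ma /integrableP[mb ib] ab; apply/integrableP; split; first exact/measurable_EFinP.
  apply: le_lt_trans ib; rewrite le_eqVlt; apply/orP; left; apply/eqP.
  apply: ae_eq_integral => //.
  - by apply: measurableT_comp => //; exact/measurable_EFinP.
  - exact: measurableT_comp.
  - by apply: filterS ab => x /= ->.
by split; [apply: h i1 _|apply: h i2 _] => //; apply: filterS fg => x /= ->.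
Qed.

(** * The Sobolev error of the sampled approximation *)

Section barron_synthesis.
Context {R : realType} {d : nat}.
Local Notation V := 'rV[R]_d.
Local Notation Theta := (V * (measurableTypeR R * V))%type.
Local Notation mTheta := (theta_measure (R := R) (d := d)).
Variables (n k : nat) (Omega : set V) (sigma varphi : R -> R[i]) (phi : V -> R[i]).
Variables (t tau r p : R) (zeta0 : V) (c0 kap : R[i]).
Variables (H : nat -> R -> R[i]) (M : nat -> R).
Hypotheses (M0 : forall j, 0 <= M j) (mH : forall j, cmeas (H j)).
Hypothesis HM : forall j x, modulus (H j x) <= M j.
Hypothesis msigma : cmeas sigma.
Hypothesis Hsigma : {ae @lebesgue_measure R, forall s, sigma s = H 0%N s}.
Hypothesis Hweak : forall j (a : 'I_d -> R) b i psi, (j < k)%N -> ctest psi ->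
  cintegral (leb d) setT (fun x => H j (\sum_j a j * x 0 j + b) * partial i psi x) =
  - ((a i)%:C%C * cintegral (leb d) setT (fun x => H j.+1 (\sum_j a j * x 0 j + b) * psi x)).
Hypotheses (varphiS : schwartz (on_line varphi)) (phiS : schwartz phi).
Hypotheses (tau_neq0 : tau != 0) (r_ge0 : 0 <= r) (le_nk : (n <= k)%N) (p_gt0 : 0 < p).
Hypotheses (oOmega : open Omega) (Omega_r : forall x, Omega x -> `|x| <= r).

Local Notation J := {ffun 'I_d -> 'I_n.+1}.
Local Notation feat := (feature H varphi phi t tau r zeta0).
Local Notation dens := (density t tau r zeta0 c0).

Let order (al : J) : nat := (\sum_i al i)%N.
Let word (al : J) : seq 'I_d := seq_of_multi (fun i => al i).

Let mOmega : measurable Omega := open_measurable_rV oOmega.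

(** Indices of order above [n] get the zero function, so that the whole finite type [J] can index
    the sampling; the indicator confines the error to [Omega]. *)
Let F g (al : J) (th : Theta) (x : V) : R[i] :=
  if (order al <= n)%N then (\1_Omega x)%:C%C * (dens g th * feat (word al) th x) else 0.

Lemma feature_wt_ge0 N (g : V -> R[i]) th : 0 <= feature_wt N g th.
Proof.
rewrite /feature_wt !mulr_ge0 ?modulus_ge0 ?exprn_ge0 ?addr_ge0 ?invr_ge0 ?addr_ge0 ?sqr_ge0 //.
exact: ltW (wt_gt0 _).
Qed.

(** The exponent [n.+1] accounts for at most [n] derivatives and the Jacobian, so one weight
    dominates all orders and can serve as sampling density. *)
Lemma feature_family_bound : exists2 C, 0 <= C & forall g al th x,
  modulus (F g al th x) <= C * feature_wt n.+1 g th * \1_Omega x.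
Proof.
have /choice[C CP] : forall al : J, exists C, 0 <= C /\ forall g th x, `|x| <= r ->
    modulus (dens g th * feat (word al) th x) <= C * feature_wt (size (word al)).+1 g th.
  by move=> al; have [C C0 h] := density_feature_bound t zeta0 M0 HM varphiS phiS tau_neq0
      r_ge0 c0 (word al); exists C.
have C0 al : 0 <= C al by have [] := CP al.
exists (\sum_al C al); first exact: sumr_ge0.
move=> g al th x.
have w0 := feature_wt_ge0 n.+1 g th.
rewrite /F indicE; have [xO|_] := boolP (x \in Omega); last first.
  by case: ifP => _; rewrite ?mul0r modulus0 mulr0.
rewrite mulr1; case: ifPn => [aln|_]; last by rewrite modulus0 mulr_ge0 // sumr_ge0.
rewrite mul1r; rewrite inE in xO; apply: le_trans ((CP al).2 g th x (Omega_r xO)) _.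
apply: ler_pM => //.
- exact: feature_wt_ge0.
- by rewrite (bigD1 al) //= lerDl sumr_ge0.
rewrite /feature_wt ler_wpM2r //.
  by rewrite mulr_ge0 ?invr_ge0 ?addr_ge0 ?sqr_ge0 // ltW // wt_gt0.
rewrite ler_wpM2l ?modulus_ge0 // ler_weXn2l ?lerDl // ltnS.
by rewrite size_seq_of_multi.
Qed.

Hypothesis c0E : c0 * cintegral (@lebesgue_measure R) setT
  (fun s => H 0%N s * varphi (s - t) * cexp (- (2 * pi * s * tau))) * invfourier phi zeta0 = kap.

Section function.
Variables (u : @functional R d) (g : V -> R[i]).
Hypothesis mg : cmeas g.
Hypothesis ig : (leb d).-integrable setT (EFin \o (fun xi => modulus (g xi) * (1 + `|xi|) ^+ n.+1)).
Hypothesis Hu : forall q, ctest q -> u q = kap * cintegral (leb d) setT (fun xi => g xi * invfourier q xi).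

Let G al x := cintegral mTheta setT (fun th => F g al th x).

Lemma feature_family_cmeas al d0 (Z : measurableType d0) (th : Z -> Theta) (x : Z -> V) :
  measurable_fun setT th -> measurable_fun setT x -> cmeas (fun z => F g al (th z) (x z)).
Proof.
move=> mth mx; rewrite /F; case: (order al <= n)%N; last exact: cmeas_cst.
apply: cmeasM.
  apply: cmeas_real; apply: (measurableT_comp (f := \1_Omega : V -> R)) => //.
apply: cmeasM; first exact: density_cmeas.
exact: (feature_cmeas t tau r zeta0 mH varphiS phiS (word al) mth mx).
Qed.

Lemma integrable_weight N : (N <= n.+1)%N ->
  (leb d).-integrable setT (EFin \o (fun xi => modulus (g xi) * (1 + `|xi|) ^+ N)).
Proof.
move=> Nn; apply: (le_integrable measurableT _ _ ig).
  apply/measurable_EFinP; apply: measurable_funM; first exact: measurable_modulus.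
  apply: measurable_funX; apply: measurable_funD => //.
  by apply: continuous_measurable_rV => x; exact: norm_continuous.
move=> xi _; rewrite /= lee_fin !ger0_norm ?mulr_ge0 ?modulus_ge0 ?exprn_ge0 ?addr_ge0 //.
by rewrite ler_wpM2l ?modulus_ge0 // ler_weXn2l // lerDl.
Qed.

Lemma integrable_family_weight (C : R) :
  mTheta.-integrable setT (EFin \o (fun th => C * feature_wt n.+1 g th)).
Proof.
exact: (integrableZl measurableT C (integrable_feature_wt ig)).
Qed.

(** For a single parameter the Leibniz expansion needs at most [order al <= n <= k] weak derivatives
    of the activation; [psi] vanishes off [Omega], so the indicator in [F] is harmless. *)
Lemma feature_ibp al psi th : (order al <= n)%N -> test_function Omega psi ->
  cintegrable (leb d) setT (fun x => dens g th * feat [::] th x * mpartial (fun i => al i) psi x) /\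
  cintegral (leb d) setT (fun x => dens g th * feat [::] th x * mpartial (fun i => al i) psi x) =
  (-1) ^+ order al * cintegral (leb d) setT (fun x => F g al th x * psi x).
Proof.
move=> aln tpsi; have ct := test_function_ctest tpsi.
have psi0 x : ~ Omega x -> psi x = 0.
  by move=> nOx; have [_ [K [_ KO K0]]] := tpsi; apply: K0 => /KO.
have sw : size (word al) = order al := size_seq_of_multi _.
have cq : ctest (foldr partial psi (word al)) := ctest_foldr _ ct.
rewrite mpartial_seq.
have iat s q := cintegrable_atom_deriv t M0 mH HM varphiS phiS (slope tau zeta0 th.1)
  (width t tau r zeta0 th.1 * th.2.1) th.2.2 s 0 0 [::] (psi := q).
have ibp := atom_deriv_ibp t M0 mH HM Hweak varphiS phiS (slope tau zeta0 th.1)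
  (width t tau r zeta0 th.1 * th.2.1) th.2.2 (s := word al) (j := 0) 0 [::] (psi := psi).
have dA (z q : V -> R[i]) : (fun x => dens g th * z x * q x) = (fun x => dens g th * (z x * q x)).
  by apply/funext => x; rewrite mulrA.
split; first by rewrite dA; apply: cintegrableZ; exact: (iat [::] _ cq).
transitivity (dens g th * cintegral (leb d) setT (fun x => feat [::] th x * foldr partial psi (word al) x)).
  by rewrite dA cintegralZ //; exact: (iat [::] _ cq).
rewrite [X in _ * X]ibp ?sw ?(leq_trans aln) // mulrCA; congr (_ * _).
rewrite -cintegralZ; last exact: (iat _ _ ct).
apply: eq_cintegral => x; rewrite /F aln indicE mulrA.
by have [_|] := boolP (x \in Omega); rewrite ?mul1r // notin_setE => /psi0 ->; rewrite !mulr0.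
Qed.

(** On [Omega] the weak derivative of [u] of index [al] is the mean [G al] of differentiated
    features. Derivatives of the target are thus means over the same parameters from which the
    approximant is sampled, and the Sobolev error becomes a sampling error. *)
Lemma weak_derivative_synthesis al psi : (order al <= n)%N -> test_function Omega psi ->
  u (mpartial (fun i => al i) psi) =
  (-1) ^+ order al * cintegral (leb d) setT (fun x => G al x * psi x).
Proof.
move=> aln tpsi; have ct := test_function_ctest tpsi.
have psi0 x : ~ Omega x -> psi x = 0.
  by move=> nOx; have [_ [K [_ KO K0]]] := tpsi; apply: K0 => /KO.
have sw : size (word al) = order al := size_seq_of_multi _.
have cq : ctest (foldr partial psi (word al)) := ctest_foldr _ ct.
have q0 x : r < `|x| -> foldr partial psi (word al) x = 0.
  apply: (foldr_partial_eq0 (U := [set x | r < `|x|])); first exact: open_norm_gt.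
  by move=> z /= rz; apply: psi0 => /Omega_r; rewrite leNgt rz.
rewrite mpartial_seq (Hu cq) -c0E.
rewrite -(synthesis t zeta0 M0 mH HM varphiS phiS tau_neq0 r_ge0 c0 mg (integrable_weight _) cq q0) //.
have [C C0 hC] := feature_family_bound.
transitivity (cintegral mTheta setT (fun th => (-1) ^+ order al *
    cintegral (leb d) setT (fun x => F g al th x * psi x))).
  by apply: eq_cintegral => th; rewrite -(feature_ibp th aln tpsi).2 mpartial_seq.
have bF1 th x : modulus (F g al th x) <= C * feature_wt n.+1 g th.
  apply: (le_trans (hC g al th x)); rewrite indicE.
  by case: (_ \in _); rewrite ?mulr1 // mulr0 mulr_ge0 // feature_wt_ge0.
have bF th x : modulus (F g al th x * psi x) <= C * feature_wt n.+1 g th * modulus (psi x).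
  by rewrite modulusM ler_wpM2r ?modulus_ge0.
have mFp : cmeas (fun z : Theta * V => F g al z.1 z.2 * psi z.2).
  apply: cmeasM; first exact: (feature_family_cmeas al measurable_fst measurable_snd).
  exact: cmeas_comp (ctest_cmeas ct) measurable_snd.
have iw := integrable_family_weight C.
have ip := integrable_modulus (ctest_cintegrable ct).
rewrite cintegralZ; last exact: (cintegrable_fubini1 mFp iw ip bF).
congr (_ * _); rewrite (cFubini mFp iw ip bF); apply: eq_cintegral => x.
rewrite cintegralZr //; apply: (le_cintegrable (g := fun th => C * feature_wt n.+1 g th)) => //.
  exact: (feature_family_cmeas al (@measurable_id _ _ setT) (measurable_cst x)).
Qed.

End function.

Let window_mass : R := \int[window_measure (R := R) (d := d)]_q theta_wt q.

Lemma Rintegral_feature_wt g : (leb d).-integrable setT (EFin \o (fun xi => modulus (g xi) * (1 + `|xi|) ^+ n.+1)) ->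
  \int[mTheta]_th feature_wt n.+1 g th =
  window_mass * \int[leb d]_xi (modulus (g xi) * (1 + `|xi|) ^+ n.+1).
Proof.
move=> ig; have iF := integrable_feature_wt ig.
rewrite -[LHS]/(\int[(leb d \x window_measure (R := R) (d := d))%E]_th feature_wt n.+1 g th).
rewrite -(Rintegral12 iF).2 -RintegralZl //; apply: eq_Rintegral => xi _.
rewrite mulrC -RintegralZl //; exact: integrable_theta_wt.
Qed.

Let dict := stft_dictionary sigma varphi phi t tau.

Let atom_of (th : Theta) : V -> R[i] := fun x =>
  sigma (dotp (th.1 + zeta0) x / tau + width t tau r zeta0 th.1 * th.2.1) *
  varphi (dotp (th.1 + zeta0) x / tau + width t tau r zeta0 th.1 * th.2.1 - t) *
  phi (x - th.2.2).

(** Dictionary elements use [sigma], features its bounded version [H 0]; at good parameters both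
    define the same distribution. *)
Let good := [set th : Theta | {ae leb d, forall x, atom_of th x = feat [::] th x}].

Lemma ae_good : {ae mTheta, forall th, good th}.
Proof.
have := ae_ridge_eq t tau zeta0 r_ge0 Hsigma.
apply: filterS => th; apply: filterS => x.
have E : \sum_i slope tau zeta0 th.1 i * x 0 i = dotp (th.1 + zeta0) x / tau.
  rewrite /dotp mulr_suml; apply: eq_bigr => i _.
  by rewrite /slope mxE mulrAC.
rewrite /atom_of /feature /= /atom /envelope /= /on_line mxE E scale1r addrA => ->.
by rewrite mulrA.
Qed.

(** [K] comes before [u], [g] and [N]: in the bound of [sampling_norm] only the mass of [rho]
    depends on [g], and it factors into the window mass and the weighted integral of [g]. *)
Lemma barron_sampling : exists2 K, 0 <= K & forall (u : @functional R d) (g : V -> R[i]) (N : nat), cmeas g ->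
  (leb d).-integrable setT (EFin \o (fun xi => modulus (g xi) * (1 + `|xi|) ^+ n.+1)) ->
  (forall q, ctest q -> u q = kap * cintegral (leb d) setT (fun xi => g xi * invfourier q xi)) ->
  (0 < N)%N ->
  (approx_error n p Omega u (span_N N dict) <=
    (K * (\int[leb d]_xi (modulus (g xi) * (1 + `|xi|) ^+ n.+1)) / Num.sqrt N%:R)%:E)%E.
Proof.
have [C C0 hC] := feature_family_bound.
have Ofin : (leb d Omega < +oo)%E by exact: leb_bounded_lty mOmega Omega_r.
have W0 : 0 <= window_mass.
  by apply: Rintegral_ge0 => q _; rewrite mulr_ge0 ?invr_ge0 ?addr_ge0 ?sqr_ge0 // ltW // wt_gt0.
pose B := expR 1 * (#|{: J * (bool * bool)}|%:R * \int[leb d]_x \1_Omega x + 1) : R.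
have B0 : 0 <= B.
  by rewrite mulr_ge0 ?expR_ge0 // addr_ge0 // mulr_ge0 // Rintegral_ge0 // => x _; rewrite indicE.
(* The constant of [sampling_norm] at exponent [p], with the [p]-th root of the sum over all
   multi-indices. *)
pose K := 12 * p * C * window_mass * (#|J|%:R * B) `^ p^-1.
exists K; first by rewrite !mulr_ge0 ?powR_ge0 // ltW.
move=> u g N mg ig Hu N0.
pose rho th := C * feature_wt n.+1 g th.
have rho0 th : 0 <= rho th by rewrite mulr_ge0 // feature_wt_ge0.
have irho : mTheta.-integrable setT (EFin \o rho) by exact: integrable_family_weight.
have [th [a [ga hDa]]] := sampling_norm (nu := leb d)
  (fun al => feature_family_cmeas mg al measurable_fst measurable_snd) rho0 irho
  (hC g) mOmega Ofin ae_good (0, (0, 0)) p_gt0 N0.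
pose G al x := cintegral mTheta setT (fun th => F g al th x).
pose h (al : J) x := G al x - \sum_(j < N) (a j)%:C%C * F g al (th j) x.
(* The approximant consists of genuine atoms, whereas its error [h] is written with features; [good]
   reconciles the two. *)
pose fN x := \sum_(j < N) (a j)%:C%C * dens g (th j) * atom_of (th j) x.
have span_fN : span_N N dict fN.
  exists (fun j => (a j)%:C%C * dens g (th j)), (fun j => atom_of (th j)); split => // j.
  by exists (th j).2.2, ((th j).1 + zeta0), (width t tau r zeta0 (th j).1 * (th j).2.1).
have mG al : cmeas (G al).
  exact: (cmeas_mean (nu := leb d) (fun al => feature_family_cmeas mg al measurable_fst measurable_snd)
      irho (hC g) mOmega Ofin al).
have FR al th' x : modulus (F g al th' x) <= rho th'.
  apply: (le_trans (hC g al th' x)); rewrite indicE.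
  by case: (_ \in _); rewrite ?mulr1 // mulr0.
have matom th' : cmeas (atom_of th').
  have ml : measurable_fun setT (fun x : V => dotp (th'.1 + zeta0) x / tau + width t tau r zeta0 th'.1 * th'.2.1).
    apply: measurable_funD => //; apply: measurable_funM => //.
    have := measurable_dotpl (th'.1 + zeta0); congr measurable_fun.
    by apply/funext => x; exact: dotpC.
  apply: cmeasM; first apply: cmeasM.
  - exact: cmeas_comp msigma ml.
  - by apply: (cmeas_comp (line_cmeas (smooth_cmeas varphiS.1))); exact: measurable_funB.
  apply: (cmeas_comp (smooth_cmeas phiS.1)).
  have := measurable_affine 1 (- th'.2.2); congr measurable_fun.
  by apply/funext => x; rewrite scale1r.
have mFx al x : cmeas (fun th' => F g al th' x).
  exact: (feature_family_cmeas mg al (@measurable_id _ _ setT) (measurable_cst x)).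
have mFth al th' : cmeas (fun x => F g al th' x).
  exact: (feature_family_cmeas mg al (measurable_cst th') (@measurable_id _ _ setT)).
have G_le al x : modulus (G al x) <= 2 * \int[mTheta]_th' rho th'.
  by apply: (le_modulus_cintegral (mFx al x) irho) => th'; exact: FR.
have mD al : cmeas (h al).
  apply: cmeasB => //; apply: cmeas_sum => j; apply: cmeasM => //; exact: cmeas_cst.
have reph al : (order al <= n)%N -> represents Omega
    (dist_mpartial (fun i => al i) (fun psi => u psi - functional_of fN psi)) (h al).
  move=> aln; split.
    apply: (bounded_loc_integrable (M := 2 * \int[mTheta]_th' rho th' + \sum_(j < N) `|a j| * rho (th j))) => // x.
    apply: le_trans (modulusD _ _) _; apply: lerD => //.
    rewrite modulusN; elim/big_ind2: _ => [|z1 y1 z2 y2 h1 h2|j _].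
    - by rewrite modulus0.
    - by apply: le_trans (modulusD _ _) _; exact: lerD.
    by rewrite modulusM modulus_real ler_wpM2l.
  move=> psi tpsi; have ct := test_function_ctest tpsi.
  have psi0 x : ~ Omega x -> psi x = 0.
    by move=> nOx; have [_ [K' [_ KO K0]]] := tpsi; apply: K0 => /KO.
  rewrite cintegral_support => [|x /psi0 ->]; last by rewrite mulr0.
  set q := mpartial (fun i => al i) psi.
  have cq : ctest q by rewrite /q mpartial_seq; exact: ctest_foldr.
  pose Tj (j : 'I_N) x := (a j)%:C%C * dens g (th j) * atom_of (th j) x * q x.
  have TjP j : cintegrable (leb d) setT (Tj j) /\
      cintegral (leb d) setT (Tj j) =
        (-1) ^+ order al * ((a j)%:C%C * cintegral (leb d) setT (fun x => F g al (th j) x * psi x)).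
    (* Sampled parameters are known to be good only where the coefficient is nonzero. *)
    have [aj0|aj] := eqVneq (a j) 0.
      have -> : Tj j = fun=> 0 by apply/funext => x; rewrite /Tj aj0 !mul0r.
      by rewrite cintegral0 aj0 mul0r mulr0; split => //; split; exact: integrable0.
    have [ib eb] := feature_ibp g (th j) aln tpsi.
    have gj : good (th j) := ga j (ltn_ord j) aj.
    have ib' := cintegrableZ (a j)%:C%C ib.
    have mT : cmeas (Tj j).
      apply: cmeasM; last exact: ctest_cmeas.
      by apply: cmeasM => //; exact: cmeas_cst.
    have eT : {ae leb d, forall x, Tj j x = (a j)%:C%C * (dens g (th j) * feat [::] (th j) x * q x)}.
      by apply: filterS gj => x; rewrite /Tj => ->; rewrite !mulrA.
    split; first exact: ae_cintegrable mT ib' eT.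
    by rewrite (ae_eq_cintegral mT (cintegrable_cmeas ib') eT) cintegralZ // eb mulrCA.
  have iG : cintegrable (leb d) setT (fun x => G al x * psi x).
    exact: (cintegrableMl (mG al) (G_le al) (ctest_cintegrable ct)).
  have iFj j : cintegrable (leb d) setT (fun x => (a j)%:C%C * (F g al (th j) x * psi x)).
    apply: cintegrableZ; exact: (cintegrableMl (mFth al (th j)) (FR al (th j)) (ctest_cintegrable ct)).
  rewrite /dist_mpartial (weak_derivative_synthesis mg ig Hu aln tpsi).
  have -> : functional_of fN q = \sum_(j < N) (-1) ^+ order al *
      ((a j)%:C%C * cintegral (leb d) setT (fun x => F g al (th j) x * psi x)).
    transitivity (\sum_(j < N) cintegral (leb d) setT (Tj j)); last first.
      by apply: eq_bigr => j _; rewrite (TjP j).2.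
    rewrite -cintegral_sum => [|j]; last exact: (TjP j).1.
    by apply: eq_cintegral => x; rewrite /fN mulr_suml.
  rewrite -mulr_sumr -mulrBr -/(order al) mulrA -expr2 sqrr_sign mul1r.
  transitivity (cintegral (leb d) setT (fun x =>
      G al x * psi x - \sum_(j < N) (a j)%:C%C * (F g al (th j) x * psi x))).
    rewrite cintegralB // ?cintegral_sum //; last exact: cintegrable_sum.
    congr (_ - _); apply: eq_bigr => j _; rewrite cintegralZ //.
    exact: (cintegrableMl (mFth al (th j)) (FR al (th j)) (ctest_cintegrable ct)).
  apply: eq_cintegral => x; rewrite /h mulrBl mulr_suml; congr (_ - _).
  by apply: eq_bigr => j _; rewrite mulrA.
apply: le_trans (ereal_inf_lbound _) _; first by exists fN.
apply: le_trans (ereal_inf_lbound _) _; first by exists h.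
pose m := \int[mTheta]_th' rho th'.
pose K0 := 12 * p * m / Num.sqrt N%:R.
have m0 : 0 <= m by exact: Rintegral_ge0.
have K00 : 0 <= K0 by rewrite divr_ge0 ?sqrtr_ge0 // !mulr_ge0 // ltW.
have LpB al : (Lp_norm Omega p%:E (h al) `^ p <= (K0 `^ p * B)%:E)%E.
  rewrite poweR_Lnorm ?gt_eqF //; apply: le_trans (hDa al).
  apply: ge0_le_integral => //.
  - by move=> x _; exact: poweR_ge0.
  - have mI : measurable_fun setT (fun x => `|modulus (h al x) * \1_Omega x|).
      apply: measurableT_comp => //; apply: measurable_funM; first exact: measurable_modulus.
      exact: measurable_indic.
    rewrite (_ : (fun _ => _) = EFin \o (fun x => `|modulus (h al x) * \1_Omega x| `^ p)).
      by apply/measurable_EFinP; exact: (measurableT_comp (measurable_powR p) mI).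
    by apply/funext => x; exact: poweR_EFin.
  - by apply/measurable_EFinP; exact: (measurableT_comp (measurable_powR p) (measurable_modulus (mD al))).
  move=> x _; rewrite poweR_EFin lee_fin; apply: ge0_ler_powR;
      rewrite ?nnegrE ?modulus_ge0 ?normr_ge0 ?(ltW p_gt0) //.
  rewrite normrM ger0_norm ?modulus_ge0 // ler_piMr ?modulus_ge0 // indicE.
  by case: (_ \in _); rewrite ?normr1 ?normr0.
apply: (@le_trans _ _ ((#|J|%:R * (K0 `^ p * B))%:E `^ p^-1)%E).
  apply: gt0_ler_poweR; rewrite ?invr_ge0 ?(ltW p_gt0) ?in_itv /= ?leey ?andbT //.
  - by apply: sume_ge0 => al _; exact: poweR_ge0.
  - by rewrite lee_fin mulr_ge0 // mulr_ge0 ?powR_ge0.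
  apply: (@le_trans _ _ (\sum_(al : J) (K0 `^ p * B)%:E)%E).
    rewrite big_mkcond /=; apply: lee_sum => al _; case: ifP => _ //.
    by rewrite lee_fin mulr_ge0 ?powR_ge0.
  by rewrite sumEFin sumr_const mulr_natl.
rewrite poweR_EFin lee_fin mulrCA (powRM _ (powR_ge0 _ _) (mulr_ge0 (ler0n _ _) B0)).
rewrite -powRrM mulfV ?gt_eqF // powRr1 // /K0 /m RintegralZl //; last exact: integrable_feature_wt.
rewrite Rintegral_feature_wt // /K le_eqVlt; apply/orP; left; apply/eqP.
by set P := _ `^ _; ring.
Qed.

End barron_synthesis.

(** * Choice of the bump and of the constants *)

Section main_estimate.
Context {R : realType} {d : nat}.
Local Notation V := 'rV[R]_d.
Variables (n k : nat) (Omega : set V) (sigma varphi : R -> R[i]) (phi : V -> R[i]) (t tau r : R).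

Local Notation D := (stft_dictionary sigma varphi phi t tau).

(** If 0 is the only test function, representing a weak derivative is a condition at 0 alone, which
    linearity of [f] settles; zero coefficients and zero derivatives then have norm 0. *)
Lemma approx_error_degenerate (f : @functional R d) N : tempered f -> 0 < r ->
  (forall psi, test_function Omega psi -> psi = cst 0) ->
  (approx_error n r Omega f (span_N N D) <= 0)%E.
Proof.
move=> [flin _] r0 triv.
have f0 : f (cst 0) = 0.
  have s0 : schwartz (cst 0 : V -> R[i]).
    apply: ctest_schwartz; apply/ctestP; split; last by exists 0.
    by apply/smoothP; split; exact: rsmooth_cst.
  have := flin (-1) _ _ s0 s0; rewrite mulN1r addNr => {2}<-.
  by congr f; apply/funext => x; rewrite /= mulr0 addr0.
have sum0 (h : 'I_N -> V -> R[i]) : (fun x => \sum_(j < N) 0 * h j x) = cst 0.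
  by apply/funext => x; rewrite big1 // => j _; rewrite mul0r.
apply: le_trans (ereal_inf_lbound _) _.
  exists (cst 0) => //; exists (fun=> 0), (fun=> fun x => sigma (dotp 0 x / tau + 0) *
    varphi (dotp 0 x / tau + 0 - t) * phi (x - 0)); split => [j|]; last by rewrite sum0.
  by exists 0, 0, 0.
apply: le_trans (ereal_inf_lbound _) _.
  exists (fun _ => cst 0) => //= a _; split.
    apply: (bounded_loc_integrable (M := 0)); first exact: cmeas_cst.
    by move=> x; rewrite modulus0.
  move=> psi /triv ->.
  have m0 : mpartial (fun i => a i) (cst 0 : V -> R[i]) = cst 0.
    rewrite mpartial_seq; apply/funext => x.
    by apply: (foldr_partial_eq0 (U := setT)) => //; exact: openT.
  have I0 : cintegral (leb d) setT (fun x : V => (0 : R[i]) * 0) = 0.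
    by under eq_cintegral do rewrite mul0r; exact: cintegral0.
  rewrite /dist_mpartial m0 f0 /functional_of cintegral_support => [|x _]; last exact: mulr0.
  by rewrite I0 subr0 mulr0.
have L0 : Lp_norm Omega r%:E (cst 0 : V -> R[i]) = 0%E.
  rewrite /Lp_norm -[RHS](Lnorm0 (leb d) (_ : r%:E != 0)%E); last by rewrite eqe gt_eqF.
  by apply: eq_Lnorm => x; rewrite modulus0 mul0r.
rewrite big1 ?poweR0r ?invr_neq0 ?gt_eqF // => a _.
by rewrite L0 poweR0r // gt_eqF.
Qed.

Hypotheses (d_gt0 : (0 < d)%N) (Omega_dom : bounded_domain Omega).
Hypotheses (sigmaW : sobolev k +oo%E setT (on_line sigma)) (le_nk : (n <= k)%N).
Hypotheses (varphiS : schwartz (on_line varphi)) (varphi_real : forall x, complex.Im (varphi x) = 0).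
Hypotheses (phiS : schwartz phi) (phi_neq0 : phi <> cst 0) (tau_neq0 : tau != 0).
Hypotheses (stft_neq0 : stft varphi sigma t tau != 0) (r_ge2 : 2 <= r).

Let barron_integral (g : V -> R[i]) : \bar R :=
  (\int[leb d]_xi ((1 + enorm xi) `^ n.+1%:R * modulus (g xi))%:E)%E.

Lemma approx_error_representative : exists2 K, 0 < K & forall (f : @functional R d) g N,
  tempered f -> represents setT (dist_fourier f) g -> (0 < N)%N ->
  (approx_error n r Omega f (span_N N D) <= (K * N%:R `^ (- 2^-1))%:E * barron_integral g)%E.
Proof.
have r0 : 0 < r by rewrite (lt_le_trans _ r_ge2).
have [triv|] := pselect (forall psi, test_function Omega psi -> psi = cst 0).
  exists 1 => // f g N ft _ _; apply: le_trans (approx_error_degenerate N ft r0 triv) _.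
  rewrite mule_ge0 ?lee_fin ?mul1r ?powR_ge0 //; apply: integral_ge0 => xi _.
  by rewrite lee_fin mulr_ge0 ?powR_ge0 ?modulus_ge0.
move=> /existsNP[psi /not_implyP[tpsi psi_neq0]].
have [x0 psix0] : exists x0, psi x0 != 0.
  by apply: contrapT => h; apply: psi_neq0; apply/funext => x; apply: contrapT => /eqP hx; apply: h; exists x.
pose theta x := complex.Re (psi x) ^+ 2 + complex.Im (psi x) ^+ 2.
have [t1 t2] := test_function_ctest tpsi.
have ttheta : rtest theta by exact: (rtestD (rtestM t1 t1.1) (rtestM t2 t2.1)).
have theta0 x : 0 <= theta x by rewrite addr_ge0 ?sqr_ge0.
have thetax0 : theta x0 != 0.
  apply: contra psix0; rewrite /theta paddr_eq0 ?sqr_ge0 // !sqrf_eq0 => /andP[/eqP h1 /eqP h2].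
  by apply/eqP; exact: eq_complexP.
(* A one-variable bump is cut from [theta] along a coordinate line through [x0]; [d_gt0] supplies
   the direction. *)
pose i0 : 'I_d := Ordinal d_gt0.
pose rho (v : 'rV[R]_1) := theta (x0 + v 0 0 *: delta_mx 0 i0).
have trho : rtest rho.
  split; first exact: (rsmooth_comp (axial_line x0 i0) ttheta.1).
  have [_ [b hb]] := ttheta; exists (b + `|x0|) => v vb; apply: hb.
  have vE : `|v| <= `|x0 + v 0 0 *: delta_mx 0 i0| + `|x0|.
    apply: le_trans (ler_normB _ _); rewrite addrAC subrr add0r.
    apply: rV_norm_le => // j; rewrite (ord1 j).
    by have := rV_coord_le_norm (v 0 0 *: delta_mx 0 i0 : V) i0; rewrite !mxE !eqxx mulr1.
  lra.
have rho_mass : 0 < \int[leb 1]_v rho v.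
  apply: (integral_gt0 (x0 := 0) (rtest_continuous trho) (rtest_integrable trho)) => [v|].
    exact: theta0.
  by rewrite /rho mxE scale0r addr0 lt_def thetax0 theta0.
have [H [M [M0 mH HM Hs Hw]]] := sobolev_ridge_chain trho rho_mass sigmaW.
have [xi0 fphi] : exists xi, fourier phi xi != 0.
  have [C C0 hC] := schwartz_wt [::] phiS.
  have [c1 c2 _] := phiS.1 [::].
  exact: (fourier_neq0 ttheta theta0 thetax0 (smooth_cmeas phiS.1) hC c1 c2 phi_neq0).
pose c := \int[leb d]_z kern theta z.
have c_gt0 : 0 < c := kern_mass_gt0 ttheta theta0 thetax0.
(* The quotient of the two constants in [tempered_repr]. *)
pose kap : R[i] := (autocor theta 0)%:C%C / c%:C%C.
have msigma : cmeas sigma := line_cmeas (loc_integrable_cmeas sigmaW.1).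
have stftE : cintegral (@lebesgue_measure R) setT
    (fun s => H 0%N s * varphi (s - t) * cexp (- (2 * pi * s * tau))) = stft varphi sigma t tau.
  have mv := line_cmeas (smooth_cmeas varphiS.1).
  have mvt : cmeas (fun s : measurableTypeR R => varphi (s - t)) by apply: (cmeas_comp mv); exact: measurable_funB.
  have me : cmeas (fun s : measurableTypeR R => cexp (- (2 * pi * s * tau))).
    by apply: cmeas_cexp; apply: measurableT_comp => //; do 2 apply: measurable_funM => //.
  apply: ae_eq_cintegral.
  - exact: (cmeasM (cmeasM (mH 0%N) mvt) me).
  - exact: (cmeasM (cmeasM msigma (cmeas_conj mvt)) me).
  apply: (@filterS _ _ (ae_filter_ringOfSetsType _) _ _ _ Hs) => s ->.
  (* The short-time transform conjugates its window, and [varphi] is real. *)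
  by congr (_ * _ * _); apply: eq_complexP; rewrite ?cReJ ?cImJ // varphi_real oppr0.
have [oO [b [_ /(_ (`|b| + 1)) Ob]]] : open Omega /\ bounded_set Omega by case: Omega_dom.
have {}Ob x : Omega x -> `|x| <= `|b| + 1 by apply: Ob; rewrite (le_lt_trans (ler_norm _)) // ltrDl.
have b0 : 0 <= `|b| + 1 by rewrite addr_ge0.
(* [c0] divides out the two factors produced by the window integral; [zeta0] is [- xi0] because
   these involve the inverse transform of [phi]. *)
have c0E : kap / stft varphi sigma t tau / fourier phi xi0 * cintegral (@lebesgue_measure R) setT
    (fun s => H 0%N s * varphi (s - t) * cexp (- (2 * pi * s * tau))) * invfourier phi (- xi0) = kap.
  by rewrite stftE invfourierN; field; rewrite stft_neq0 fphi.
have [K K0 hK] := barron_sampling M0 mH HM msigma Hs (fun j a b i psi => Hw j d a b i psi)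
  varphiS phiS tau_neq0 b0 le_nk r0 oO Ob c0E.
(* A positive constant is required, and it makes the bound trivial when the Barron integral is
   infinite. *)
exists (K + 1); first by rewrite ltr_wpDl.
move=> f g N ft repg N0.
have mg : cmeas g := loc_integrable_cmeas repg.1.
have NE : N%:R `^ (- 2^-1) = (Num.sqrt N%:R)^-1 :> R by rewrite powRN powR12_sqrt.
have sN : 0 < Num.sqrt N%:R :> R by rewrite sqrtr_gt0 ltr0n.
have KN : 0 < (K + 1) * N%:R `^ (- 2^-1) by rewrite NE divr_gt0 // ltr_wpDl.
have menorm : measurable_fun setT (@enorm R d).
  apply: measurableT_comp; first by apply: continuous_measurable_fun; exact: sqrt_continuous.
  by apply: measurable_sum => i; apply: measurable_funM; exact: measurable_coord.
have mI : measurable_fun setT (fun xi => (1 + enorm xi) `^ n.+1%:R * modulus (g xi)).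
  apply: measurable_funM; last exact: measurable_modulus.
  by apply: (measurableT_comp (measurable_powR _)); exact: measurable_funD.
have I0 xi : 0 <= (1 + enorm xi) `^ n.+1%:R * modulus (g xi) by rewrite mulr_ge0 ?powR_ge0 ?modulus_ge0.
have [Iy|Iy] := ltP (barron_integral g) +oo%E; last first.
  by move: Iy; rewrite leye_eq => /eqP ->; rewrite gt0_muley ?lte_fin // leey.
have iI : (leb d).-integrable setT (EFin \o (fun xi => (1 + enorm xi) `^ n.+1%:R * modulus (g xi))).
  apply/integrableP; split; first exact/measurable_EFinP.
  by under eq_integral do rewrite /= ger0_norm //.
have le_wt xi : modulus (g xi) * (1 + `|xi|) ^+ n.+1 <= (1 + enorm xi) `^ n.+1%:R * modulus (g xi).
  rewrite mulrC ler_wpM2r ?modulus_ge0 // powR_mulrn ?addr_ge0 ?sqrtr_ge0 //.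
  by rewrite lerXn2r ?nnegrE ?addr_ge0 ?sqrtr_ge0 // lerD2l norm_le_enorm.
have wt0 xi : 0 <= modulus (g xi) * (1 + `|xi|) ^+ n.+1.
  by rewrite mulr_ge0 ?modulus_ge0 // exprn_ge0 // addr_ge0.
have ig : (leb d).-integrable setT (EFin \o (fun xi => modulus (g xi) * (1 + `|xi|) ^+ n.+1)).
  apply: (le_integrable measurableT _ _ iI).
    apply/measurable_EFinP; apply: measurable_funM; first exact: measurable_modulus.
    apply: measurable_funX; apply: measurable_funD => //.
    by apply: continuous_measurable_rV => x; exact: norm_continuous.
  by move=> xi _; rewrite /= lee_fin !ger0_norm.
have cg : cintegrable (leb d) setT g.
  apply: (le_cintegrable mg ig) => xi; rewrite ler_peMr ?modulus_ge0 //.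
  by rewrite exprn_ege1 // lerDl.
have Hu q : ctest q -> f q = kap * cintegral (leb d) setT (fun xi => g xi * invfourier q xi).
  move=> tq; have := tempered_repr ttheta ft repg cg tq => E.
  have c0 : c%:C%C != 0 :> R[i].
    by rewrite -(rmorph0 (real_complex R)) (inj_eq (@complexI R)) gt_eqF.
  by apply: (mulfI c0); rewrite [LHS]E /kap mulrA [_ * (_ / _)]mulrC divfK.
apply: le_trans (hK f g N mg ig Hu N0) _.
rewrite NE; apply: (@le_trans _ _ ((K + 1) / Num.sqrt N%:R * fine (barron_integral g))%:E).
  have hI : \int[leb d]_xi (modulus (g xi) * (1 + `|xi|) ^+ n.+1) <= fine (barron_integral g).
    exact: (le_Rintegral measurableT ig iI (fun xi _ => le_wt xi)).
  rewrite lee_fin mulrAC; apply: ler_pM => //; first by rewrite divr_ge0 // ltW.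
  - exact: Rintegral_ge0.
  - by rewrite ler_wpM2r ?invr_ge0 ?(ltW sN) // lerDl.
rewrite EFinM fineK // ge0_fin_numE //.
by apply: integral_ge0 => xi _; rewrite lee_fin.
Qed.

(** The Barron norm is an infimum over representatives of the transform; a bound by a fixed positive
    multiple of each integral passes to the infimum. *)
Lemma approx_error_barron : exists2 K, 0 < K & forall (f : @functional R d) N,
  tempered f -> (0 < N)%N ->
  (approx_error n r Omega f (span_N N D) <=
   (K * N%:R `^ (- 2^-1))%:E * barron_norm n.+1%:R f)%E.
Proof.
have [K K0 hK] := approx_error_representative; exists K => // f N ft N0.
have c0 : 0 < K * N%:R `^ (- 2^-1) by rewrite mulr_gt0 // powR_gt0 // ltr0n.
rewrite -lee_pdivrMl //; apply: le_ereal_inf_tmp => _ [g repg <-].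
by rewrite lee_pdivrMl //; exact: hK.
Qed.

End main_estimate.

Theorem corollary23 (R : realType) (d n k : nat) (Omega : set 'rV[R]_d)
    (sigma varphi : R -> R[i]) (phi : 'rV[R]_d -> R[i]) (t tau : R)
    (d_gt0 : (0 < d)%N)
    (Omega_dom : bounded_domain Omega)
    (sigmaW : sobolev k +oo%E setT (on_line sigma))
    (sigma_neq0 : ~ (\forall x \ae @lebesgue_measure R, sigma x = 0))
    (le_nk : (n <= k)%N)
    (varphiS : schwartz (on_line varphi))
    (varphi_neq0 : varphi <> cst 0)
    (varphi_real : forall x, complex.Im (varphi x) = 0)
    (phiS : schwartz phi)
    (phi_neq0 : phi <> cst 0)
    (tau_neq0 : tau != 0)
    (stft_neq0 : stft varphi sigma t tau != 0)
    (r : R) (r_ge2 : 2 <= r)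
    (f : functional) (fB : barron n.+1%:R f) :
  let D := stft_dictionary sigma varphi phi t tau in
  (exists2 C : R, 0 < C & forall N : nat, (0 < N)%N ->
    (approx_error n r Omega f (span_N N D) <=
       (C * N%:R `^ (- 2^-1))%:E * leb d (sumset Omega Omega)
         * barron_norm n.+1%:R f)%E) /\
  (convex_set Omega ->
   exists2 C : R, 0 < C & forall N : nat, (0 < N)%N ->
    (approx_error n r Omega f (span_N N D) <=
       (2 * C * N%:R `^ (- 2^-1))%:E * leb d Omega
         * barron_norm n.+1%:R f)%E).
Proof.
move=> D.
have [K K0 hK] := approx_error_barron d_gt0 Omega_dom sigmaW le_nk varphiS varphi_real phiS
  phi_neq0 tau_neq0 stft_neq0 r_ge2.
have [[x0 Ox0] oO [b [_ /(_ (`|b| + 1)) Ob]]] :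
  [/\ Omega !=set0, open Omega & bounded_set Omega] by case: Omega_dom.
have {}Ob x : Omega x -> `|x| <= `|b| + 1.
  by apply: Ob; rewrite (le_lt_trans (ler_norm _)) // ltrDl.
(* [C] may depend on [Omega]. A nonempty bounded open set has positive finite measure, so the volume
   factor can be divided into the constant, for [Omega] and for the sumset alike. *)
have volume A M : open A -> A !=set0 -> (forall x, A x -> `|x| <= M) ->
    exists2 l : R, 0 < l & leb d A = l%:E.
  move=> oA A0 AM.
  have lt := leb_bounded_lty (open_measurable_rV oA) AM.
  have gt := leb_open_gt0 oA A0.
  exists (fine (leb d A)); first by rewrite fine_gt0 // gt lt.
  by rewrite fineK // ge0_fin_numE // ltW.
split=> [|_].
  have [l l0 ->] : exists2 l : R, 0 < l & leb d (sumset Omega Omega) = l%:E.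
    apply: (volume _ (2 * (`|b| + 1)) (open_sumset oO)); first by exists (x0 + x0), x0 => //; exists x0.
    move=> _ [x Ox [y Oy <-]]; apply: le_trans (ler_normD _ _) _.
    have := Ob x Ox; have := Ob y Oy; lra.
  exists (K / l) => [|N N0]; first exact: divr_gt0.
  apply: le_trans (hK f N fB.1 N0) _; rewrite -EFinM.
  by rewrite (_ : K / l * _ * l = K * N%:R `^ (- 2^-1)) //; field; rewrite gt_eqF.
have [l l0 ->] := volume _ _ oO (ex_intro _ x0 Ox0) Ob.
exists (K / (2 * l)) => [|N N0]; first by rewrite divr_gt0 // mulr_gt0.
apply: le_trans (hK f N fB.1 N0) _; rewrite -EFinM.
by rewrite (_ : 2 * _ * _ * l = K * N%:R `^ (- 2^-1)) //; field; rewrite gt_eqF.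
Qed.
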